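(* Let $H$ be a finite-dimensional pointed Hopf algebra over a field $k$ such that $H_{\mathrm{ab}}$ is (isomorphic as a Hopf algebra to) a group algebra. Then $\mathcal{B}_H$ is isomorphic to a localization $T^{-1}k[x_1,\dots,x_m]$ of a polynomial algebra in finitely many variables.
   Context: A Hopf algebra is pointed if every simple subcoalgebra is one-dimensional. $H_{\mathrm{ab}}$ denotes the largest commutative Hopf algebra quotient of $H$. Sweedler notation $\Delta(x)=x_1\otimes x_2$. Let $t_H=\{t_x: x\in H\}$ be a copy of the vector space $H$ ($x\mapsto t_x$ linear isomorphism), $S(t_H)$ its symmetric algebra, and $x\mapsto t^{-1}_x$ the unique linear map from $H$ to $\mathrm{Frac}\,S(t_H)$ with $t_{x_1}t^{-1}_{x_2}=t^{-1}_{x_1}t_{x_2}=\varepsilon(x)1$. The generic base algebra $\mathcal{B}_H$ is the subalgebra of $\mathrm{Frac}\,S(t_H)$ generated by all $\sigma(x,y)=t_{x_1}t_{y_1}t^{-1}_{x_2y_2}$ and $\sigma^{-1}(x,y)=t_{x_1y_1}t^{-1}_{x_2}t^{-1}_{y_2}$, $x,y\in H$. *)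

(* Defs.v *)
(* Finite-dimensional Hopf algebras are encoded by structure
   constants with respect to a fixed basis e_0..e_{n-1} of H = F^n (row vectors). *)
From HB Require Import structures.
From mathcomp Require Import all_boot all_order all_algebra all_fingroup.
From mathcomp Require Import mpoly fraction.
Set Implicit Arguments.
Unset Strict Implicit.
Unset Printing Implicit Defensive.
Import GRing.Theory.
Local Open Scope ring_scope.

Record hopf_data (F : fieldType) (n : nat) := HopfData {
  hm : 'I_n -> 'I_n -> 'rV[F]_n;   (* e_i * e_j *)
  hu : 'rV[F]_n;                   (* unit 1_H *)
  hd : 'I_n -> 'M[F]_n;            (* Delta(e_i) = sum_{a,b} (hd i) a b e_a (x) e_b *)
  he : 'I_n -> F;                  (* counit eps(e_i) *)
  hs : 'M[F]_n                     (* antipode S(x) = x *m hs *)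
}.

Section HopfOps.
Variables (F : fieldType) (n : nat) (H : hopf_data F n).

Definition bvec (i : 'I_n) : 'rV[F]_n := delta_mx 0 i.

Definition hmul (x y : 'rV[F]_n) : 'rV[F]_n :=
  \sum_(i < n) \sum_(j < n) (x 0 i * y 0 j) *: hm H i j.

(* Delta(x), as the n x n coefficient matrix on the basis e_a (x) e_b *)
Definition hcomul (x : 'rV[F]_n) : 'M[F]_n := \sum_(i < n) x 0 i *: hd H i.

Definition hcounit (x : 'rV[F]_n) : F := \sum_(i < n) x 0 i * he H i.

Definition hanti (x : 'rV[F]_n) : 'rV[F]_n := x *m hs H.

(* product in H (x) H : (e_a (x) e_b)(e_c (x) e_d) = e_a e_c (x) e_b e_d *)
Definition tmul (D E : 'M[F]_n) : 'M[F]_n :=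
  \sum_(a < n) \sum_(b < n) \sum_(c < n) \sum_(d < n)
     (D a b * E c d) *: ((hmul (bvec a) (bvec c))^T *m hmul (bvec b) (bvec d)).

Definition mul_tensor (f g : 'rV[F]_n -> 'rV[F]_n) (D : 'M[F]_n) : 'rV[F]_n :=
  \sum_(a < n) \sum_(b < n) D a b *: hmul (f (bvec a)) (g (bvec b)).

Definition is_hopf : Prop :=
  [/\
      (forall x y z, hmul (hmul x y) z = hmul x (hmul y z)) /\
      (forall x, hmul (hu H) x = x /\ hmul x (hu H) = x),
      (* coassociativity: (Delta (x) id) Delta = (id (x) Delta) Delta *)
      (forall x (a b c : 'I_n),
         \sum_(j < n) hcomul x j c * hd H j a b
         = \sum_(l < n) hcomul x a l * hd H l b c),
      (forall x (l : 'I_n), \sum_(j < n) hcomul x j l * he H j = x 0 l) /\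
      (forall x (j : 'I_n), \sum_(l < n) hcomul x j l * he H l = x 0 j),
      [/\ (forall x y, hcomul (hmul x y) = tmul (hcomul x) (hcomul y)),
          hcomul (hu H) = (hu H)^T *m hu H,
          (forall x y, hcounit (hmul x y) = hcounit x * hcounit y) &
          hcounit (hu H) = 1] &
      (forall x, mul_tensor hanti id (hcomul x) = hcounit x *: hu H /\
                 mul_tensor id hanti (hcomul x) = hcounit x *: hu H)].

Definition hopf_commutative : Prop := forall x y, hmul x y = hmul y x.

(* C (row space of the square matrix C) is a subcoalgebra: Delta(C) in C (x) C.
   Elements of C (x) C are exactly the tensors C^T *m M *m C. *)
Definition subcoalgebra (C : 'M[F]_n) : Prop :=
  forall x : 'rV[F]_n, (x <= C)%MS -> exists M : 'M[F]_n, hcomul x = C^T *m M *m C.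

Definition simple_subcoalgebra (C : 'M[F]_n) : Prop :=
  [/\ subcoalgebra C, C != 0 &
      forall D : 'M[F]_n, subcoalgebra D -> (D <= C)%MS -> D = 0 \/ (D == C)%MS].

Definition pointed : Prop :=
  forall C : 'M[F]_n, simple_subcoalgebra C -> \rank C = 1%N.

End HopfOps.
Arguments bvec {F n} i.

Definition hopf_morph (F : fieldType) (n m : nat) (H : hopf_data F n)
    (K : hopf_data F m) (P : 'M[F]_(n, m)) : Prop :=
  [/\ forall x y, hmul K (x *m P) (y *m P) = hmul H x y *m P,
      hu K = hu H *m P,
      forall x, hcomul K (x *m P) = P^T *m hcomul H x *m P,
      forall x, hcounit K (x *m P) = hcounit H x &
      forall x, hanti K (x *m P) = hanti H x *m P].

Definition hopf_iso (F : fieldType) (n m : nat) (H : hopf_data F n)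
    (K : hopf_data F m) (P : 'M[F]_(n, m)) : Prop :=
  [/\ hopf_morph H K P, row_free P & row_full P].

(* (Q, P) is the largest commutative Hopf algebra quotient H_ab of H:
   P : H ->> Q is a surjective Hopf map onto a commutative Hopf algebra
   through which every Hopf map to a commutative Hopf algebra factors
   (its kernel is contained in the kernel of every such map). *)
Definition is_abelianization (F : fieldType) (n m : nat) (H : hopf_data F n)
    (Q : hopf_data F m) (P : 'M[F]_(n, m)) : Prop :=
  [/\ is_hopf Q, hopf_commutative Q, hopf_morph H Q P, row_full P &
      forall (m' : nat) (K : hopf_data F m') (P' : 'M[F]_(n, m')),
        is_hopf K -> hopf_commutative K -> hopf_morph H K P' ->
        (kermx P <= kermx P')%MS].

Section GroupAlgebra.
Variables (F : fieldType) (gT : finGroupType).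
Local Notation N := #|gT|.
Definition gval (i : 'I_N) : gT := enum_val i.
Definition grank (g : gT) : 'I_N := enum_rank g.

Definition group_algebra : hopf_data F N :=
  HopfData
    (fun i j => delta_mx 0 (grank (gval i * gval j)%g))
    (delta_mx 0 (grank 1%g))
    (fun i => delta_mx i i)
    (fun _ => 1)
    (\matrix_(i, j) (j == grank (gval i)^-1%g)%:R).
End GroupAlgebra.

Section GenericBase.
Variables (F : fieldType) (n : nat) (H : hopf_data F n).

Local Notation FracT := {fraction {mpoly F[n]}}.

Definition fconst (c : F) : FracT := @FracField.tofrac _ (c%:MP).

(* t_x = sum_i x_i T_i, with T_i the polynomial variables (S(t_H) = F[T_0..T_{n-1}]) *)
Definition tvar (x : 'rV[F]_n) : FracT :=
  @FracField.tofrac _ (\sum_(i < n) x 0 i *: 'X_i).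

(* the linear map x |-> t^{-1}_x determined by its values u on the basis *)
Definition tinv_of (u : 'I_n -> FracT) (x : 'rV[F]_n) : FracT :=
  \sum_(i < n) fconst (x 0 i) * u i.

(* u defines t^{-1}: t_{x1} t^{-1}_{x2} = t^{-1}_{x1} t_{x2} = eps(x) 1 *)
Definition is_tinv (u : 'I_n -> FracT) : Prop :=
  forall x : 'rV[F]_n,
    \sum_(a < n) \sum_(b < n) fconst (hcomul H x a b) * (tvar (bvec a) * tinv_of u (bvec b))
      = fconst (hcounit H x) /\
    \sum_(a < n) \sum_(b < n) fconst (hcomul H x a b) * (tinv_of u (bvec a) * tvar (bvec b))
      = fconst (hcounit H x).

(* sigma(x,y) = t_{x1} t_{y1} t^{-1}_{x2 y2} *)
Definition gsigma (u : 'I_n -> FracT) (x y : 'rV[F]_n) : FracT :=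
  \sum_(a < n) \sum_(b < n) \sum_(c < n) \sum_(d < n)
    fconst (hcomul H x a b * hcomul H y c d) *
      (tvar (bvec a) * tvar (bvec c) * tinv_of u (hmul H (bvec b) (bvec d))).

(* sigma^{-1}(x,y) = t_{x1 y1} t^{-1}_{x2} t^{-1}_{y2} *)
Definition gsigmainv (u : 'I_n -> FracT) (x y : 'rV[F]_n) : FracT :=
  \sum_(a < n) \sum_(b < n) \sum_(c < n) \sum_(d < n)
    fconst (hcomul H x a b * hcomul H y c d) *
      (tvar (hmul H (bvec a) (bvec c)) * tinv_of u (bvec b) * tinv_of u (bvec d)).

(* B_H: the F-subalgebra of Frac S(t_H) generated by all sigma, sigma^{-1} *)
Definition in_BH (u : 'I_n -> FracT) (z : FracT) : Prop :=
  forall P : FracT -> Prop,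
    (forall c : F, P (fconst c)) ->
    (forall a b, P a -> P b -> P (a + b)) ->
    (forall a b, P a -> P b -> P (a * b)) ->
    (forall x y, P (gsigma u x y)) ->
    (forall x y, P (gsigmainv u x y)) ->
    P z.
End GenericBase.

Definition mult_subset (F : fieldType) (m : nat) (T : {mpoly F[m]} -> Prop) : Prop :=
  [/\ T 1, ~ T 0 & forall p q, T p -> T q -> T (p * q)].

Definition in_localization (F : fieldType) (m : nat) (T : {mpoly F[m]} -> Prop)
    (z : {fraction {mpoly F[m]}}) : Prop :=
  exists p t, T t /\ z = @FracField.tofrac _ p / @FracField.tofrac _ t.

(* F-algebra isomorphism between the subalgebras A of K1 and B of K2
   (F acting through the embeddings e1, e2) *)
Definition alg_iso_on (F : fieldType) (K1 K2 : fieldType)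
    (e1 : F -> K1) (e2 : F -> K2) (A : K1 -> Prop) (B : K2 -> Prop) : Prop :=
  exists (f : K1 -> K2) (g : K2 -> K1),
    [/\ (forall x, A x -> B (f x)) /\ (forall y, B y -> A (g y)),
        (forall x, A x -> g (f x) = x) /\ (forall y, B y -> f (g y) = y),
        f 1 = 1,
        (forall x y, A x -> A y -> f (x + y) = f x + f y /\ f (x * y) = f x * f y) &
        (forall (c : F) x, A x -> f (e1 c * x) = e2 c * f x)].

(* Main.v *)
Require Import Defs.
From HB Require Import structures.
From mathcomp Require Import all_boot all_order all_algebra all_fingroup.
From mathcomp Require Import mpoly fraction.
From mathcomp Require Import ring zify.
From Stdlib Require Import ClassicalEpsilon.
Set Implicit Arguments.
Unset Strict Implicit.
Unset Printing Implicit Defensive.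
Import GRing.Theory.
Local Open Scope ring_scope.

(* Write L for Frac S(t_H) and B for the generic base algebra. In the convolution
   rings Hom(H, L) and Hom(H (x) H, L) one has sigma = (t (x) t) * (t^-1 o m) and
   sigma^-1 = (t o m) * (t^-1 (x) t^-1), so t_x t_y = sigma(x1, y1) t_{x2 y2}: the
   B-span A of the t_x is a ring. A pointed H has a flag whose successive quotients
   are given by group-likes g, and t_g^-1 lies in A, so t^-1 takes values in A.

   The map H -> H_ab = F[G] is the quotient by the commutator ideal; it grades H,
   hence also A, by the abelian group G, and B lies in degree 0. Conversely B is all
   of the degree 0 part of A. Indeed, let f : A -> B/J be the B-linear coordinate of
   one generator t_x with x of degree 0. Then Psi(x) = t^-1_{x1} f(t_{x2}) satisfies
   Psi(xy) = t^-1_{x1} t^-1_{y1} f(t_{x2} t_{y2}), which is symmetric in x and y, so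
   Psi vanishes on the commutator ideal and f(t_x) = t_x Psi(1) = 0 modulo JA. This
   forces J = B, and the generator t_x can be dropped.

   Choose a homogeneous basis z_i of H containing one group-like g_h for each h in G.
   Monomials of degree 0 in the t_{z_i} are generated, up to inverting the t_{g_h}, by
   n of them: t_{z_i} t_{g_h} with h inverse to the degree of z_i, and a triangular
   basis of the lattice of relations in G. These are algebraically independent, and
   B is a localization of the polynomial algebra that they generate. *)

(** * Convolution rings *)

(** The main obstacle is that t_x with x of degree 0 should lie in B, while no formula exhibits it
    as a polynomial in the values of sigma; hence the indirect argument with the ideal J. It closes
    because A is a finite B-module containing the unit t_1: from JA = A the determinant trick yields
    J = B. H_ab is known only through its universal property. The quotient of H by the commutator
    ideal must therefore be shown to be a Hopf algebra before the kernel of H -> H_ab can be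
    compared with that ideal. Its antipode exists because S is antimultiplicative modulo the ideal,
    a consequence of the uniqueness of convolution inverses in a noncommutative ring. Pointedness
    enters through the flag: it reduces the inversion of t to the inversion of the elements t_g, and
    it lifts each element of G to a group-like element of H. Finiteness of G keeps exponents
    natural: |G| - 1 replaces -1, and t_g^-1 = t_g^(|G| - 1) / t_g^|G| has a denominator of degree
    0, so that degrees of fractions make sense. *)

Record coalg (F : fieldType) (I : finType) := Coalg {
  cd : I -> I -> I -> F;
  ce : I -> F;
  cdA : forall i a b c, \sum_j cd i j c * cd j a b = \sum_l cd i a l * cd l b c;
  ceL : forall i l, \sum_j cd i j l * ce j = (i == l)%:R;
  ceR : forall i j, \sum_l cd i j l * ce l = (i == j)%:R
}.

(** [R] may be noncommutative: values are taken in the fraction field and also, for the antipode of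
    the commutative quotient, in a matrix ring. *)
Record central (F : fieldType) (R : pzRingType) := Central {
  cm :> {rmorphism F -> R};
  cmC : forall c x, cm c * x = x * cm c
}.

(** A linear map from the coalgebra to [R], given on the basis. [C] and [iota] occur in the type
    only, where they select the convolution product. *)
Definition cv (F : fieldType) (I : finType) (C : coalg F I) (R : pzRingType)
  (iota : central F R) : Type := {ffun I -> R}.

Section Conv.
Variables (F : fieldType) (R : pzRingType) (iota : central F R).

Lemma cmMM c c' (x y : R) : iota c * x * (iota c' * y) = iota (c * c') * (x * y).
Proof. by rewrite rmorphM !mulrA -(mulrA (iota c)) -(cmC _ _ x) !mulrA. Qed.

Lemma cmMr c (x y : R) : x * (iota c * y) = iota c * (x * y).
Proof. by rewrite !mulrA cmC. Qed.

Lemma cm_suml (J : finType) (c : J -> F) (x : R) :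
  \sum_j iota (c j) * x = iota (\sum_j c j) * x.
Proof. by rewrite rmorph_sum mulr_suml. Qed.

Lemma sum_delta (J : finType) (i : J) (f : J -> R) :
  \sum_j iota (i == j)%:R * f j = f i.
Proof.
rewrite (bigD1 i) //= eqxx rmorph1 mul1r big1 ?addr0 // => j /negPf.
by rewrite eq_sym => ->; rewrite rmorph0 mul0r.
Qed.

Section OneCoalg.
Variables (I : finType) (C : coalg F I).
Local Notation cv := (cv C iota).

HB.instance Definition _ := GRing.Zmodule.on cv.

Definition cv_mul (f g : cv) : cv :=
  [ffun i => \sum_a \sum_b iota (cd C i a b) * (f a * g b)].
Definition cv_one : cv := [ffun i => iota (ce C i)].

Lemma cv_mulA : associative cv_mul.
Proof.
move=> f g h; apply/ffunP=> i; rewrite !ffunE.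
transitivity (\sum_a \sum_b \sum_c iota (\sum_l cd C i a l * cd C l b c)
                * (f a * g b * h c)).
  apply: eq_bigr => a _; under eq_bigr => l _.
    rewrite ffunE mulr_sumr mulr_sumr; under eq_bigr => b _.
      rewrite mulr_sumr mulr_sumr; under eq_bigr => c _.
        rewrite cmMr mulrA -rmorphM (mulrA (f a)); over.
      over.
    over.
  rewrite exchange_big /=; apply: eq_bigr => b _.
  by rewrite exchange_big /=; apply: eq_bigr => c _; rewrite cm_suml.
apply: esym; under eq_bigr => j _.
  under eq_bigr => c _.
    rewrite ffunE mulr_suml mulr_sumr; under eq_bigr => a _.
      rewrite mulr_suml mulr_sumr; under eq_bigr => b _.
        rewrite -mulrA mulrA -rmorphM; over.
      over.
    over.
  rewrite exchange_big; over.
rewrite exchange_big /=; apply: eq_bigr => a _.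
under eq_bigr => j _ do rewrite exchange_big.
rewrite exchange_big /=; apply: eq_bigr => b _.
rewrite exchange_big /=; apply: eq_bigr => c _.
by rewrite cm_suml cdA.
Qed.

Lemma cv_mul1l : left_id cv_one cv_mul.
Proof.
move=> f; apply/ffunP=> i; rewrite ffunE exchange_big /=.
rewrite -[RHS](sum_delta i f); apply: eq_bigr => b _.
rewrite -(ceL C) -cm_suml; apply: eq_bigr => a _.
by rewrite ffunE mulrA -rmorphM.
Qed.

Lemma cv_mul1r : right_id cv_one cv_mul.
Proof.
move=> f; apply/ffunP=> i; rewrite ffunE.
rewrite -[RHS](sum_delta i f); apply: eq_bigr => a _.
rewrite -(ceR C) -cm_suml; apply: eq_bigr => b _.
by rewrite ffunE -cmC mulrA -rmorphM.
Qed.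

Lemma cv_mulDl : left_distributive cv_mul +%R.
Proof.
move=> f g h; apply/ffunP=> i; rewrite !ffunE -big_split /=.
apply: eq_bigr => a _; rewrite -big_split /=; apply: eq_bigr => b _.
by rewrite !ffunE mulrDl mulrDr.
Qed.

Lemma cv_mulDr : right_distributive cv_mul +%R.
Proof.
move=> f g h; apply/ffunP=> i; rewrite !ffunE -big_split /=.
apply: eq_bigr => a _; rewrite -big_split /=; apply: eq_bigr => b _.
by rewrite !ffunE mulrDr mulrDr.
Qed.

HB.instance Definition _ := GRing.Zmodule_isPzRing.Build cv
  cv_mulA cv_mul1l cv_mul1r cv_mulDl cv_mulDr.

Lemma cvM (f g : cv) i :
  (f * g) i = \sum_a \sum_b iota (cd C i a b) * (f a * g b).
Proof. by rewrite /GRing.mul /= ffunE. Qed.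

Lemma cv1 i : (1 : cv) i = iota (ce C i).
Proof. by rewrite /GRing.one /= ffunE. Qed.

Lemma cvD (f g : cv) i : (f + g) i = f i + g i.
Proof. by rewrite ffunE. Qed.

Lemma cv0 i : (0 : cv) i = 0.
Proof. by rewrite ffunE. Qed.

Lemma cv_sum (J : Type) (r : seq J) (P : pred J) (f : J -> cv) i :
  (\sum_(j <- r | P j) f j) i = \sum_(j <- r | P j) f j i.
Proof. by elim/big_rec2: _ => [|j x y _ <-]; rewrite (cv0, cvD). Qed.

End OneCoalg.

Section Pull.
Variables (I J : finType) (C : coalg F I) (D : coalg F J) (M : I -> J -> F).

Definition coalg_morph :=
  (forall i a b, \sum_j M i j * cd D j a b =
     \sum_a' \sum_b' cd C i a' b' * (M a' a * M b' b)) /\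
  (forall i, \sum_j M i j * ce D j = ce C i).

(** Precomposition with the linear map of matrix [M]; a ring morphism when [M] is a coalgebra
    morphism. *)
Definition pull (f : cv D iota) : cv C iota := [ffun i => \sum_j iota (M i j) * f j].

Lemma pullE f i : pull f i = \sum_j iota (M i j) * f j.
Proof. by rewrite ffunE. Qed.

Lemma pullD f g : pull (f + g) = pull f + pull g.
Proof.
apply/ffunP=> i; rewrite cvD !pullE -big_split /=.
by apply: eq_bigr => j _; rewrite cvD mulrDr.
Qed.

Lemma pull0 : pull 0 = 0.
Proof.
by apply/ffunP=> i; rewrite cv0 !pullE big1 // => j _; rewrite cv0 mulr0.
Qed.

Lemma pull_sum (K : Type) (r : seq K) (P : pred K) (f : K -> cv D iota) :
  pull (\sum_(j <- r | P j) f j) = \sum_(j <- r | P j) pull (f j).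
Proof. by elim/big_rec2: _ => [|j x y _ <-]; rewrite (pull0, pullD). Qed.

Hypothesis MP : coalg_morph.

Lemma pullM f g : pull (f * g) = pull f * pull g.
Proof.
apply/ffunP=> i; rewrite pullE cvM.
transitivity (\sum_a \sum_b iota (\sum_j M i j * cd D j a b) * (f a * g b)).
  under eq_bigr => j _.
    rewrite cvM mulr_sumr; under eq_bigr => a _.
      rewrite mulr_sumr; under eq_bigr => b _ do rewrite mulrA -rmorphM.
      over.
    over.
  rewrite exchange_big /=; apply: eq_bigr => a _.
  by rewrite exchange_big /=; apply: eq_bigr => b _; rewrite cm_suml.
transitivity (\sum_a' \sum_b' \sum_a \sum_b
   iota (cd C i a' b' * (M a' a * M b' b)) * (f a * g b)); last first.
  apply: eq_bigr => a' _; apply: eq_bigr => b' _.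
  rewrite !pullE big_distrlr mulr_sumr; apply: eq_bigr => a _ /=.
  by rewrite mulr_sumr; apply: eq_bigr => b _; rewrite cmMM (rmorphM _ (cd _ _ _ _)) -mulrA.
under [RHS]eq_bigr => a' _ do rewrite exchange_big.
rewrite [RHS]exchange_big /=; apply: eq_bigr => a _.
under [RHS]eq_bigr => a' _ do rewrite exchange_big.
rewrite [RHS]exchange_big /=; apply: eq_bigr => b _.
rewrite MP.1 rmorph_sum mulr_suml; apply: eq_bigr => a' _.
by rewrite rmorph_sum mulr_suml.
Qed.

Lemma pull1 : pull 1 = 1.
Proof.
apply/ffunP=> i; rewrite pullE cv1 -MP.2 rmorph_sum.
by apply: eq_bigr => j _; rewrite cv1 -rmorphM.
Qed.

End Pull.
End Conv.

Lemma sum_pair (V : nmodType) (I J : finType) (f : I * J -> V) :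
  \sum_p f p = \sum_i \sum_j f (i, j).
Proof. by rewrite pair_bigA; apply: eq_bigr => -[]. Qed.

(** * Tensor products of coalgebras *)

Section Tensor.
Variables (F : fieldType) (I J : finType) (C : coalg F I) (D : coalg F J).

Definition tcd (i a b : I * J) := cd C i.1 a.1 b.1 * cd D i.2 a.2 b.2.
Definition tce (i : I * J) := ce C i.1 * ce D i.2.

Lemma tcdA i a b c :
  \sum_j tcd i j c * tcd j a b = \sum_l tcd i a l * tcd l b c.
Proof.
rewrite -(pair_bigA _ (fun j j' => tcd i (j, j') c * tcd (j, j') a b)) /=.
rewrite -(pair_bigA _ (fun j j' => tcd i a (j, j') * tcd (j, j') b c)) /=.
rewrite /tcd /=.
transitivity ((\sum_j cd C i.1 j c.1 * cd C j a.1 b.1) *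
              (\sum_j cd D i.2 j c.2 * cd D j a.2 b.2)).
  rewrite big_distrlr; apply: eq_bigr => j _; apply: eq_bigr => j' _ /=.
  by rewrite mulrACA.
rewrite !cdA big_distrlr; apply: eq_bigr => j _; apply: eq_bigr => j' _ /=.
by rewrite mulrACA.
Qed.

Lemma tceL i l : \sum_j tcd i j l * tce j = (i == l)%:R.
Proof.
rewrite -(pair_bigA _ (fun j j' => tcd i (j, j') l * tce (j, j'))) /=.
rewrite /tcd /tce /= -pair_eqE /= -mulnb natrM -(ceL C) -(ceL D) big_distrlr.
by apply: eq_bigr => j _; apply: eq_bigr => j' _ /=; rewrite mulrACA.
Qed.

Lemma tceR i l : \sum_j tcd i l j * tce j = (i == l)%:R.
Proof.
rewrite -(pair_bigA _ (fun j j' => tcd i l (j, j') * tce (j, j'))) /=.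
rewrite /tcd /tce /= -pair_eqE /= -mulnb natrM -(ceR C) -(ceR D) big_distrlr.
by apply: eq_bigr => j _; apply: eq_bigr => j' _ /=; rewrite mulrACA.
Qed.

Definition tens : coalg F (I * J)%type := Coalg tcdA tceL tceR.

(** The matrices of id (x) eps and eps (x) id: the convolution product of the two pullbacks is f (x)
    g. *)
Definition pr1 (i : I * J) (j : I) := (i.1 == j)%:R * ce D i.2.
Definition pr2 (i : I * J) (j : J) := (i.2 == j)%:R * ce C i.1.

Variables (R : pzRingType) (iota : central F R).

Lemma pr1E (f : cv C iota) i : pull tens pr1 f i = f i.1 * iota (ce D i.2).
Proof.
rewrite pullE -cmC -[in RHS](sum_delta iota i.1 f) mulr_sumr.
by apply: eq_bigr => j _; rewrite /pr1 mulrC rmorphM mulrA.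
Qed.

Lemma pr2E (f : cv D iota) i : pull tens pr2 f i = f i.2 * iota (ce C i.1).
Proof.
rewrite pullE -cmC -[in RHS](sum_delta iota i.2 f) mulr_sumr.
by apply: eq_bigr => j _; rewrite /pr2 mulrC rmorphM mulrA.
Qed.

Lemma pr12 (f : cv C iota) (g : cv D iota) i :
  (pull tens pr1 f * pull tens pr2 g) i = f i.1 * g i.2.
Proof.
rewrite cvM.
under eq_bigr => a _ do under eq_bigr => b _ do rewrite pr1E pr2E.
rewrite -(pair_bigA _ (fun a a' => \sum_b iota (tcd i (a, a') b) *
  (f a * iota (ce D a') * (g b.2 * iota (ce C b.1))))) /=.
transitivity (\sum_a \sum_a' \sum_b \sum_b' iota (cd C i.1 a b * ce C b) *
   (iota (cd D i.2 a' b' * ce D a') * (f a * g b'))).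
  apply: eq_bigr => a _; apply: eq_bigr => a' _.
  rewrite -(pair_bigA _ (fun b b' => iota (tcd i (a, a') (b, b')) *
  (f a * iota (ce D a') * (g b' * iota (ce C b))))) /=.
  apply: eq_bigr => b _; apply: eq_bigr => b' _.
  rewrite /tcd /= -!(cmC iota _ (f a)) -(cmC iota _ (g b')) cmMM.
  rewrite !mulrA -!rmorphM; congr (iota _ * _ * _).
  ring.
transitivity (\sum_a \sum_b' iota (\sum_b cd C i.1 a b * ce C b) *
   (iota (\sum_a' cd D i.2 a' b' * ce D a') * (f a * g b'))).
  apply: eq_bigr => a _.
  under eq_bigr => a' _ do rewrite exchange_big.
  rewrite exchange_big /=; apply: eq_bigr => b' _.
  rewrite exchange_big /= -!cm_suml.
  by apply: eq_bigr => b _; rewrite mulr_sumr.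
under eq_bigr => a _ do under eq_bigr => b' _ do rewrite ceR ceL.
under eq_bigr => a _ do rewrite -mulr_sumr (sum_delta iota _ (fun b => f a * g b)).
by rewrite (sum_delta iota _ (fun a => f a * g i.2)).
Qed.

(** The values in [R] are multiplied in the opposite order, which is the shape of
    antimultiplicativity of the antipode. *)
Lemma pr21 (f : cv C iota) (g : cv D iota) i :
  (pull tens pr2 g * pull tens pr1 f) i = g i.2 * f i.1.
Proof.
rewrite cvM.
under eq_bigr => a _ do under eq_bigr => b _ do rewrite pr1E pr2E.
rewrite -(pair_bigA _ (fun a a' => \sum_b iota (tcd i (a, a') b) *
  (g a' * iota (ce C a) * (f b.1 * iota (ce D b.2))))) /=.
transitivity (\sum_a' \sum_a \sum_b' \sum_b iota (cd D i.2 a' b' * ce D b') *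
   (iota (cd C i.1 a b * ce C a) * (g a' * f b))).
  rewrite exchange_big; apply: eq_bigr => a' _; apply: eq_bigr => a _.
  rewrite -(pair_bigA _ (fun b b' => iota (tcd i (a, a') (b, b')) *
  (g a' * iota (ce C a) * (f b * iota (ce D b'))))) exchange_big /=.
  apply: eq_bigr => b' _; apply: eq_bigr => b _.
  rewrite /tcd /= -!(cmC iota _ (g a')) -(cmC iota _ (f b)) cmMM.
  rewrite !mulrA -!rmorphM; congr (iota _ * _ * _).
  ring.
transitivity (\sum_a' \sum_b iota (\sum_b' cd D i.2 a' b' * ce D b') *
   (iota (\sum_a cd C i.1 a b * ce C a) * (g a' * f b))).
  apply: eq_bigr => a' _.
  under eq_bigr => a _ do rewrite exchange_big.
  rewrite exchange_big /=; apply: eq_bigr => b _.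
  rewrite exchange_big /= -!cm_suml.
  by apply: eq_bigr => b' _; rewrite mulr_sumr.
under eq_bigr => a _ do under eq_bigr => b' _ do rewrite ceR ceL.
under eq_bigr => a _ do rewrite -mulr_sumr (sum_delta iota _ (fun b => g a * f b)).
by rewrite (sum_delta iota _ (fun a => g a * f i.1)).
Qed.

Lemma pr1P : coalg_morph tens C pr1.
Proof.
split=> [i a b|i].
  transitivity (cd C i.1 a b * ce D i.2).
    rewrite (bigD1 i.1) //= /pr1 eqxx mul1r mulrC big1 ?addr0 // => j /negPf.
    by rewrite eq_sym => ->; rewrite !mul0r.
  rewrite -(pair_bigA _ (fun a1 a2 => \sum_b' tcd i (a1, a2) b' *
    (pr1 (a1, a2) a * pr1 b' b))) /=.
  rewrite (bigD1 a) //= [X in _ + X]big1 ?addr0; last first.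
    move=> j /negPf jb; apply: big1 => k _; apply: big1 => l _.
    by rewrite /pr1 /= jb !mul0r mulr0.
  transitivity (\sum_a2 \sum_b2 (cd C i.1 a b * cd D i.2 a2 b2 * (ce D a2 * ce D b2))).
    have E a2 b2 : cd C i.1 a b * cd D i.2 a2 b2 * (ce D a2 * ce D b2) =
      cd C i.1 a b * ce D a2 * (cd D i.2 a2 b2 * ce D b2) by ring.
    under [RHS]eq_bigr => a2 _ do under eq_bigr => b2 _ do rewrite E.
    under [RHS]eq_bigr => a2 _ do rewrite -mulr_sumr ceR.
    rewrite (bigD1 i.2) //= eqxx mulr1 big1 ?addr0 // => j /negPf.
    by rewrite eq_sym => ->; rewrite mulr0.
  apply: eq_bigr => a2 _.
  rewrite -(pair_bigA _ (fun b1 b2 => tcd i (a, a2) (b1, b2) *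
    (pr1 (a, a2) a * pr1 (b1, b2) b))) /=.
  rewrite [RHS](bigD1 b) //= [X in _ + X]big1 ?addr0; last first.
    move=> j /negPf jb; apply: big1 => k _.
    by rewrite /pr1 /= jb !mul0r !mulr0.
  by apply: eq_bigr => b2 _; rewrite /pr1 /tcd /= !eqxx !mul1r.
rewrite (bigD1 i.1) //= /pr1 eqxx mul1r /tce mulrC big1 ?addr0 // => j /negPf.
by rewrite eq_sym => ->; rewrite !mul0r.
Qed.

Lemma pr2P : coalg_morph tens D pr2.
Proof.
split=> [i a b|i].
  transitivity (cd D i.2 a b * ce C i.1).
    rewrite (bigD1 i.2) //= /pr2 eqxx mul1r mulrC big1 ?addr0 // => j /negPf.
    by rewrite eq_sym => ->; rewrite !mul0r.
  rewrite -(pair_bigA _ (fun a1 a2 => \sum_b' tcd i (a1, a2) b' *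
    (pr2 (a1, a2) a * pr2 b' b))) exchange_big /=.
  rewrite (bigD1 a) //= [X in _ + X]big1 ?addr0; last first.
    move=> j /negPf jb; apply: big1 => k _; apply: big1 => l _.
    by rewrite /pr2 /= jb !mul0r mulr0.
  transitivity (\sum_a2 \sum_b2 (cd D i.2 a b * cd C i.1 a2 b2 * (ce C a2 * ce C b2))).
    have E a2 b2 : cd D i.2 a b * cd C i.1 a2 b2 * (ce C a2 * ce C b2) =
      cd D i.2 a b * ce C a2 * (cd C i.1 a2 b2 * ce C b2) by ring.
    under [RHS]eq_bigr => a2 _ do under eq_bigr => b2 _ do rewrite E.
    under [RHS]eq_bigr => a2 _ do rewrite -mulr_sumr ceR.
    rewrite (bigD1 i.1) //= eqxx mulr1 big1 ?addr0 // => j /negPf.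
    by rewrite eq_sym => ->; rewrite mulr0.
  apply: eq_bigr => a2 _.
  rewrite -(pair_bigA _ (fun b1 b2 => tcd i (a2, a) (b1, b2) *
    (pr2 (a2, a) a * pr2 (b1, b2) b))) exchange_big /=.
  rewrite [RHS](bigD1 b) //= [X in _ + X]big1 ?addr0; last first.
    move=> j /negPf jb; apply: big1 => k _.
    by rewrite /pr2 /= jb !mul0r !mulr0.
  by apply: eq_bigr => b2 _; rewrite /pr2 /tcd /= !eqxx !mul1r [cd D _ _ _ * _]mulrC.
rewrite (bigD1 i.2) //= /pr2 eqxx mul1r /tce mulrC big1 ?addr0 1?mulrC // => j /negPf.
by rewrite eq_sym => ->; rewrite !mul0r.
Qed.
End Tensor.

Arguments pr1 {F I J} D.
Arguments pr2 {F I J} C.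

(** * Hopf algebras and evaluation of convolution products *)

Section HopfBasics.
Variables (F : fieldType) (n : nat) (H : hopf_data F n).
Implicit Types x y z : 'rV[F]_n.

Lemma bvecE (i j : 'I_n) : bvec i 0 j = (i == j)%:R :> F.
Proof. by rewrite mxE eqxx eq_sym. Qed.

Lemma sum_bvec (V : lmodType F) (i : 'I_n) (f : 'I_n -> V) :
  \sum_j (bvec i 0 j : F) *: f j = f i.
Proof.
rewrite (bigD1 i) //= bvecE eqxx scale1r big1 ?addr0 // => j /negPf.
by rewrite bvecE eq_sym => ->; rewrite scale0r.
Qed.

Lemma row_sum_bvec x : x = \sum_i x 0 i *: bvec i.
Proof. exact: row_sum_delta. Qed.

Lemma hcomul_bvec i : hcomul H (bvec i) = hd H i.
Proof. exact: sum_bvec. Qed.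

Lemma hmul_bvec i j : hmul H (bvec i) (bvec j) = hm H i j.
Proof.
rewrite /hmul; under eq_bigr => a _ do under eq_bigr => b _ do rewrite -scalerA.
by under eq_bigr => a _ do rewrite -scaler_sumr sum_bvec; rewrite sum_bvec.
Qed.

Lemma hcounit_bvec i : hcounit H (bvec i) = he H i.
Proof. exact: (@sum_bvec F^o). Qed.

Lemma hmul_linl y : linear (hmul H ^~ y).
Proof.
move=> c x x'; rewrite /hmul scaler_sumr -big_split /=; apply: eq_bigr => i _.
rewrite scaler_sumr -big_split /=; apply: eq_bigr => j _.
by rewrite !mxE scalerA -scalerDl mulrDl mulrA.
Qed.

Lemma hmul_linr x : linear (hmul H x).
Proof.
move=> c y y'; rewrite /hmul scaler_sumr -big_split /=; apply: eq_bigr => i _.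
rewrite scaler_sumr -big_split /=; apply: eq_bigr => j _.
by rewrite !mxE scalerA -scalerDl mulrDr !mulrA [c * _]mulrC.
Qed.

Definition hmulr y := hmul H ^~ y.
HB.instance Definition _ y := GRing.isLinear.Build F _ _ _ (hmulr y) (hmul_linl y).
HB.instance Definition _ x := GRing.isLinear.Build F _ _ _ (hmul H x) (hmul_linr x).

Lemma hmulDl x x' y : hmul H (x + x') y = hmul H x y + hmul H x' y.
Proof. exact: (raddfD (hmulr y)). Qed.
Lemma hmulZl c x y : hmul H (c *: x) y = c *: hmul H x y.
Proof. exact: (linearZ_LR (hmulr y)). Qed.
Lemma hmul_suml (J : Type) (r : seq J) (P : pred J) f y :
  hmul H (\sum_(j <- r | P j) f j) y = \sum_(j <- r | P j) hmul H (f j) y.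
Proof. exact: (raddf_sum (hmulr y)). Qed.
Lemma hmulZr c x y : hmul H x (c *: y) = c *: hmul H x y.
Proof. exact: linearZ_LR. Qed.

Lemma hcomul_lin : linear (hcomul H).
Proof.
move=> c x y; rewrite /hcomul scaler_sumr -big_split /=; apply: eq_bigr => i _.
by rewrite !mxE scalerA -scalerDl.
Qed.
HB.instance Definition _ := GRing.isLinear.Build F _ _ _ (hcomul H) hcomul_lin.

Lemma hcounit_lin : linear_for *%R (hcounit H).
Proof.
move=> c x y; rewrite /hcounit mulr_sumr -big_split /=; apply: eq_bigr => i _.
by rewrite !mxE mulrDl mulrA.
Qed.
HB.instance Definition _ := GRing.isLinear.Build F _ _ _ (hcounit H) hcounit_lin.

Lemma hcomulE x a b : hcomul H x a b = \sum_i x 0 i * hd H i a b.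
Proof. by rewrite summxE; apply: eq_bigr => i _; rewrite mxE. Qed.

Definition glike (g : 'rV[F]_n) := hcomul H g = g^T *m g /\ hcounit H g = 1.

Hypothesis hH : is_hopf H.

Lemma hmulA x y z : hmul H (hmul H x y) z = hmul H x (hmul H y z).
Proof. by case: hH => -[]. Qed.
Lemma hmul1x x : hmul H (hu H) x = x.
Proof. by case: hH => -[_ h] _ _ _ _; case: (h x). Qed.
Lemma hmulx1 x : hmul H x (hu H) = x.
Proof. by case: hH => -[_ h] _ _ _ _; case: (h x). Qed.
Lemma hcomulM x y : hcomul H (hmul H x y) = tmul H (hcomul H x) (hcomul H y).
Proof. by case: hH => _ _ _ []. Qed.
Lemma hcounitM x y : hcounit H (hmul H x y) = hcounit H x * hcounit H y.
Proof. by case: hH => _ _ _ []. Qed.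
Lemma glike1 : glike (hu H).
Proof. by case: hH => _ _ _ []. Qed.
Lemma hantiL x : mul_tensor H (hanti H) id (hcomul H x) = hcounit H x *: hu H.
Proof. by case: hH => _ _ _ _ h; case: (h x). Qed.
Lemma hantiR x : mul_tensor H id (hanti H) (hcomul H x) = hcounit H x *: hu H.
Proof. by case: hH => _ _ _ _ h; case: (h x). Qed.

Lemma hdA i a b c :
  \sum_j hd H i j c * hd H j a b = \sum_l hd H i a l * hd H l b c.
Proof. by case: hH => _ h _ _ _; have := h (bvec i) a b c; rewrite hcomul_bvec. Qed.

Lemma heL i l : \sum_j hd H i j l * he H j = (i == l)%:R.
Proof. by case: hH => _ _ [h _] _ _; have := h (bvec i) l; rewrite hcomul_bvec bvecE. Qed.

Lemma heR i j : \sum_l hd H i j l * he H l = (i == j)%:R.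
Proof. by case: hH => _ _ [_ h] _ _; have := h (bvec i) j; rewrite hcomul_bvec bvecE. Qed.

Definition hco : coalg F 'I_n := @Coalg F 'I_n (fun i a b => hd H i a b) (he H) hdA heL heR.

Lemma glike_inv g : glike g -> hmul H g (hanti H g) = hu H.
Proof.
move=> [gg g1]; have := hantiR g; rewrite g1 scale1r => <-.
rewrite /mul_tensor gg {1 2}[g]row_sum_bvec hmul_suml.
apply: eq_bigr => a _; rewrite /hanti mulmx_suml raddf_sum; apply: eq_bigr => b _.
by rewrite /= mxE big_ord1 mxE -scalemxAl hmulZl hmulZr scalerA.
Qed.

(** The matrix of the multiplication H (x) H -> H; [mmP] is the bialgebra axiom. *)
Definition mm (i : 'I_n * 'I_n) (l : 'I_n) : F := hm H i.1 i.2 0 l.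

Lemma tmulE (D E : 'M[F]_n) a b :
  tmul H D E a b = \sum_a1 \sum_b1 \sum_c \sum_d
    (D a1 b1 * E c d * (hm H a1 c 0 a * hm H b1 d 0 b)).
Proof.
rewrite /tmul summxE; apply: eq_bigr => a1 _; rewrite summxE; apply: eq_bigr => b1 _.
rewrite summxE; apply: eq_bigr => c _; rewrite summxE; apply: eq_bigr => d _.
by rewrite !hmul_bvec !mxE big_ord1 !mxE.
Qed.

Lemma mmP : coalg_morph (tens hco hco) hco mm.
Proof.
split=> [[i j] a b|[i j]] /=; last first.
  by rewrite -[RHS]/(he H i * he H j) -!hcounit_bvec -hcounitM hmul_bvec.
rewrite -(pair_bigA _ (fun a1 c => \sum_b' tcd hco hco (i, j) (a1, c) b' *
    (mm (a1, c) a * mm b' b))) /=.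
rewrite -[LHS](hcomulE (hm H i j)) -hmul_bvec hcomulM tmulE !hcomul_bvec.
apply: eq_bigr => a1 _; rewrite exchange_big /=; apply: eq_bigr => c _.
by rewrite (pair_bigA _ (fun b1 d => hd H i a1 b1 * hd H j c d *
    (hm H a1 c 0 a * hm H b1 d 0 b))).
Qed.

Variables (R : pzRingType) (iota : central F R).

Definition ev (f : cv hco iota) (x : 'rV[F]_n) : R := \sum_i iota (x 0 i) * f i.
Definition ev2 (f : cv (tens hco hco) iota) (x y : 'rV[F]_n) : R :=
  \sum_i \sum_j iota (x 0 i * y 0 j) * f (i, j).
Implicit Types f g : cv hco iota.

Lemma ev_bvec f i : ev f (bvec i) = f i.
Proof. by rewrite /ev; under eq_bigr => j _ do rewrite bvecE; rewrite sum_delta. Qed.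

Lemma evDr f x y : ev f (x + y) = ev f x + ev f y.
Proof.
by rewrite /ev -big_split; apply: eq_bigr => i _; rewrite mxE rmorphD mulrDl.
Qed.

Lemma evZr f c x : ev f (c *: x) = iota c * ev f x.
Proof.
by rewrite /ev mulr_sumr; apply: eq_bigr => i _; rewrite mxE rmorphM mulrA.
Qed.

Lemma ev0r f : ev f 0 = 0.
Proof. by rewrite -(scale0r 0) evZr rmorph0 mul0r. Qed.

Lemma ev_sumr f (J : Type) (r : seq J) (P : pred J) (x : J -> _) :
  ev f (\sum_(j <- r | P j) x j) = \sum_(j <- r | P j) ev f (x j).
Proof. by elim/big_rec2: _ => [|j x1 y1 _ <-]; rewrite (ev0r, evDr). Qed.

Lemma evDl f g x : ev (f + g) x = ev f x + ev g x.
Proof.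
by rewrite /ev -big_split; apply: eq_bigr => i _; rewrite cvD mulrDr.
Qed.

Lemma ev_suml (J : Type) (r : seq J) (P : pred J) (f : J -> cv hco iota) x :
  ev (\sum_(j <- r | P j) f j) x = \sum_(j <- r | P j) ev (f j) x.
Proof.
elim/big_rec2: _ => [|j x1 y1 _ <-]; last by rewrite evDl.
by rewrite /ev big1 // => i _; rewrite cv0 mulr0.
Qed.

Lemma ev1 x : ev 1 x = iota (hcounit H x).
Proof.
by rewrite /ev rmorph_sum; apply: eq_bigr => i _; rewrite cv1 rmorphM.
Qed.

Lemma evM f g x : ev (f * g) x = \sum_a \sum_b iota (hcomul H x a b) * (f a * g b).
Proof.
rewrite /ev; under eq_bigr => i _.
  rewrite cvM mulr_sumr; under eq_bigr => a _.
    by rewrite mulr_sumr; under eq_bigr => b _ do rewrite mulrA -rmorphM; over.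
  over.
rewrite exchange_big /=; apply: eq_bigr => a _.
rewrite exchange_big /=; apply: eq_bigr => b _.
by rewrite cm_suml hcomulE.
Qed.

Lemma evM_row f g x : ev (f * g) x = \sum_a f a * ev g (row a (hcomul H x)).
Proof.
rewrite evM; apply: eq_bigr => a _; rewrite mulr_sumr; apply: eq_bigr => b _.
by rewrite mxE cmMr.
Qed.

(** Used with [v] group-like and [w = x], where the rows of [N] lie lower in the flag and are
    covered by induction. *)
Lemma evM_flag f g (x v w : 'rV[F]_n) (N : 'M[F]_n) : hcomul H x = v^T *m w + N ->
  ev (f * g) x = ev f v * ev g w + \sum_a f a * ev g (row a N).
Proof.
move=> Dx; have E a : row a (hcomul H x) = v 0 a *: w + row a N.
  by rewrite Dx linearD; congr (_ + _); apply/rowP=> b; rewrite !mxE big_ord1 !mxE.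
rewrite evM_row [ev f v]/ev mulr_suml -big_split; apply: eq_bigr => a _ /=.
by rewrite E evDr evZr mulrDr cmMr mulrA.
Qed.

Lemma evM_glike f h (g : 'rV[F]_n) : glike g -> ev (f * h) g = ev f g * ev h g.
Proof.
move=> [gg _]; rewrite (@evM_flag _ _ _ g g 0) ?addr0 // big1 ?addr0 // => a _.
by rewrite row0 ev0r mulr0.
Qed.

Lemma ev2_bvec (f : cv (tens hco hco) iota) i j : ev2 f (bvec i) (bvec j) = f (i, j).
Proof.
rewrite /ev2; under eq_bigr => a _ do under eq_bigr => b _ do
  rewrite rmorphM !bvecE -mulrA.
under eq_bigr => a _ do rewrite -mulr_sumr sum_delta.
by rewrite (sum_delta iota i (fun a => f (a, j))).
Qed.

Lemma ev2_mm f x y : ev2 (pull _ mm f) x y = ev f (hmul H x y).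
Proof.
rewrite /ev2 /hmul ev_sumr; apply: eq_bigr => i _.
rewrite ev_sumr; apply: eq_bigr => j _.
by rewrite evZr pullE.
Qed.

Lemma ev2M (f g : cv (tens hco hco) iota) x y :
  ev2 (f * g) x y = \sum_a \sum_b \sum_c \sum_d
   iota (hcomul H x a b * hcomul H y c d) * (f (a, c) * g (b, d)).
Proof.
rewrite /ev2.
transitivity (\sum_i \sum_j \sum_a \sum_b \sum_c \sum_d
  iota (x 0 i * y 0 j * (hd H i a b * hd H j c d)) * (f (a, c) * g (b, d))).
  apply: eq_bigr => i _; apply: eq_bigr => j _; rewrite cvM mulr_sumr.
  rewrite sum_pair.
  apply: eq_bigr => a _; rewrite exchange_big /=; apply: eq_bigr => c _.
  rewrite mulr_sumr.
  rewrite sum_pair.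
  by apply: eq_bigr => b _; apply: eq_bigr => d _; rewrite mulrA -rmorphM.
under eq_bigr => i _ do rewrite exchange_big.
rewrite exchange_big /=; apply: eq_bigr => a _.
under eq_bigr => i _ do rewrite exchange_big.
rewrite exchange_big /=; apply: eq_bigr => b _.
under eq_bigr => i _ do rewrite exchange_big.
rewrite exchange_big /=; apply: eq_bigr => c _.
under eq_bigr => i _ do rewrite exchange_big.
rewrite exchange_big /=; apply: eq_bigr => d _.
rewrite !hcomulE big_distrlr rmorph_sum mulr_suml; apply: eq_bigr => i _.
rewrite rmorph_sum mulr_suml; apply: eq_bigr => j _.
by congr (iota _ * _); rewrite mulrACA.
Qed.

End HopfBasics.

(** * Pointed Hopf algebras: a filtration by group-like elements *)

Lemma col_matrixP (R : Type) m n (A B : 'M[R]_(m, n)) :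
  (forall j, col j A = col j B) -> A = B.
Proof. by move=> h; apply/matrixP=> i j; have /colP/(_ i) := h j; rewrite !mxE. Qed.

Lemma col_mul (R : pzRingType) m n p (A : 'M[R]_(m, n)) (B : 'M_(n, p)) j :
  col j (A *m B) = A *m col j B.
Proof. by rewrite !colE mulmxA. Qed.

Section Subspace.
Variables (F : fieldType) (n : nat).

Definition is_subspace (X : 'rV[F]_n -> Prop) :=
  X 0 /\ forall c x y, X x -> X y -> X (c *: x + y).

Lemma subspaceD X x y : is_subspace X -> X x -> X y -> X (x + y).
Proof. by move=> [_ h] Xx Xy; rewrite -[x]scale1r; apply: h. Qed.

Lemma subspaceZ X c x : is_subspace X -> X x -> X (c *: x).
Proof. by move=> [X0 h] Xx; rewrite -[_ *: _]addr0; apply: h. Qed.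

(** Lets a subspace be given by a property: a matrix inside [X] is enlarged by missed vectors until
    its rank, bounded by [n], stops growing. *)
Lemma subspaceP X : is_subspace X ->
  exists M : 'M[F]_n, forall v : 'rV[F]_n, (v <= M)%MS <-> X v.
Proof.
move=> sX.
suff gen k (M : 'M[F]_n) : (n - \rank M <= k)%N ->
    (forall v : 'rV_n, (v <= M)%MS -> X v) ->
    exists M : 'M[F]_n, forall v : 'rV[F]_n, (v <= M)%MS <-> X v.
  apply: (gen n 0); first by rewrite leq_subr.
  by move=> v; rewrite submx0 => /eqP ->; apply: sX.1.
elim: k M => [|k IH] M Mk XM.
  exists M => v; split; first exact: XM.
  move=> _; rewrite submx_full // -sub1mx -mxrank_leqif_sup ?submx1 //.
  by rewrite eqn_leq mxrankS ?submx1 // mxrank1 -subn_eq0 -leqn0 Mk.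
have [[v [Xv vM]]|Xs] := classic (exists v, X v /\ ~~ (v <= M)%MS); last first.
  exists M => v; split=> [|Xv]; first exact: XM.
  by apply/negPn/negP => vM; apply: Xs; exists v.
apply: (IH (M + v)%MS); last first.
  move=> w /sub_addsmxP [[w1 w2] /= ->]; apply: subspaceD => //.
    by apply: XM; exact: submxMl.
  by rewrite [w2]mx11_scalar mul_scalar_mx; apply: subspaceZ.
have : (\rank M < \rank (M + v))%N.
  by apply: rank_ltmx; rewrite ltmxE addsmxSl addsmx_sub submx_refl.
by lia.
Qed.

End Subspace.

Section Pointed.
Variables (F : fieldType) (n : nat) (H : hopf_data F n).
Hypothesis hH : is_hopf H.
Implicit Types (x v w : 'rV[F]_n) (phi psi : 'cV[F]_n) (V W D : 'M[F]_n).

(** The map x |-> phi(x1) x2. It makes H a right module over the dual algebra, whose product is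
    [cnv]. *)
Definition Act phi : 'M[F]_n := \matrix_(i, b) (phi^T *m hd H i) 0 b.
Definition cnv phi psi : 'cV[F]_n := \col_l (phi^T *m hd H l *m psi) 0 0.
Definition epsc : 'cV[F]_n := \col_i he H i.

Lemma ActE x phi : x *m Act phi = phi^T *m hcomul H x.
Proof.
apply/rowP=> b; rewrite !mxE.
under eq_bigr => i _ do rewrite !mxE mulr_sumr.
rewrite exchange_big /=; apply: eq_bigr => a _.
by rewrite hcomulE mulr_sumr; apply: eq_bigr => i _; rewrite mulrCA.
Qed.

Lemma cnvE x phi psi : x *m cnv phi psi = phi^T *m hcomul H x *m psi.
Proof.
rewrite -ActE -mulmxA; congr (_ *m _); apply/colP=> l.
by rewrite !mxE; apply: eq_bigr => b _; rewrite !mxE.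
Qed.

Lemma ActM phi psi : Act phi *m Act psi = Act (cnv phi psi).
Proof.
apply/matrixP=> i c; rewrite !mxE.
transitivity (\sum_a \sum_e phi a 0 * psi e 0 * (\sum_l hd H i a l * hd H l e c)).
  under eq_bigr => b _ do rewrite !mxE big_distrlr.
  rewrite exchange_big /=; apply: eq_bigr => a _.
  rewrite exchange_big /=; apply: eq_bigr => e _.
  by rewrite mulr_sumr; apply: eq_bigr => l _; rewrite !mxE mulrACA.
under [RHS]eq_bigr => l _.
  rewrite !mxE mulr_suml; under eq_bigr => e _.
    rewrite !mxE mulr_suml mulr_suml; over.
  rewrite exchange_big; over.
rewrite [RHS]exchange_big; apply: eq_bigr => a _.
rewrite [RHS]exchange_big; apply: eq_bigr => e _.
rewrite -(hdA hH) mulr_sumr; apply: eq_bigr => l _; rewrite !mxE; ring.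
Qed.

Lemma Act_eps : Act epsc = 1%:M.
Proof.
apply/matrixP=> i b; rewrite !mxE -(heL hH).
by apply: eq_bigr => a _; rewrite !mxE mulrC.
Qed.

Lemma ActB phi psi : Act (phi - psi) = Act phi - Act psi.
Proof. by apply/row_matrixP=> i; rewrite linearB /= !rowE !ActE linearB /= mulmxBl. Qed.

Lemma ActD phi psi : Act (phi + psi) = Act phi + Act psi.
Proof. by apply/row_matrixP=> i; rewrite linearD /= !rowE !ActE linearD /= mulmxDl. Qed.

Lemma ActZ c phi : Act (c *: phi) = c *: Act phi.
Proof. by apply/row_matrixP=> i; rewrite linearZ /= !rowE !ActE linearZ /= -scalemxAl. Qed.

(** These are the left coideals, Delta(W) in H (x) W. *)
Definition stable W := forall phi, (W *m Act phi <= W)%MS.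

Lemma stableP W v phi : stable W -> (v <= W)%MS -> (v *m Act phi <= W)%MS.
Proof. by move=> sW vW; apply: submx_trans (submxMr _ vW) (sW phi). Qed.

Lemma stable_pred W : (forall v phi, (v <= W)%MS -> (v *m Act phi <= W)%MS) -> stable W.
Proof. by move=> h phi; apply/row_subP=> i; rewrite row_mul h // row_sub. Qed.

(** For stable [W], this says that [V / W] is a simple comodule. *)
Definition minimal_over W V := [/\ stable V, (W < V)%MS &
  forall V', stable V' -> (W <= V')%MS -> (V' <= V)%MS -> (V' <= W)%MS \/ (V <= V')%MS].

Lemma minimal_ex W : ~~ row_full W -> exists V, minimal_over W V.
Proof.
move=> nW; suff gen k V : (\rank V <= k)%N -> stable V -> (W < V)%MS ->
    exists V, minimal_over W V.
  apply: (gen n 1%:M); rewrite ?mxrank1 //; first by move=> phi; rewrite submx1.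
  by rewrite ltmx1.
elim: k V => [|k IH] V.
  by rewrite leqn0 mxrank_eq0 => /eqP-> _ /ltmx_sub_trans/(_ (sub0mx _ W)); rewrite ltmx_irrefl.
move=> Vk sV WV.
have [h|h] := classic (exists V', [/\ stable V', (W < V')%MS & (V' < V)%MS]).
  case: h => V' [sV' WV' /rank_ltmx lt]; apply: (IH V') => //.
  by rewrite -ltnS (leq_trans lt).
exists V; split=> // V' sV' WV' V'V.
have [a|a] := boolP (V' <= W)%MS; first by left.
have [b|b] := boolP (V <= V')%MS; first by right.
by case: h; exists V'; rewrite !ltmxE WV' V'V a b.
Qed.

Lemma subcoalgebra_cnv D x phi psi : subcoalgebra H D -> (x <= D)%MS ->
  D *m phi = 0 \/ D *m psi = 0 -> x *m cnv phi psi = 0.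
Proof.
move=> sD /sD [M Dx] h; rewrite cnvE Dx !mulmxA -trmx_mul -!mulmxA.
by case: h => ->; rewrite ?trmx0 ?mul0mx ?mulmx0.
Qed.

Lemma cnv_perp D phi psi : subcoalgebra H D ->
  D *m phi = 0 \/ D *m psi = 0 -> D *m cnv phi psi = 0.
Proof.
move=> sD h; apply/row_matrixP=> i; rewrite row_mul row0.
exact: subcoalgebra_cnv sD (row_sub i D) h.
Qed.

Section MinimalOver.
Variables (W V : 'M[F]_n).
Hypotheses (sW : stable W) (mV : minimal_over W V).

Definition annih phi := forall v, (v <= V)%MS -> (v *m Act phi <= W)%MS.

Let WV : (W <= V)%MS.
Proof. by case: mV => _ /ltmxW. Qed.

Let sV : stable V.
Proof. by case: mV. Qed.

(* The annihilator of [D] is a two-sided ideal of the dual algebra, over which V/W is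
   a simple module; [epsc] is the unit. *)
Lemma ideal_dichotomy D : subcoalgebra H D ->
  (forall phi, D *m phi = 0 -> annih phi) \/
  exists2 e, D *m e = 0 & annih (epsc - e).
Proof.
move=> sD.
(* The vectors of [V] that the annihilator of [D] sends into [W] form a stable subspace, which is
   [W] or [V] by minimality. *)
have [M0 M0P] : exists M : 'M[F]_n, forall v, (v <= M)%MS <->
    (v <= V)%MS /\ forall phi, D *m phi = 0 -> (v *m Act phi <= W)%MS.
  apply: subspaceP; split=> [|c x y [xV hx] [yV hy]].
    by split=> [|phi _]; rewrite ?mul0mx sub0mx.
  split=> [|phi Dphi]; first by rewrite addmx_sub ?scalemx_sub.
  by rewrite mulmxDl -scalemxAl addmx_sub ?scalemx_sub ?hx ?hy.
have M0W : (W <= M0)%MS.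
  apply/rV_subP=> v vW; apply/M0P; split; first exact: submx_trans vW WV.
  by move=> phi _; apply: stableP.
have M0V : (M0 <= V)%MS by apply/rV_subP=> v /M0P [].
have sM0 : stable M0.
  apply: stable_pred => v phi /M0P [vV hv]; apply/M0P; split; first exact: stableP.
  move=> psi Dpsi; rewrite -mulmxA ActM; apply: hv.
  by apply: cnv_perp => //; right.
case: mV => _ _ /(_ M0 sM0 M0W M0V) [{}M0W|{}M0V]; last first.
  by left=> phi Dphi v vV; have /M0P[_ ->] := submx_trans vV M0V.
right.
(* If it is [W], then any [v] outside [W] generates [V] modulo [W] under the annihilator of [D]; in
   particular [v] itself is reached. *)
have cyc v : (v <= V)%MS -> ~~ (v <= W)%MS ->
    exists2 e, D *m e = 0 & (v - v *m Act e <= W)%MS.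
  move=> vV vW.
  have [Y YP] : exists M : 'M[F]_n, forall y, (y <= M)%MS <->
      exists phi w, [/\ D *m phi = 0, (w <= W)%MS & y = v *m Act phi + w].
    apply: subspaceP; split=> [|c x y [p [w [Dp wW ->]]] [p' [w' [Dp' wW' ->]]]].
      exists 0, 0; split; rewrite ?mulmx0 ?sub0mx // addr0 ActE trmx0 mul0mx //.
    exists (c *: p + p'), (c *: w + w'); split.
    - by rewrite mulmxDr -scalemxAr Dp Dp' scaler0 addr0.
    - by rewrite addmx_sub ?scalemx_sub.
    by rewrite ActD ActZ mulmxDr -scalemxAr scalerDr addrACA.
  have WY : (W <= Y)%MS.
    apply/rV_subP=> w wW; apply/YP; exists 0, w; split=> //; first by rewrite mulmx0.
    by rewrite ActE trmx0 mul0mx add0r.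
  have YV : (Y <= V)%MS.
    apply/rV_subP=> y /YP [phi [w [_ wW ->]]].
    by rewrite addmx_sub ?(submx_trans wW) // stableP.
  have sY : stable Y.
    apply: stable_pred => y psi /YP [phi [w [Dp wW ->]]]; apply/YP.
    exists (cnv phi psi), (w *m Act psi); split; first by apply: cnv_perp => //; left.
      exact: stableP.
    by rewrite mulmxDl -mulmxA ActM.
  case: mV => _ _ /(_ Y sY WY YV) [YW|VY].
    case/negP: vW; apply: submx_trans M0W; apply/M0P; split=> // phi Dp.
    apply: submx_trans YW; apply/YP; exists phi, 0; split=> //; first exact: sub0mx.
    by rewrite addr0.
  have /YP [e [w [De wW vE]]] := submx_trans vV VY.
  by exists e => //; rewrite {1}vE addrAC subrr add0r.
(* One [e] serves finitely many vectors, by 1 - (e + p - e p) = (1 - e)(1 - p). *)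
have list_cyc (s : seq 'rV[F]_n) : all (fun v => (v <= V)%MS) s ->
    exists2 e, D *m e = 0 & forall v, v \in s -> (v - v *m Act e <= W)%MS.
  elim: s => [_|v s IH /= /andP [vV /IH [e De he]]].
    by exists 0 => //; rewrite mulmx0.
  have v'V : (v - v *m Act e <= V)%MS.
    by rewrite addmx_sub // eqmx_opp stableP.
  have [vW|/(cyc _ v'V) [p Dp hp]] := boolP (v - v *m Act e <= W)%MS.
    by exists e => // w; rewrite inE => /predU1P [->|/he].
  have E x : x - x *m Act (e + p - cnv e p) =
      (x - x *m Act e) - (x - x *m Act e) *m Act p.
    by rewrite ActB ActD -ActM !mulmxBr mulmxDr mulmxBl mulmxA -(addrA (x *m Act e)) opprD addrA.
  exists (e + p - cnv e p).
    by rewrite mulmxBr mulmxDr De Dp cnv_perp ?subr0 ?addr0 //; left.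
  move=> w; rewrite inE E => /predU1P [->|/he wW] //.
  by rewrite addmx_sub // eqmx_opp stableP.
have [|e De he] := list_cyc [seq row i V | i <- enum 'I_n].
  by apply/allP=> _ /mapP [i _ ->]; rewrite row_sub.
exists e => // v /submxP [c ->]; rewrite ActB Act_eps -mulmxA; apply: submx_trans (submxMl _ _) _; apply/row_subP=> i.
rewrite row_mul mulmxBr mulmx1; apply: he; apply: map_f; exact: mem_enum.
Qed.

Lemma annih_cnv phi psi : annih phi \/ annih psi -> annih (cnv phi psi).
Proof.
move=> h v vV; rewrite -ActM mulmxA; case: h => h; last by apply: h; exact: stableP.
by apply: stableP => //; exact: h.
Qed.

(** [C] is the coefficient coalgebra of the comodule [V / W], obtained as the orthogonal of the
    annihilator of [V / W]. *)
Lemma coef_space : exists C : 'M[F]_n,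
  [/\ subcoalgebra H C, (forall phi, C *m phi = 0 <-> annih phi) &
      forall v (xi : 'cV_n), (v <= V)%MS -> W *m xi = 0 -> ((hcomul H v *m xi)^T <= C)%MS].
Proof.
have [C CP] : exists M : 'M[F]_n, forall c : 'rV[F]_n, (c <= M)%MS <->
    forall phi, annih phi -> c *m phi = 0.
  apply: subspaceP; split=> [phi _|c x y hx hy phi ap]; first by rewrite mul0mx.
  by rewrite mulmxDl -scalemxAl hx // hy // scaler0 addr0.
have Cc v (xi : 'cV_n) : (v <= V)%MS -> W *m xi = 0 -> ((hcomul H v *m xi)^T <= C)%MS.
  move=> vV Wxi; apply/CP=> phi /(_ v vV); rewrite ActE => /submxP [c Ec].
  apply: trmx_inj; rewrite trmx_mul trmxK mulmxA Ec -mulmxA Wxi mulmx0.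
  by rewrite trmx0.
have CA phi : annih phi -> C *m phi = 0.
  by move=> ap; apply/row_matrixP=> i; rewrite row_mul row0; apply: (CP _).1; rewrite ?row_sub.
exists C; split=> //; last first.
  move=> phi; split=> [Cp v vV|]; last exact: CA.
  rewrite submxE ActE; apply/eqP/matrixP=> i j; rewrite (ord1 i) [RHS]mxE.
  have Wj : W *m col j (cokermx W) = 0 by rewrite -col_mul mulmx_coker col0.
  have /submxP [c Ec] := Cc v _ vV Wj.
  have -> : (phi^T *m hcomul H v *m cokermx W) 0 j =
     (phi^T *m (hcomul H v *m col j (cokermx W))) 0 0.
    by rewrite mulmxA -col_mul [RHS]mxE.
  rewrite -[_ *m col _ _]trmxK Ec.
  by rewrite -trmx_mul -mulmxA Cp mulmx0 trmx0 mxE.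
move=> x xC.
(* The annihilator is a two-sided ideal, so both tensor legs of Delta x lie in [C]; the
   pseudo-inverse of [C] then gives the middle matrix. *)
have R1 : (hcomul H x <= C)%MS.
  apply/row_subP=> a; apply/CP=> phi ap.
  rewrite rowE -mulmxA -(trmxK (delta_mx 0 a)) mulmxA -cnvE.
  by have /CP := xC; apply; apply: annih_cnv; right.
have R2 : ((hcomul H x)^T <= C)%MS.
  apply/row_subP=> a; apply/CP=> phi ap.
  apply: trmx_inj; rewrite trmx0 rowE trmx_mul trmx_mul trmxK mulmxA -cnvE.
  by have /CP -> // := xC; apply: annih_cnv; left.
have [p [E1 E2]] : exists p, hcomul H x *m p *m C = hcomul H x /\
    (hcomul H x)^T *m p *m C = (hcomul H x)^T.
  by exists (pinvmx C); rewrite !mulmxKpV.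
exists (p^T *m hcomul H x *m p); rewrite !mulmxA -[LHS]E1; congr (_ *m _ *m _).
by apply: trmx_inj; rewrite !trmx_mul !trmxK mulmxA E2.
Qed.

Hypothesis hpt : pointed H.

(** The simple comodule [V / W] has a simple coefficient coalgebra, which pointedness makes a line
    spanned by a group-like [g]. The coaction on [V / W] is then v |-> g (x) v, up to an error [N]
    in H (x) W. *)
Lemma glike_coef : exists2 g, glike H g & forall v, (v <= V)%MS ->
  exists2 N : 'M[F]_n, hcomul H v = g^T *m v + N & (N <= W)%MS.
Proof.
have [C [sC CA Cc]] := coef_space.
have epsx x : epsc^T *m hcomul H x = x by rewrite -ActE Act_eps mulmx1.
have simC : simple_subcoalgebra H C.
  split=> //.
    apply/eqP=> C0; have /CA ae : C *m epsc = 0 by rewrite C0 mul0mx.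
    case: mV => _ /ltmx_sub_trans VW _.
    have /VW : (V <= W)%MS.
      by apply/rV_subP=> v /ae; rewrite Act_eps mulmx1.
    by rewrite ltmx_irrefl.
  (* Either the annihilator of [D] kills [V / W], whence [C <= D]; or eps agrees on [C] with some
     [e] that kills [D], so eps vanishes on [D] and the counit axiom gives [D = 0]. *)
  move=> D sD DC; have [h|[e De ae]] := ideal_dichotomy sD.
    right; rewrite DC /= submxE; apply/eqP; apply: col_matrixP => j; rewrite col0 col_mul.
    by apply/CA/h; rewrite -col_mul mulmx_coker col0.
  left; have De0 : D *m epsc = 0.
    have /CA /(congr1 (mulmx (D *m pinvmx C))) := ae.
    by rewrite mulmx0 mulmxA mulmxKpV // mulmxBr De subr0.
  apply/row_matrixP=> i; rewrite row0 -[LHS]epsx.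
  have [M ->] := sD _ (row_sub i D).
  by rewrite !mulmxA -trmx_mul De0 trmx0 !mul0mx.
have rC := hpt simC.
have [c c0 cC] : exists2 c : 'rV[F]_n, c != 0 & (c <= C)%MS.
  by exists (nz_row C); rewrite ?nz_row_sub // nz_row_eq0 -mxrank_eq0 rC.
have Cc' : (C <= c)%MS.
  by have := mxrank_leqif_sup cC; rewrite rC rank_rV c0; case=> _ <-.
have [k Ck] := submxP Cc'.
have [M DM] := sC c cC.
(* Rescaling the generator [c] of the line by this [l] makes it group-like. *)
have [l Dc] : exists l, hcomul H c = l *: (c^T *m c).
  exists ((k^T *m M *m k) 0 0).
  have -> : hcomul H c = c^T *m (k^T *m M *m k) *m c.
    by rewrite DM Ck trmx_mul !mulmxA.
  by rewrite [in LHS](mx11_scalar (_ *m k)) mul_mx_scalar -scalemxAl.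
have le : l * (epsc^T *m c^T) 0 0 = 1.
  have E : (l * (epsc^T *m c^T) 0 0) *: c = c.
    rewrite -[RHS]epsx Dc -scalemxAr mulmxA [in RHS](mx11_scalar (_ *m c^T)).
    by rewrite mul_scalar_mx scalerA.
  apply/eqP; rewrite -subr_eq0.
  have /eqP : (l * (epsc^T *m c^T) 0 0 - 1) *: c = 0 by rewrite scalerBl scale1r E subrr.
  by rewrite scaler_eq0 (negPf c0) orbF.
have hc x : (epsc^T *m x^T) 0 0 = hcounit H x.
  by rewrite mxE; apply: eq_bigr => i _; rewrite !mxE mulrC.
exists (l *: c).
  split; last by rewrite linearZ /= -hc.
  by rewrite [LHS]linearZ /= Dc [(l *: c)^T]linearZ /= -scalemxAl -scalemxAr.
move=> v vV; exists (hcomul H v - (l *: c)^T *m v); first by rewrite addrC subrK.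
rewrite submxE mulmxBl; apply/eqP; apply: col_matrixP => j; rewrite col0 linearB /= (col_mul (hcomul H v)) (col_mul (_ *m v)).
set xi := col j (cokermx W).
have Wxi : W *m xi = 0 by rewrite /xi -col_mul mulmx_coker col0.
have /submxP [s Es] := submx_trans (Cc _ _ vV Wxi) Cc'.
have E2 : hcomul H v *m xi = s 0 0 *: c^T.
  by apply: trmx_inj; rewrite Es [in LHS](mx11_scalar s) mul_scalar_mx linearZ /= trmxK.
have : v *m xi = (s 0 0 * (epsc^T *m c^T) 0 0)%:M.
  rewrite -{1}(epsx v) -mulmxA E2 -scalemxAr [_ *m c^T]mx11_scalar.
  by rewrite scale_scalar_mx !mxE eqxx mulr1n.
move=> E3; rewrite E2 -mulmxA E3 [(l *: c)^T]linearZ /= -scalemxAl mul_mx_scalar scalerA.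
by rewrite mulrCA le mulr1 subrr.
Qed.
End MinimalOver.

(** Induction along a composition series of H as a comodule over itself; [k] bounds the codimension
    of the part [W] on which [X] is already known. *)
Lemma pointed_ind (X : 'rV[F]_n -> Prop) : pointed H -> is_subspace X ->
  (forall w g (N : 'M[F]_n), glike H g -> hcomul H w = g^T *m w + N ->
     (forall a, X (row a N)) -> X w) ->
  forall x, X x.
Proof.
move=> hpt sX hX.
suff gen k W : (n - \rank W <= k)%N -> stable W -> (forall w, (w <= W)%MS -> X w) ->
    forall x, X x.
  apply: (gen n 0); rewrite ?leq_subr //; first by move=> phi; rewrite mul0mx sub0mx.
  by move=> w; rewrite submx0 => /eqP ->; apply: sX.1.
elim: k W => [|k IH] W Wk sW XW.
  move=> x; apply: XW; rewrite submx_full // /row_full eqn_leq rank_leq_col.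
  by rewrite -subn_eq0 -leqn0.
have [fW|/minimal_ex [V mV]] := boolP (row_full W).
  by move=> x; apply: XW; rewrite submx_full.
have [g gg gV] := glike_coef sW mV hpt.
have [sV WV _] := mV; apply: (IH V) => //.
  by have := rank_ltmx WV; lia.
move=> v /gV [N Dv NW]; apply: hX gg Dv _ => a; apply: XW.
by apply: submx_trans NW; exact: row_sub.
Qed.
End Pointed.

(** * The commutative quotient *)

Section TensorMul.
Variables (F : fieldType) (n : nat) (H : hopf_data F n).
Implicit Types (D E : 'M[F]_n) (x y z w : 'rV[F]_n).

Lemma tmul_linl E : linear (tmul H ^~ E).
Proof.
move=> k D D'; rewrite /tmul scaler_sumr -big_split; apply: eq_bigr => a _ /=.
rewrite scaler_sumr -big_split; apply: eq_bigr => b _ /=.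
rewrite scaler_sumr -big_split; apply: eq_bigr => c _ /=.
rewrite scaler_sumr -big_split; apply: eq_bigr => d _ /=.
by rewrite scalerA -scalerDl !mxE; congr (_ *: _); ring.
Qed.

Lemma tmul_linr D : linear (tmul H D).
Proof.
move=> k E E'; rewrite /tmul scaler_sumr -big_split; apply: eq_bigr => a _ /=.
rewrite scaler_sumr -big_split; apply: eq_bigr => b _ /=.
rewrite scaler_sumr -big_split; apply: eq_bigr => c _ /=.
rewrite scaler_sumr -big_split; apply: eq_bigr => d _ /=.
by rewrite scalerA -scalerDl !mxE; congr (_ *: _); ring.
Qed.

Definition tmulr E := tmul H ^~ E.
HB.instance Definition _ E := GRing.isLinear.Build F _ _ _ (tmulr E) (tmul_linl E).
HB.instance Definition _ D := GRing.isLinear.Build F _ _ _ (tmul H D) (tmul_linr D).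

Lemma tmul_sums (I J : finType) (X : I -> 'M[F]_n) (Y : J -> 'M[F]_n) :
  tmul H (\sum_a X a) (\sum_b Y b) = \sum_a \sum_b tmul H (X a) (Y b).
Proof.
rewrite -[LHS]/(tmulr _ _) (raddf_sum (tmulr _)); apply: eq_bigr => a _.
exact: (raddf_sum (tmul H _)).
Qed.

Lemma mx_sum_rank1 D : D = \sum_a (bvec a)^T *m row a D.
Proof.
apply/matrixP=> i j; rewrite summxE (bigD1 i) //= big1 ?addr0 => [|a /negPf ai].
  by rewrite mxE big_ord1 !mxE !eqxx mul1r.
by rewrite mxE big_ord1 !mxE eqxx eq_sym ai mul0r.
Qed.

Lemma tmul_rank1 x y z w :
  tmul H (x^T *m y) (z^T *m w) = (hmul H x z)^T *m hmul H y w.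
Proof.
rewrite /tmul [hmul H x z]/hmul (raddf_sum (@trmx F 1 n)) mulmx_suml; apply: eq_bigr => a _ /=.
rewrite (raddf_sum (@trmx F 1 n)) mulmx_suml exchange_big /=.
rewrite [RHS](eq_bigr (fun c => \sum_b \sum_d (x 0 a * y 0 b * (z 0 c * w 0 d)) *:
    ((hm H a c)^T *m hm H b d))); last first.
  move=> c _; rewrite [(_ *: hm H a c)^T]linearZ /= -scalemxAl /hmul mulmx_sumr scaler_sumr.
  apply: eq_bigr => b _; rewrite mulmx_sumr scaler_sumr; apply: eq_bigr => d _.
  by rewrite -scalemxAr scalerA; congr (_ *: _); ring.
rewrite exchange_big; under eq_bigr => b _ do rewrite exchange_big.
rewrite [RHS]exchange_big; apply: eq_bigr => b _ /=.
rewrite exchange_big /=; apply: eq_bigr => c _; apply: eq_bigr => d _.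
by rewrite !hmul_bvec !mxE !big_ord1 !mxE.
Qed.

Lemma tmulC D E : hopf_commutative H -> tmul H D E = tmul H E D.
Proof.
move=> cH; rewrite /tmul.
transitivity (\sum_(c < n) \sum_(d < n) \sum_(a < n) \sum_(b < n)
     (D a b * E c d) *: ((hmul H (bvec a) (bvec c))^T *m hmul H (bvec b) (bvec d))).
  under eq_bigr => a _ do rewrite exchange_big /=.
  rewrite exchange_big /=; apply: eq_bigr => c _.
  under eq_bigr => a _ do rewrite exchange_big /=.
  by rewrite exchange_big.
apply: eq_bigr => c _; apply: eq_bigr => d _; apply: eq_bigr => a _; apply: eq_bigr => b _.
by rewrite mulrC (cH (bvec a)) (cH (bvec b)).
Qed.

Lemma mul_tensor_lin f g : linear (mul_tensor H f g).
Proof.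
move=> k D E; rewrite /mul_tensor scaler_sumr -big_split; apply: eq_bigr => a _ /=.
rewrite scaler_sumr -big_split; apply: eq_bigr => b _ /=.
by rewrite scalerA -scalerDl !mxE.
Qed.
HB.instance Definition _ f g :=
  GRing.isLinear.Build F _ _ _ (mul_tensor H f g) (mul_tensor_lin f g).

Lemma mul_tensor_rank1 (f g : {linear 'rV[F]_n -> 'rV[F]_n}) x y :
  mul_tensor H f g (x^T *m y) = hmul H (f x) (g y).
Proof.
rewrite /mul_tensor {2}[x]row_sum_bvec linear_sum hmul_suml; apply: eq_bigr => a _.
rewrite {2}[y]row_sum_bvec !linear_sum; apply: eq_bigr => b _ /=.
by rewrite !linearZ /= hmulZl scalerA !mxE big_ord1 !mxE mulrC.
Qed.

Lemma hanti_lin : linear (hanti H).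
Proof. by move=> c x y; rewrite /hanti mulmxDl -scalemxAl. Qed.
HB.instance Definition _ := GRing.isLinear.Build F _ _ _ (hanti H) hanti_lin.
End TensorMul.

Section TensorMorph.
Variables (F : fieldType) (n m : nat) (H : hopf_data F n) (K : hopf_data F m).
Variable p : 'M[F]_(n, m).
Hypothesis pM : forall x y, hmul K (x *m p) (y *m p) = hmul H x y *m p.

Lemma tmul_morph (D E : 'M[F]_n) :
  p^T *m tmul H D E *m p = tmul K (p^T *m D *m p) (p^T *m E *m p).
Proof.
have P1 x y : p^T *m (x^T *m y) *m p = (x *m p)^T *m (y *m p) :> 'M[F]_m.
  by rewrite trmx_mul !mulmxA.
have S D0 : p^T *m D0 *m p = \sum_a p^T *m ((bvec a)^T *m row a D0) *m p.
  by rewrite {1}(mx_sum_rank1 D0) mulmx_sumr mulmx_suml.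
rewrite (S D) (S E) tmul_sums {1}(mx_sum_rank1 D) {1}(mx_sum_rank1 E) tmul_sums.
rewrite mulmx_sumr mulmx_suml; apply: eq_bigr => a _.
rewrite mulmx_sumr mulmx_suml; apply: eq_bigr => b _.
by rewrite tmul_rank1 !P1 tmul_rank1 !pM.
Qed.

Lemma mul_tensor_morph (f g : {linear 'rV[F]_n -> 'rV[F]_n})
    (f' g' : {linear 'rV[F]_m -> 'rV[F]_m}) (D : 'M[F]_n) :
  (forall x, f' (x *m p) = f x *m p) -> (forall x, g' (x *m p) = g x *m p) ->
  mul_tensor K f' g' (p^T *m D *m p) = mul_tensor H f g D *m p.
Proof.
move=> fp gp.
rewrite {2}(mx_sum_rank1 D) (raddf_sum (mul_tensor H f g)) mulmx_suml.
rewrite {1}(mx_sum_rank1 D) mulmx_sumr mulmx_suml (raddf_sum (mul_tensor K f' g')).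
apply: eq_bigr => a _.
have -> : p^T *m ((bvec a)^T *m row a D) *m p = (bvec a *m p)^T *m (row a D *m p).
  by rewrite trmx_mul !mulmxA.
by rewrite /= !mul_tensor_rank1 fp gp pM.
Qed.
End TensorMorph.

Section CommutatorIdeal.
Variables (F : fieldType) (n : nat) (H : hopf_data F n).
Hypothesis hH : is_hopf H.
Implicit Types (x y z : 'rV[F]_n).

Definition comm_vanish (X : 'rV[F]_n -> Prop) :=
  forall a x y b, X (hmul H a (hmul H (hmul H x y - hmul H y x) b)).

(** The commutator ideal as a least subspace: a linear property of its elements need only be checked
    on the products a [x, y] b. *)
Definition comI z := forall X, is_subspace X -> comm_vanish X -> X z.

Lemma comI_subspace : is_subspace comI.
Proof.
by split=> [X [] //|c x y hx hy X sX cX]; apply: sX.2; [apply: hx | apply: hy].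
Qed.

Lemma comI_comm : comm_vanish comI.
Proof. by move=> a x y b X _; apply. Qed.

Lemma comI_mull a z : comI z -> comI (hmul H a z).
Proof.
move=> /(_ (fun z => comI (hmul H a z))); apply.
  split=> [|c x y hx hy]; first by rewrite raddf0; apply: comI_subspace.1.
  by rewrite linearP; apply: comI_subspace.2.
by move=> b x y c; rewrite -hmulA //; apply: comI_comm.
Qed.

Lemma comI_mulr b z : comI z -> comI (hmul H z b).
Proof.
move=> /(_ (fun z => comI (hmul H z b))); apply.
  split=> [|c x y hx hy]; first by rewrite -[hmul H 0 b]/(hmulr H b 0) raddf0; apply: comI_subspace.1.
  by rewrite hmulDl hmulZl; apply: comI_subspace.2.
by move=> a x y c; rewrite !hmulA //; apply: comI_comm.
Qed.

Lemma comI_quotient : exists r (p : 'M[F]_(n, r)) (s : 'M[F]_(r, n)),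
  s *m p = 1%:M /\ forall z, z *m p = 0 <-> comI z.
Proof.
have [M MP] := subspaceP comI_subspace.
have /row_fullP [s sp] := col_base_full (cokermx M).
exists _, (col_base (cokermx M)), s; split=> // z.
rewrite -MP submxE; split=> [zp|/eqP].
  by rewrite -(mulmx_base (cokermx M)) mulmxA zp mul0mx.
rewrite -{1}(mulmx_base (cokermx M)) mulmxA => /eqP.
by rewrite mulmx_free_eq0 ?row_base_free // => /eqP.
Qed.

Section Quotient.
Variables (r : nat) (p : 'M[F]_(n, r)) (s : 'M[F]_(r, n)).
Hypotheses (sp : s *m p = 1%:M) (pI : forall z, z *m p = 0 <-> comI z).

(** Structure constants computed on representatives, through the linear section [s] of the quotient
    map [p]. *)
Definition quo : hopf_data F r := HopfData
  (fun i j => hmul H (row i s) (row j s) *m p)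
  (hu H *m p)
  (fun i => p^T *m hcomul H (row i s) *m p)
  (fun i => hcounit H (row i s))
  (s *m hs H *m p).

Let lift (a : 'rV[F]_r) : exists x, a = x *m p.
Proof. by exists (a *m s); rewrite -mulmxA sp mulmx1. Qed.

Let row_s (a : 'rV[F]_r) : a *m s = \sum_i a 0 i *: row i s.
Proof. exact: mulmx_sum_row. Qed.

Let lin_ps (U : lmodType F) (f : {linear 'rV[F]_n -> U}) x :
  (forall z, comI z -> f z = 0) -> f (x *m p *m s) = f x.
Proof.
move=> f0; apply/eqP; rewrite -subr_eq0 -linearB; apply/eqP/f0/pI.
by rewrite mulmxBl -!mulmxA sp mulmx1 subrr.
Qed.

Lemma quo_mul (a b : 'rV[F]_r) : hmul quo a b = hmul H (a *m s) (b *m s) *m p.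
Proof.
rewrite {1}/hmul !row_s hmul_suml mulmx_suml; apply: eq_bigr => i _.
rewrite raddf_sum mulmx_suml; apply: eq_bigr => j _ /=.
by rewrite hmulZl hmulZr scalerA -scalemxAl.
Qed.

Lemma quo_pM x y : hmul quo (x *m p) (y *m p) = hmul H x y *m p.
Proof.
rewrite quo_mul.
pose f := (mulmxr p \o hmul H (x *m p *m s) : {linear _ -> _}).
rewrite -[LHS]/(f _) lin_ps /=; last first.
  by move=> z zI; exact: ((pI _).2 (comI_mull _ zI)).
pose g := (mulmxr p \o hmulr H y : {linear _ -> _}).
rewrite /f /= -[LHS]/(g _) lin_ps //.
by move=> z zI; exact: ((pI _).2 (comI_mulr _ zI)).
Qed.

Lemma quo_comm : hopf_commutative quo.
Proof.
move=> a b; have [x ->] := lift a; have [y ->] := lift b; rewrite !quo_pM.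
apply/eqP; rewrite -subr_eq0 -mulmxBl; apply/eqP/pI.
have := comI_comm (hu H) x y (hu H); by rewrite hmul1x // hmulx1.
Qed.

(** The commutator ideal is a coideal because (p (x) p) Delta is multiplicative with values in the
    commutative algebra quo (x) quo. *)
Lemma quo_comul0 z : comI z -> p^T *m hcomul H z *m p = 0.
Proof.
move=> /(_ (fun z => p^T *m hcomul H z *m p = 0)); apply.
  split=> [|c x y hx hy]; first by rewrite raddf0 mulmx0 mul0mx.
  by rewrite linearP mulmxDr mulmxDl -scalemxAr -scalemxAl hx hy scaler0 addr0.
move=> a x y b; rewrite hcomulM // (tmul_morph quo_pM) hcomulM // (tmul_morph quo_pM).
rewrite raddfB /= !hcomulM // mulmxBr mulmxBl !(tmul_morph quo_pM).
rewrite [X in _ - X](tmulC _ _ quo_comm) subrr.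
by rewrite -[tmul quo 0 _]/(tmulr quo _ 0) !raddf0.
Qed.

Lemma quo_comul a : hcomul quo a = p^T *m hcomul H (a *m s) *m p.
Proof.
rewrite row_s (raddf_sum (hcomul H)) mulmx_sumr mulmx_suml; apply: eq_bigr => i _ /=.
by rewrite linearZ /= -scalemxAr -scalemxAl.
Qed.

Lemma quo_pD x : hcomul quo (x *m p) = p^T *m hcomul H x *m p.
Proof.
rewrite quo_comul.
pose f := (mulmxr p \o (mulmx p^T \o hcomul H) : {linear _ -> _}).
by rewrite -[LHS]/(f _) lin_ps // => z /quo_comul0.
Qed.

Lemma quo_counit a : hcounit quo a = hcounit H (a *m s).
Proof.
by rewrite row_s (raddf_sum (hcounit H)); apply: eq_bigr => i _ /=; rewrite linearZ.
Qed.

Lemma quo_pe x : hcounit quo (x *m p) = hcounit H x.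
Proof.
rewrite quo_counit.
have e0 z : comI z -> hcounit H z = 0.
  move=> /(_ (fun z => hcounit H z = 0)); apply.
    split=> [|c y y' hy hy']; first by rewrite raddf0.
    by rewrite linearP /= hy hy' mulr0 addr0.
  move=> a y y' b; rewrite !hcounitM // raddfB /= !hcounitM //; ring.
apply/eqP; rewrite -subr_eq0 -raddfB /=; apply/eqP/e0/pI.
by rewrite mulmxBl -!mulmxA sp mulmx1 subrr.
Qed.

(* Right multiplications embed the quotient in a matrix ring, so that its elements can
   serve as values of a convolution ring, where inverses are unique. *)
Definition rho (a : 'rV[F]_r) : 'M[F]_r := lin1_mx (hmulr quo a).

Lemma rhoE a b : b *m rho a = hmul quo b a.
Proof. exact: mul_rV_lin1. Qed.

Lemma rho_inj : injective rho.
Proof.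
move=> a b /(congr1 (mulmx (hu quo))); rewrite !rhoE.
have [x ->] := lift a; have [y ->] := lift b.
by rewrite /= !quo_pM !hmul1x.
Qed.

Lemma quo_mulA a b c : hmul quo (hmul quo a b) c = hmul quo a (hmul quo b c).
Proof.
have [x ->] := lift a; have [y ->] := lift b; have [z ->] := lift c.
by rewrite !quo_pM hmulA.
Qed.

Lemma rhoM a b : rho (hmul quo a b) = rho a *m rho b.
Proof.
by apply/row_matrixP=> i; rewrite !rowE mulmxA !rhoE quo_mulA.
Qed.

Lemma rho_lin : linear rho.
Proof.
by move=> c a b; apply/row_matrixP=> i; rewrite !rowE mulmxDr -scalemxAr !rhoE linearP.
Qed.
HB.instance Definition _ := GRing.isLinear.Build F _ _ _ rho rho_lin.

Lemma scalar_central (c : F) (x : 'M[F]_r) : scalar_mx c * x = x * scalar_mx c.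
Proof. by rewrite -[LHS]/(_ *m _) -[RHS]/(_ *m _) scalar_mxC. Qed.

Definition scal : central F 'M[F]_r :=
  @Central F 'M[F]_r (scalar_mx : {rmorphism F -> 'M[F]_r}) scalar_central.

Definition cvp : cv (hco hH) scal := [ffun i => rho (row i p)].
Definition cvS : cv (hco hH) scal := [ffun i => rho (row i (hs H *m p))].

Lemma cvSE (q : 'M[F]_(n, r)) (f : cv (hco hH) scal) x :
  (forall i, f i = rho (row i q)) -> ev f x = rho (x *m q).
Proof.
move=> fE; rewrite /ev mulmx_sum_row raddf_sum; apply: eq_bigr => i _ /=.
by rewrite fE linearZ /= -mul_scalar_mx.
Qed.

Lemma quo_anti_aux (f g : cv (hco hH) scal) (f' g' : {linear 'rV[F]_n -> 'rV[F]_n}) :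
  (forall i, f i = rho (f' (bvec i) *m p)) -> (forall i, g i = rho (g' (bvec i) *m p)) ->
  (forall x, mul_tensor H f' g' (hcomul H x) = hcounit H x *: hu H) -> f * g = 1.
Proof.
move=> fE gE h; apply/ffunP=> i; rewrite -!ev_bvec ev1 evM.
transitivity (rho (mul_tensor H f' g' (hcomul H (bvec i)) *m p)).
  rewrite /mul_tensor mulmx_suml raddf_sum; apply: eq_bigr => a _ /=.
  rewrite mulmx_suml raddf_sum; apply: eq_bigr => b _ /=.
  rewrite fE gE -scalemxAl linearZ /= -quo_pM rhoM.
  exact: mul_scalar_mx.
rewrite h -scalemxAl linearZ /=; transitivity (hcounit H (bvec i) *: (1%:M : 'M[F]_r)).
  congr (_ *: _); apply/row_matrixP=> j; rewrite !rowE rhoE mulmx1.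
  by have [x ->] := lift (delta_mx 0 j); rewrite quo_pM hmulx1.
by rewrite scale_scalar_mx mulr1.
Qed.

Lemma cvSp : cvS * cvp = 1.
Proof.
apply: (@quo_anti_aux _ _ (hanti H) idfun).
- by move=> i; rewrite ffunE /hanti -mulmxA rowE.
- by move=> i; rewrite ffunE /= rowE.
by move=> x; rewrite -hantiL.
Qed.

Lemma cvpS : cvp * cvS = 1.
Proof.
apply: (@quo_anti_aux _ _ idfun (hanti H)).
- by move=> i; rewrite ffunE /= rowE.
- by move=> i; rewrite ffunE /hanti -mulmxA rowE.
by move=> x; rewrite -hantiR.
Qed.

Lemma cvp_mm : pull _ (mm H) cvp =
  pull (tens (hco hH) (hco hH)) (pr1 (hco hH)) cvp * pull _ (pr2 (hco hH)) cvp.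
Proof.
apply/ffunP=> -[i j]; rewrite pr12 -[LHS]ev2_bvec ev2_mm /= (cvSE (q := p)); last first.
  by move=> k; rewrite ffunE.
by rewrite !ffunE -[RHS]rhoM !rowE quo_pM.
Qed.

(** Both sides are convolution inverses of [p] composed with the multiplication, which is [p1 * p2]
    by [cvp_mm]. *)
Lemma cvS_mm : pull _ (mm H) cvS =
  pull (tens (hco hH) (hco hH)) (pr2 (hco hH)) cvS * pull _ (pr1 (hco hH)) cvS.
Proof.
set S1 := pull _ (pr1 _) _; set S2 := pull _ (pr2 _) _; set mS := pull _ _ _.
pose p1 := pull (tens (hco hH) (hco hH)) (pr1 (hco hH)) cvp.
pose p2 := pull (tens (hco hH) (hco hH)) (pr2 (hco hH)) cvp.
have E1 : p1 * S1 = 1 by rewrite -(pullM (pr1P _ _)) cvpS pull1 //; exact: pr1P.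
have E2 : p2 * S2 = 1 by rewrite -(pullM (pr2P _ _)) cvpS pull1 //; exact: pr2P.
have E3 : mS * (p1 * p2) = 1.
  by rewrite -cvp_mm -(pullM (mmP hH)) cvSp pull1 //; exact: mmP.
rewrite -[LHS]mulr1 -E1 -{1}[p1]mulr1 -E2 !mulrA -[mS * p1 * p2]mulrA.
by rewrite E3 mul1r.
Qed.

Lemma quo_antiM x y : hanti H (hmul H x y) *m p =
  hmul quo (hanti H y *m p) (hanti H x *m p).
Proof.
apply: rho_inj; rewrite rhoM.
have E z : rho (hanti H z *m p) = ev cvS z.
  by rewrite (cvSE (q := hs H *m p)) ?mulmxA // => i; rewrite ffunE.
rewrite !E -ev2_mm cvS_mm /ev2 /ev.
transitivity (\sum_i \sum_j scal (x 0 i * y 0 j) * (cvS j * cvS i)).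
  by apply: eq_bigr => i _; apply: eq_bigr => j _; rewrite pr21.
rewrite exchange_big /= -[RHS]/(_ * _) big_distrlr /=.
apply: eq_bigr => j _; apply: eq_bigr => i _.
by rewrite [RHS](cmMM scal (y 0 j) (x 0 i)) [y 0 j * _]mulrC.
Qed.

(** Since S is antimultiplicative modulo the ideal and the quotient is commutative, S maps
    commutators into the ideal. *)
Lemma quo_anti0 z : comI z -> hanti H z *m p = 0.
Proof.
move=> /(_ (fun z => hanti H z *m p = 0)); apply.
  split=> [|c x y hx hy]; first by rewrite raddf0 mul0mx.
  by rewrite linearP mulmxDl -scalemxAl hx hy scaler0 addr0.
move=> a x y b; rewrite quo_antiM quo_antiM raddfB /= mulmxBl !quo_antiM.
rewrite [X in _ - X]quo_comm subrr raddf0.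
by rewrite -[hmul quo 0 _]/(hmulr quo _ 0) raddf0.
Qed.

Lemma quo_pS x : hanti quo (x *m p) = hanti H x *m p.
Proof.
rewrite {1}/hanti /= !mulmxA.
pose f := (mulmxr p \o hanti H : {linear _ -> _}).
by rewrite -[LHS]/(f _) lin_ps // => z /quo_anti0.
Qed.

Let sandE (X : 'M[F]_n) a b :
  (p^T *m X *m p) a b = \sum_a' \sum_b' p a' a * p b' b * X a' b'.
Proof.
rewrite mxE; under eq_bigr => b' _ do rewrite mxE mulr_suml.
rewrite exchange_big; apply: eq_bigr => a' _; apply: eq_bigr => b' _.
by rewrite mxE; ring.
Qed.

Let sandT (X : 'M[F]_n) : p^T *m X^T *m p = (p^T *m X *m p)^T.
Proof. by rewrite !trmx_mul trmxK mulmxA. Qed.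

Lemma quo_hopf : is_hopf quo.
Proof.
split; first split.
- by move=> a b c; rewrite quo_mulA.
- by move=> a; have [x ->] := lift a; rewrite !quo_pM hmul1x // hmulx1.
- move=> x' a b c; have [x ->] := lift x'; rewrite quo_pD.
  (* Both sides become the image under p (x) p (x) p of an iterated coproduct of [x]. *)
  have -> : \sum_j (p^T *m hcomul H x *m p) j c * hd quo j a b =
     hcomul quo (row c (p^T *m (hcomul H x)^T) *m p) a b.
    rewrite hcomulE; apply: eq_bigr => j _; congr (_ * _).
    by rewrite -row_mul sandT [RHS]mxE [RHS]mxE.
  have -> : \sum_l (p^T *m hcomul H x *m p) a l * hd quo l b c =
     hcomul quo (row a (p^T *m hcomul H x) *m p) b c.
    rewrite hcomulE; apply: eq_bigr => j _; congr (_ * _).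
    by rewrite -row_mul [RHS]mxE.
  rewrite !quo_pD !sandE.
  transitivity (\sum_a' \sum_b' \sum_k p a' a * p b' b * p k c *
     (\sum_j hcomul H x j k * hd H j a' b')).
    apply: eq_bigr => a' _; apply: eq_bigr => b' _.
    under [RHS]eq_bigr => k _ do rewrite -mulrA; rewrite -mulr_sumr; congr (_ * _).
    rewrite hcomulE; under eq_bigr => j _ do rewrite !mxE mulr_suml.
    rewrite exchange_big; apply: eq_bigr => k _; rewrite mulr_sumr.
    by apply: eq_bigr => j _; rewrite !mxE mulrA.
  have coA : forall a' b' k, \sum_j hcomul H x j k * hd H j a' b' =
      \sum_l hcomul H x a' l * hd H l b' k by case: hH.
  under eq_bigr => a' _ do under eq_bigr => b' _ do under eq_bigr => k _ do rewrite coA.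
  rewrite exchange_big; apply: eq_bigr => b' _ /=.
  rewrite exchange_big; apply: eq_bigr => k _ /=.
  rewrite hcomulE; under [in RHS]eq_bigr => j _ do rewrite !mxE mulr_suml.
  rewrite exchange_big mulr_sumr; apply: eq_bigr => a' _ /=.
  rewrite !mulr_sumr; apply: eq_bigr => j _; rewrite !mxE; ring.
- have cc (f : 'I_n -> 'I_n -> F) (x : 'rV[F]_n) l : (forall k, \sum_i f i k * he H i = x 0 k) ->
    \sum_i (\sum_k f i k * p k l) * he H i = (x *m p) 0 l.
    move=> h; under eq_bigr => i _ do rewrite mulr_suml.
    rewrite exchange_big mxE; apply: eq_bigr => k _ /=; rewrite -h mulr_suml.
    by apply: eq_bigr => i _; ring.
  case: (hH) => _ _ [e1 e2] _ _; split=> x' l; have [x ->] := lift x'; rewrite quo_pD.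
    transitivity (hcounit quo (row l ((hcomul H x *m p)^T) *m p)).
      apply: eq_bigr => j _; congr (_ * _).
      by rewrite -row_mul trmx_mul sandT [RHS]mxE [RHS]mxE.
    rewrite quo_pe -(cc (fun i k => hcomul H x i k)) //.
    by apply: eq_bigr => i _; rewrite !mxE.
  transitivity (hcounit quo (row l (p^T *m hcomul H x) *m p)).
    by apply: eq_bigr => j _; congr (_ * _); rewrite -row_mul [RHS]mxE.
  rewrite quo_pe -(cc (fun i k => hcomul H x k i)) //.
  apply: eq_bigr => i _; rewrite !mxE; congr (_ * _); apply: eq_bigr => k _.
  by rewrite !mxE mulrC.
- split.
  + move=> a b; have [x ->] := lift a; have [y ->] := lift b.
    by rewrite quo_pM !quo_pD hcomulM // (tmul_morph quo_pM).
  + by rewrite quo_pD (glike1 hH).1 trmx_mul !mulmxA.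
  + move=> a b; have [x ->] := lift a; have [y ->] := lift b.
    by rewrite quo_pM !quo_pe hcounitM.
  by rewrite quo_pe (glike1 hH).2.
move=> a; have [x ->] := lift a; rewrite quo_pe quo_pD; split.
  rewrite (mul_tensor_morph quo_pM (f := hanti H) (g := idfun) _ (f' := hanti quo) (g' := idfun)) //.
    by rewrite (hantiL hH) -scalemxAl.
  exact: quo_pS.
rewrite (mul_tensor_morph quo_pM (f := idfun) (g := hanti H) _ (f' := idfun) (g' := hanti quo)) //.
  by rewrite (hantiR hH) -scalemxAl.
exact: quo_pS.
Qed.

Lemma quo_morph : hopf_morph H quo p.
Proof.
split=> //; [exact: quo_pM | exact: quo_pD | exact: quo_pe | exact: quo_pS].
Qed.

End Quotient.

(** The quotient by [comI] is itself a commutative Hopf quotient, so the projection onto H_ab cannot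
    kill more than [comI]. *)
Lemma abelianization_ker m (Q : hopf_data F m) (P : 'M[F]_(n, m)) x :
  is_abelianization H Q P -> x *m P = 0 -> comI x.
Proof.
move=> [_ _ _ _ univ] xP; have [r [p [s [sp pI]]]] := comI_quotient.
apply/pI/sub_kermxP.
apply: submx_trans (univ _ _ _ (quo_hopf sp pI) (quo_comm sp pI) (quo_morph sp pI)).
exact/sub_kermxP.
Qed.

End CommutatorIdeal.

(** * The grading by the group *)

(** The group written additively; the proof of commutativity is an argument of the type so that the
    abelian group structure can be attached to it. *)
Definition abz (gT : finGroupType) (abT : commutative (@mulg gT)) : Type := gT.

Section AbZmod.
Variables (gT : finGroupType) (abT : commutative (@mulg gT)).
HB.instance Definition _ := Finite.copy (abz abT) gT.
HB.instance Definition _ := GRing.isZmodule.Build (abz abT)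
  (@mulgA gT) abT (@mul1g gT) (@mulVg gT).
End AbZmod.

(** [gpi h] takes the coefficient at [h] of the image in F[D]. By [gpiM] these functionals are
    orthogonal idempotents of the dual algebra, and they cut H into its homogeneous parts. *)
Record grading (F : fieldType) (n : nat) (H : hopf_data F n) (D : finZmodType) := Grading {
  gpi : D -> 'I_n -> F;
  gpiM : forall h k i,
    \sum_a \sum_b hd H i a b * (gpi h a * gpi k b) = (h == k)%:R * gpi h i;
  gpi_sum : forall i, \sum_h gpi h i = he H i;
  gpi_mm : forall l i j,
    \sum_k hm H i j 0 k * gpi l k = \sum_h gpi h i * gpi (l - h) j;
  gpi_u : forall h, \sum_i hu H 0 i * gpi h i = (h == 0)%:R;
  gpi_surj : forall h, exists i, gpi h i != 0;
  gpi_ker : forall x : 'rV[F]_n, (forall h, \sum_i x 0 i * gpi h i = 0) -> comI H x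
}.

Lemma grankK (gT : finGroupType) (g : gT) : Defs.gval (grank g) = g.
Proof. exact: enum_rankK. Qed.

Lemma grank_eq (gT : finGroupType) (g h : gT) : (grank g == grank h) = (g == h).
Proof. exact: (inj_eq enum_rank_inj). Qed.

Section GroupPi.
Variables (F : fieldType) (n : nat) (H : hopf_data F n).
Variables (gT : finGroupType) (abT : commutative (@mulg gT)) (q : 'M[F]_(n, #|gT|)).
Local Notation K := (group_algebra F gT).
Hypothesis comp_pM : forall x y, hmul K (x *m q) (y *m q) = hmul H x y *m q.
Hypothesis comp_pD : forall x, hcomul K (x *m q) = q^T *m hcomul H x *m q.
Hypothesis comp_pe : forall x, hcounit K (x *m q) = hcounit H x.
Hypothesis comp_pu : hu H *m q = hu K.
Hypothesis fq : row_full q.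
Hypothesis kerq : forall x, x *m q = 0 -> comI H x.

Local Notation D := (abz abT).
Definition group_pi (h : D) (i : 'I_n) : F := q i (grank (h : gT)).

Lemma sum_grank (f : 'I_(#|gT|) -> F) : \sum_j f j = \sum_(h : D) f (grank (h : gT)).
Proof.
rewrite (reindex (@enum_rank gT)) //=.
by exists enum_val => x _; rewrite (enum_rankK, enum_valK).
Qed.

Lemma bvec_q i : bvec i *m q = row i q.
Proof. by rewrite rowE. Qed.

Lemma piE (x : 'rV[F]_n) (h : D) : \sum_i x 0 i * group_pi h i = (x *m q) 0 (grank (h : gT)).
Proof. by rewrite [RHS]mxE. Qed.

Lemma group_piM h k i :
  \sum_a \sum_b hd H i a b * (group_pi h a * group_pi k b) = (h == k)%:R * group_pi h i.
Proof.
have := comp_pD (bvec i); rewrite hcomul_bvec => /matrixP/(_ (grank (h : gT)) (grank (k : gT))).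
rewrite [RHS]mxE => E; transitivity (hcomul K (bvec i *m q) (grank (h : gT)) (grank (k : gT))).
  rewrite E exchange_big; apply: eq_bigr => b _ /=.
  rewrite mxE mulr_suml; apply: eq_bigr => a _; rewrite mxE /group_pi; ring.
rewrite hcomulE bvec_q (bigD1 (grank (h : gT))) //= big1 ?addr0.
  rewrite !mxE eqxx /= grank_eq mulrC eq_sym.
  by congr (_ * _); rewrite /group_pi mxE.
by move=> j /negPf jh; rewrite [delta_mx _ _ _ _]mxE eq_sym jh mulr0.
Qed.

Lemma group_pi_sum i : \sum_h group_pi h i = he H i.
Proof.
rewrite -hcounit_bvec -comp_pe bvec_q -(sum_grank (fun j => q i j)).
by apply: eq_bigr => j _; rewrite [in RHS]mxE mulr1.
Qed.

Lemma group_pi_mm l i j :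
  \sum_k hm H i j 0 k * group_pi l k = \sum_h group_pi h i * group_pi (l - h) j.
Proof.
rewrite piE -hmul_bvec -comp_pM !bvec_q /hmul summxE.
rewrite (sum_grank (fun a => (\sum_b (row i q 0 a * row j q 0 b) *: hm K a b) 0 (grank (l : gT)))).
apply: eq_bigr => h _; rewrite summxE.
rewrite (sum_grank (fun b => ((row i q 0 (grank (h : gT)) * row j q 0 b) *: hm K _ b) 0 (grank (l : gT)))).
rewrite (bigD1 (l - h)) //= big1 ?addr0.
  rewrite mxE [delta_mx _ _ _ _]mxE !grankK eqxx /=.
  have -> : ((h : gT) * (l - h : D))%g = l.
    by rewrite -[LHS]/(h + (l - h) : D) addrC subrK.
  rewrite eqxx mulr1.
  by rewrite mxE [row j q _ _]mxE.
move=> k kl; rewrite mxE [delta_mx _ _ _ _]mxE !grankK eqxx /=.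
rewrite grank_eq (_ : _ == _ = false) ?mulr0 //.
apply/negbTE; apply: contra kl => /eqP ->.
by rewrite -[((h : gT) * k)%g]/(h + k : D) [h + k]addrC addrK.
Qed.

Lemma group_pi_u h : \sum_i hu H 0 i * group_pi h i = (h == 0)%:R.
Proof.
by rewrite piE comp_pu mxE eqxx /= grank_eq.
Qed.

Lemma group_pi_surj h : exists i, group_pi h i != 0.
Proof.
apply: Classical_Prop.NNPP => ne.
have /row_fullP [s sq] := fq.
have : (bvec (grank (h : gT)) *m s *m q) 0 (grank (h : gT)) = 1.
  by rewrite -mulmxA sq mulmx1 mxE !eqxx.
rewrite mxE big1 => [|i _]; first by move/esym/eqP; rewrite oner_eq0.
have [-> |ne'] := eqVneq (q i (grank (h : gT))) 0; first by rewrite mulr0.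
by case: ne; exists i.
Qed.

Lemma group_pi_ker (x : 'rV[F]_n) : (forall h, \sum_i x 0 i * group_pi h i = 0) -> comI H x.
Proof.
move=> h0; apply: kerq.
apply/rowP=> j; have := h0 (enum_val j : D).
by rewrite piE /grank enum_valK => ->; rewrite mxE.
Qed.

Definition morph_grading : grading H D :=
  Grading group_piM group_pi_sum group_pi_mm group_pi_u group_pi_surj group_pi_ker.

End GroupPi.

Section GroupGrading.
Variables (F : fieldType) (n : nat) (H : hopf_data F n) (hH : is_hopf H).
Variables (m : nat) (Q : hopf_data F m) (P : 'M[F]_(n, m)).
Hypothesis hab : is_abelianization H Q P.
Variables (gT : finGroupType) (Phi : 'M[F]_(m, #|gT|)).
Hypothesis hiso : hopf_iso Q (group_algebra F gT) Phi.

Local Notation K := (group_algebra F gT).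
Local Notation q := (P *m Phi).

Lemma group_mulC : commutative (@mulg gT).
Proof.
case: hab => _ cQ _ _ _; case: hiso => -[pM _ _ _ _] _ /row_fullP [s sP] g h.
have E x : bvec x = (bvec x *m s) *m Phi :> 'rV[F]_(#|gT|) by rewrite -mulmxA sP mulmx1.
have : hmul K (bvec (grank g)) (bvec (grank h)) = hmul K (bvec (grank h)) (bvec (grank g)).
  by rewrite (E (grank g)) (E (grank h)) !pM cQ.
rewrite !hmul_bvec /= !grankK => /rowP/(_ (grank (g * h)%g)).
rewrite !mxE !eqxx /=; case: eqP => [/enum_rank_inj //|_ /eqP].
by rewrite oner_eq0.
Qed.

Lemma comp_pM x y : hmul K (x *m q) (y *m q) = hmul H x y *m q.
Proof.
case: hab => _ _ [pM _ _ _ _] _ _; case: hiso => -[pM' _ _ _ _] _ _.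
by rewrite !mulmxA pM' pM.
Qed.

Lemma comp_pD x : hcomul K (x *m q) = q^T *m hcomul H x *m q.
Proof.
case: hab => _ _ [_ _ pD _ _] _ _; case: hiso => -[_ _ pD' _ _] _ _.
by rewrite mulmxA pD' pD trmx_mul !mulmxA.
Qed.

Lemma comp_pe x : hcounit K (x *m q) = hcounit H x.
Proof.
case: hab => _ _ [_ _ _ pe _] _ _; case: hiso => -[_ _ _ pe' _] _ _.
by rewrite mulmxA pe' pe.
Qed.

Lemma comp_pu : hu H *m q = hu K.
Proof.
case: hab => _ _ [_ pu _ _ _] _ _; case: hiso => -[_ pu' _ _ _] _ _.
by rewrite mulmxA -pu -pu'.
Qed.

Lemma comp_full : row_full q.
Proof.
case: hab => _ _ _ /row_fullP [s sP] _; case: hiso => _ _ /row_fullP [s' sP'].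
by apply/row_fullP; exists (s' *m s); rewrite mulmxA -(mulmxA s') sP mulmx1.
Qed.

Lemma comp_ker x : x *m q = 0 -> comI H x.
Proof.
rewrite mulmxA => /eqP xq; apply: (abelianization_ker hH hab).
by case: hiso => _ fPhi _; move: xq; rewrite mulmx_free_eq0 // => /eqP.
Qed.

Definition group_grading : grading H (abz group_mulC) :=
  morph_grading group_mulC comp_pM comp_pD comp_pe comp_pu comp_full comp_ker.

End GroupGrading.

(** * Degrees of the values of t^-1, sigma and sigma^-1 *)

Section Graded.
Variables (F : fieldType) (n : nat) (H : hopf_data F n) (hH : is_hopf H).
Variables (L : fieldType) (iota : central F L).
Local Notation C := (hco hH).
Local Notation CC := (tens C C).
Local Notation cvL := (cv C iota).
Local Notation cvLL := (cv CC iota).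

Definition T1 (f : cvL) : cvLL := pull CC (pr1 C) f.
Definition T2 (f : cvL) : cvLL := pull CC (pr2 C) f.
Definition Mm (f : cvL) : cvLL := pull CC (mm H) f.

Lemma T1M f g : T1 (f * g) = T1 f * T1 g. Proof. exact: (pullM (pr1P _ _)). Qed.
Lemma T2M f g : T2 (f * g) = T2 f * T2 g. Proof. exact: (pullM (pr2P _ _)). Qed.
Lemma MmM f g : Mm (f * g) = Mm f * Mm g. Proof. exact: (pullM (mmP hH)). Qed.
Lemma T1_1 : T1 1 = 1. Proof. exact: (pull1 _ (pr1P _ _)). Qed.
Lemma T2_1 : T2 1 = 1. Proof. exact: (pull1 _ (pr2P _ _)). Qed.
Lemma Mm_1 : Mm 1 = 1. Proof. exact: (pull1 _ (mmP hH)). Qed.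
Lemma T12E f g i j : (T1 f * T2 g) (i, j) = f i * g j.
Proof. exact: (pr12 f g (i, j)). Qed.
Lemma T12C f g : T1 f * T2 g = T2 g * T1 f.
Proof. by apply/ffunP=> i; rewrite [LHS]pr12 [RHS]pr21 mulrC. Qed.

Section Sigma.
Variables t u : cvL.
Definition sigma : cvLL := T1 t * T2 t * Mm u.
Definition sigmai : cvLL := Mm t * (T1 u * T2 u).
Hypotheses (tu : t * u = 1) (ut : u * t = 1).

Lemma sigma_Mm : sigma * Mm t = T1 t * T2 t.
Proof. by rewrite /sigma -mulrA -MmM ut Mm_1 mulr1. Qed.

Lemma sigmai_T2 : sigmai * T2 t = Mm t * T1 u.
Proof. by rewrite /sigmai -!mulrA -T2M ut T2_1 mulr1. Qed.

Lemma sigmai_TT : sigmai * (T1 t * T2 t) = Mm t.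
Proof.
rewrite /sigmai -mulrA T12C (mulrA (T2 u * T1 u)) -(mulrA (T2 u)) -T1M ut T1_1 mulr1.
by rewrite -T2M ut T2_1 mulr1.
Qed.

Lemma Mmu_sigmai : Mm u * sigmai = T1 u * T2 u.
Proof. by rewrite /sigmai mulrA -MmM ut Mm_1 mul1r. Qed.

Lemma tg_unit g : glike H g -> ev t g * ev u g = 1.
Proof. by move=> gg; rewrite -evM_glike // tu ev1 gg.2 rmorph1. Qed.

Lemma ug g : glike H g -> ev u g = (ev t g)^-1.
Proof.
move=> gg; have E := tg_unit gg.
have tg0 : ev t g != 0.
  by apply/eqP => tg0; move/eqP: E; rewrite tg0 mul0r eq_sym oner_eq0.
by apply: (mulfI tg0); rewrite E divff.
Qed.

Lemma tg_neq0 g : glike H g -> ev t g != 0.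
Proof.
move=> /tg_unit E; apply/eqP => tg0.
by move/eqP: E; rewrite tg0 mul0r eq_sym oner_eq0.
Qed.

Section Grade.
Variables (D : finZmodType) (gr : grading H D).

Definition pp (h : D) : cvL := [ffun i => iota (gpi gr h i)].

Lemma ppM h k : pp h * pp k = if h == k then pp h else 0.
Proof.
apply/ffunP=> i; rewrite cvM.
have -> : (if h == k then pp h else 0) i = iota ((h == k)%:R * gpi gr h i).
  by case: eqP; rewrite ffunE ?mul1r ?mul0r ?rmorph0.
rewrite -gpiM rmorph_sum; apply: eq_bigr => a _; rewrite rmorph_sum; apply: eq_bigr => b _.
by rewrite !ffunE !rmorphM.
Qed.

Lemma pp_sum : \sum_h pp h = 1.
Proof.
apply/ffunP=> i; rewrite cv_sum cv1 /= -(gpi_sum gr) rmorph_sum.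
by apply: eq_bigr => h _; rewrite ffunE.
Qed.

Lemma Mm_pp l : Mm (pp l) = \sum_h T1 (pp h) * T2 (pp (l - h)).
Proof.
apply/ffunP=> -[i j]; rewrite cv_sum /Mm pullE.
under eq_bigr => k _ do rewrite ffunE -rmorphM.
rewrite -rmorph_sum gpi_mm rmorph_sum; apply: eq_bigr => h _.
by rewrite T12E !ffunE rmorphM.
Qed.

(** Evaluation at a group-like is multiplicative, so the [pp h] become orthogonal idempotents of sum
    1 in a field: exactly one of them is 1. *)
Lemma glike_deg g : glike H g -> exists h, forall k, ev (pp k) g = (k == h)%:R.
Proof.
move=> gg.
have M h k : ev (pp h) g * ev (pp k) g = (h == k)%:R * ev (pp h) g.
  rewrite -evM_glike // ppM; case: eqP => _; rewrite ?mul1r ?mul0r //.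
  by rewrite /ev big1 // => i _; rewrite cv0 mulr0.
have S : \sum_h ev (pp h) g = 1.
  by rewrite -ev_suml pp_sum ev1 gg.2 rmorph1.
have [h h0] : exists h, ev (pp h) g != 0.
  apply: NNPP => ne; move/eqP: S; rewrite big1 ?(eq_sym 0) ?oner_eq0 // => h _.
  by apply/eqP/negPn/negP => h0; apply: ne; exists h.
exists h => k; have [->|kh] := eqVneq k h.
  by apply: (mulfI h0); rewrite M eqxx mul1r mulr1.
by apply: (mulfI h0); rewrite M eq_sym (negPf kh) mulr0 mul0r.
Qed.

Section Family.
Variable P : D -> L -> Prop.
(** Axioms of a graded subring of [L] that contains the components of [t] and the inverses of the
    t_g. The constant family [A] yields [A_u]; the homogeneous fractions [PS] show that sigma has
    degree 0. *)
Record gfam := Gfam {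
  gf0 : forall h, P h 0;
  gfD : forall h a b, P h a -> P h b -> P h (a + b);
  gfM : forall h k a b, P h a -> P k b -> P (h + k) (a * b);
  gfc : forall c, P 0 (iota c);
  gft : forall h i, P h ((t * pp h) i);
  gfg : forall g h, glike H g -> (forall k, ev (pp k) g = (k == h)%:R) ->
          P (- h) (ev t g)^-1
}.
Hypothesis Pf : gfam.

Lemma gf_sum (J : finType) h (f : J -> L) : (forall j, P h (f j)) -> P h (\sum_j f j).
Proof. by move=> hf; elim/big_ind: _ => [|a b|//]; [apply: (gf0 Pf)|apply: (gfD Pf)]. Qed.

Lemma gfZ h c a : P h a -> P h (iota c * a).
Proof. by move=> Pa; rewrite -[h]add0r; apply: (gfM Pf) => //; apply: (gfc Pf). Qed.

Lemma gfN h a : P h a -> P h (- a).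
Proof. by move=> /(gfZ (-1)); rewrite rmorphN1 mulN1r. Qed.

(** Recursion along the flag: when Delta w = g (x) w + N, the equation t * u = 1 at [w] is solved
    for the value of [u] at [w] by dividing by t_g alone. *)
Lemma gf_u : pointed H -> forall x h, P (- h) (ev (pp h * u) x).
Proof.
move=> hpt; apply: (pointed_ind hH hpt).
  split=> [h|c x y hx hy h]; first by rewrite ev0r; apply: (gf0 Pf).
  by rewrite evDr evZr; apply: (gfD Pf); first apply: gfZ.
move=> w g N gg Dw hN h.
have [k kd] := glike_deg gg.
have ppU h' : pp h' * u = pp h' * (pp h' * u) by rewrite mulrA ppM eqxx.
have [->|hk] := eqVneq h k; last first.
  rewrite ppU (evM_flag _ _ Dw) kd (negPf hk) mul0r add0r.
  by apply: gf_sum => a; rewrite ffunE; apply: gfZ.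
(* Each idempotent is doubled, so that the two factors carry the opposite degrees h' and - h'. *)
have E : \sum_h' (t * pp h') * (pp h' * u) = 1.
  rewrite -[RHS]tu -[t in RHS]mulr1 -pp_sum mulr_sumr mulr_suml; apply: eq_bigr => h' _.
  by rewrite -!mulrA [pp h' * _]mulrA ppM eqxx.
have : ev t g * ev (pp k * u) w = iota (hcounit H w) -
    \sum_h' \sum_a (t * pp h') a * ev (pp h' * u) (row a N).
  apply/eqP; rewrite eq_sym subr_eq -ev1 -E ev_suml.
  under eq_bigr => h' _ do rewrite (evM_flag _ _ Dw) evM_glike // kd.
  rewrite big_split /=; apply/eqP; congr (_ + _).
  rewrite (bigD1 k) //= eqxx mulr1 big1 ?addr0 // => h' /negPf ->.
  by rewrite mulr0 mul0r.
move/(congr1 ( *%R (ev t g)^-1)); rewrite mulKf ?tg_neq0 // => ->.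
rewrite -[- k]addr0; apply: (gfM Pf); first exact: (gfg Pf gg kd).
apply: (gfD Pf) => //; first exact: (gfc Pf).
apply: gfN; apply: gf_sum => h'; apply: gf_sum => a.
by rewrite -(subrr h'); apply: (gfM Pf) => //; apply: (gft Pf).
Qed.

Lemma gf_ui : pointed H -> forall i h, P (- h) ((pp h * u) i).
Proof. by move=> hpt i h; rewrite -ev_bvec; apply: gf_u. Qed.

Lemma gf_conv (J : finType) (E : coalg F J) (f g : cv E iota) h k :
  (forall i, P h (f i)) -> (forall i, P k (g i)) -> forall i, P (h + k) ((f * g) i).
Proof.
move=> hf hg i; rewrite cvM; apply: gf_sum => a; apply: gf_sum => b.
by apply: gfZ; apply: (gfM Pf).
Qed.

Lemma gf_pull (I J : finType) (E : coalg F I) (E' : coalg F J) M (f : cv E' iota) h :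
  (forall i, P h (f i)) -> forall i, P h (pull E M f i).
Proof. by move=> hf i; rewrite pullE; apply: gf_sum => j; apply: gfZ. Qed.

Let a_ h := T1 (pp h).
Let b_ h := T2 (pp h).

Lemma TT_pp h k h' k' : a_ h * b_ k * (a_ h' * b_ k') =
  if (h == h') && (k == k') then a_ h * b_ k else 0.
Proof.
rewrite -!mulrA (mulrA (b_ k)) -(T12C (pp h') (pp k)) !mulrA -T1M ppM -mulrA -T2M ppM.
by case: eqP => /= _; case: eqP => _; rewrite ?pull0 /T1 /T2 ?pull0 ?mul0r ?mulr0.
Qed.

(** Multiplication adds degrees: on the part of bidegree (h, k), projecting the product to degree h
    + k changes nothing. *)
Lemma TT_Mm h k : a_ h * b_ k * Mm (pp (h + k)) = a_ h * b_ k.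
Proof.
rewrite Mm_pp mulr_sumr (bigD1 h) //= TT_pp eqxx (addrC h k) addrK eqxx /=.
rewrite big1 ?addr0 // => h' hh'; by rewrite TT_pp eq_sym (negPf hh').
Qed.

Lemma Mm_TT h k : Mm (pp (h + k)) * (a_ h * b_ k) = a_ h * b_ k.
Proof.
rewrite Mm_pp mulr_suml (bigD1 h) //= TT_pp eqxx (addrC h k) addrK eqxx /=.
rewrite big1 ?addr0 // => h' hh'; by rewrite TT_pp (negPf hh').
Qed.

Lemma TT_sum : \sum_h \sum_k a_ h * b_ k = 1.
Proof.
under eq_bigr => h _ do rewrite -mulr_sumr -pull_sum pp_sum -/(T2 1) T2_1 mulr1.
by rewrite -pull_sum pp_sum -/(T1 1) T1_1.
Qed.

Lemma gf_sigma : pointed H -> forall i, P 0 (sigma i).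
Proof.
move=> hpt i.
(* Inserting the idempotents of all bidegrees splits sigma into terms of degree h + k - (h + k). *)
have -> : sigma = \sum_h \sum_k (T1 (t * pp h) * T2 (t * pp k)) * Mm (pp (h + k) * u).
  rewrite /sigma -[T1 t * T2 t]mulr1 -TT_sum mulr_sumr mulr_suml; apply: eq_bigr => h _.
  rewrite mulr_sumr mulr_suml; apply: eq_bigr => k _.
  rewrite T1M T2M MmM -[in LHS]TT_Mm !mulrA.
  by rewrite -(mulrA (T1 t)) -(T12C (pp h) t) !mulrA.
rewrite cv_sum; apply: gf_sum => h; rewrite cv_sum; apply: gf_sum => k.
rewrite -(subrr (h + k)); apply: gf_conv => [[i1 i2]|].
  by rewrite T12E; apply: (gfM Pf); apply: (gft Pf).
by apply: gf_pull => j; apply: gf_ui.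
Qed.

Lemma gf_sigmai : pointed H -> forall i, P 0 (sigmai i).
Proof.
move=> hpt i.
have -> : sigmai = \sum_h \sum_k Mm (t * pp (h + k)) * (T1 (pp h * u) * T2 (pp k * u)).
  rewrite /sigmai -[T1 u * T2 u]mul1r -TT_sum mulr_suml mulr_sumr; apply: eq_bigr => h _.
  rewrite mulr_suml mulr_sumr; apply: eq_bigr => k _.
  rewrite T1M T2M MmM -[in LHS]Mm_TT -!mulrA; congr (_ * (_ * (_ * _))).
  by rewrite mulrA -(T12C u (pp k)) mulrA.
rewrite cv_sum; apply: gf_sum => h; rewrite cv_sum; apply: gf_sum => k.
rewrite -(subrr (h + k)); apply: gf_conv => [|[i1 i2]].
  by apply: gf_pull => j; apply: (gft Pf).
by rewrite T12E opprD; apply: (gfM Pf); apply: gf_ui.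
Qed.

End Family.
End Grade.
End Sigma.
End Graded.

(** * Finiteness over the generic base algebra *)

Section Finite.
Variables (F : fieldType) (n : nat) (H : hopf_data F n) (hH : is_hopf H).
Variables (L : fieldType) (iota : central F L).
Local Notation C := (hco hH).
Local Notation CC := (tens C C).
Variables t u : cv C iota.
Hypotheses (tu : t * u = 1) (ut : u * t = 1).
Local Notation sigma := (sigma t u).
Local Notation sigmai := (sigmai t u).
Local Notation T1 := (@T1 F n H hH L iota).
Local Notation T2 := (@T2 F n H hH L iota).
Local Notation Mm := (@Mm F n H hH L iota).

Variable B : L -> Prop.
Hypothesis Bc : forall c, B (iota c).
Hypothesis BD : forall a b, B a -> B b -> B (a + b).
Hypothesis BM : forall a b, B a -> B b -> B (a * b).
Hypothesis Bs : forall i, B (sigma i).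
Hypothesis Bsi : forall i, B (sigmai i).

Lemma B0 : B 0. Proof. by rewrite -(rmorph0 iota). Qed.
Lemma B1 : B 1. Proof. by rewrite -(rmorph1 iota). Qed.
Lemma BN b : B b -> B (- b).
Proof. by move=> bB; rewrite -mulN1r -(rmorphN1 iota); apply: BM. Qed.
Lemma BB a b : B a -> B b -> B (a - b).
Proof. by move=> aB bB; apply: BD => //; apply: BN. Qed.
Lemma B_sum (J : finType) (f : J -> L) : (forall j, B (f j)) -> B (\sum_j f j).
Proof. by move=> h; elim/big_ind: _ => //; exact: B0. Qed.

Lemma B_ev2 (f : cv CC iota) x y : (forall i, B (f i)) -> B (ev2 f x y).
Proof. by move=> fB; apply: B_sum => i; apply: B_sum => j; apply: BM. Qed.

Lemma ev2_TT f g x y : ev2 (T1 f * T2 g) x y = ev f x * ev g y.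
Proof.
rewrite /ev2 /ev big_distrlr; apply: eq_bigr => i _; apply: eq_bigr => j _ /=.
by rewrite T12E cmMM.
Qed.

Lemma ev2M_glike f f' (g g' : 'rV[F]_n) : glike H g -> glike H g' ->
  ev2 (f * f' : cv CC iota) g g' = ev2 f g g' * ev2 f' g g'.
Proof.
move=> [gg _] [gg' _]; rewrite ev2M gg gg' /ev2 mulr_suml; apply: eq_bigr => a _.
rewrite mulr_suml exchange_big /=; apply: eq_bigr => c _.
rewrite mulr_sumr; apply: eq_bigr => b _; rewrite mulr_sumr; apply: eq_bigr => d _.
by rewrite cmMM !mxE !big_ord1 !mxE; congr (iota _ * _); ring.
Qed.

(** sigma(1, 1) = t_1 t_1 t_1^-1. *)
Lemma B_t1 : B (ev t (hu H)).
Proof.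
have g1 := glike1 hH.
have : B (ev2 sigma (hu H) (hu H)) by apply: B_ev2.
rewrite ev2M_glike // ev2_TT ev2_mm hmul1x // -mulrA.
by rewrite tg_unit // mulr1.
Qed.

Lemma B_u1 : B (ev u (hu H)).
Proof.
have g1 := glike1 hH.
have : B (ev2 sigmai (hu H) (hu H)) by apply: B_ev2.
rewrite ev2M_glike // ev2_TT ev2_mm hmul1x // mulrA.
by rewrite tg_unit // mul1r.
Qed.

(** For an ideal [J] of [B] this is the product [J A]. *)
Definition modB (J : L -> Prop) (z : L) :=
  exists2 b : 'I_n -> L, forall i, J (b i) & z = \sum_i b i * t i.
Definition tring := modB B.
Local Notation A := tring.

Section Ideal.
Variable J : L -> Prop.
Hypothesis J0 : J 0.
Hypothesis JD : forall a b, J a -> J b -> J (a + b).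
Hypothesis JM : forall a b, B a -> J b -> J (a * b).

Lemma modB0 : modB J 0.
Proof. by exists (fun=> 0) => //; rewrite big1 // => i _; rewrite mul0r. Qed.

Lemma modBD x y : modB J x -> modB J y -> modB J (x + y).
Proof.
move=> [b bJ ->] [c cJ ->]; exists (fun i => b i + c i); first by move=> i; apply: JD.
by rewrite -big_split; apply: eq_bigr => i _; rewrite mulrDl.
Qed.

Lemma modBM b x : B b -> modB J x -> modB J (b * x).
Proof.
move=> bB [c cJ ->]; exists (fun i => b * c i); first by move=> i; apply: JM.
by rewrite mulr_sumr; apply: eq_bigr => i _; rewrite mulrA.
Qed.

Lemma modB_sum (I : finType) (f : I -> L) : (forall j, modB J (f j)) -> modB J (\sum_j f j).
Proof. by move=> h; elim/big_ind: _ => //; [exact: modB0 | exact: modBD]. Qed.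

Lemma J_modB b x : J b -> A x -> modB J (b * x).
Proof.
move=> bJ [c cB ->]; exists (fun i => c i * b); first by move=> i; apply: JM.
by rewrite mulr_sumr; apply: eq_bigr => i _; rewrite mulrCA mulrA.
Qed.
End Ideal.

Lemma A_t i : A (t i).
Proof.
exists (fun j => iota (i == j)%:R) => //; by rewrite sum_delta.
Qed.

Lemma A_0 : A 0. Proof. exact: (modB0 B0). Qed.
Lemma A_D x y : A x -> A y -> A (x + y). Proof. exact: modBD. Qed.
Lemma A_B b x : B b -> A x -> A (b * x). Proof. exact: modBM. Qed.
Lemma A_sum (I : finType) (f : I -> L) : (forall j, A (f j)) -> A (\sum_j f j).
Proof. by apply: modB_sum => //; exact: B0. Qed.

Lemma A_conv (I : finType) (E : coalg F I) (f g : cv E iota) :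
  (forall i, B (f i)) -> (forall i, A (g i)) -> forall i, A ((f * g) i).
Proof.
move=> fB gA i; rewrite cvM; apply: A_sum => a; apply: A_sum => b.
by apply: A_B => //; apply: A_B.
Qed.

Lemma A_pull (I J : finType) (E : coalg F I) (E' : coalg F J) M (f : cv E' iota) :
  (forall i, A (f i)) -> forall i, A (pull E M f i).
Proof. by move=> fA i; rewrite pullE; apply: A_sum => j; apply: A_B. Qed.

Lemma A_ev (f : cv C iota) x : (forall i, A (f i)) -> A (ev f x).
Proof. by move=> fA; apply: A_sum => j; apply: A_B. Qed.

Lemma A_tt i j : A (t i * t j).
Proof.
rewrite -(T12E t t) -(sigma_Mm ut); apply: A_conv => //.
by apply: A_pull; exact: A_t.
Qed.

Lemma A_M x y : A x -> A y -> A (x * y).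
Proof.
move=> [b bB ->] [c cB ->]; rewrite big_distrlr; apply: A_sum => i; apply: A_sum => j /=.
by rewrite mulrACA; apply: A_B; [apply: BM | apply: A_tt].
Qed.

Lemma A_1 : A 1.
Proof.
by rewrite -(tg_unit tu (glike1 hH)) mulrC; apply: A_B; [exact: B_u1 | apply: A_ev; exact: A_t].
Qed.

Lemma B_A b : B b -> A b.
Proof. by move=> bB; rewrite -[b]mulr1; apply: A_B => //; exact: A_1. Qed.

Lemma ev2_Mm_T1 f h g y : glike H g -> ev2 (Mm f * T1 h) g y = ev f (hmul H g y) * ev h g.
Proof.
move=> [gg _]; rewrite ev2M gg -ev2_mm /ev2 mulr_suml; apply: eq_bigr => a _.
rewrite mulr_suml exchange_big /=; apply: eq_bigr => c _.
rewrite mulr_sumr; apply: eq_bigr => b _.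
have <- : \sum_d hcomul H y c d * he H d = y 0 c by case: hH => _ _ [_ ->].
rewrite mulr_sumr rmorph_sum mulr_suml mulr_suml; apply: eq_bigr => d _.
by rewrite [T1 h _]pr1E /= !mxE big_ord1 !mxE !rmorphM; ring.
Qed.

(** Evaluated at (g, S g), the identity sigma^-1 * (eps (x) t) = (t o m) * (t^-1 (x) eps) puts t_1
    t_g^-1 in [A]; then t_1 is cancelled by t_1^-1, an element of [B]. *)
Lemma A_ug g : glike H g -> A (ev u g).
Proof.
move=> gg.
have : A (ev2 (sigmai * T2 t) g (hanti H g)).
  apply: A_sum => i; apply: A_sum => j; apply: A_B => //; apply: A_conv => //.
  by apply: A_pull; exact: A_t.
rewrite (sigmai_T2 ut) ev2_Mm_T1 // glike_inv // => Ag.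
rewrite -[ev u g]mul1r -(tg_unit tu (glike1 hH)) mulrAC mulrC.
by apply: A_B => //; exact: B_u1.
Qed.

Variables (D : finZmodType) (gr : grading H D).
Hypothesis hpt : pointed H.

Lemma A_u i : A (u i).
Proof.
have Ac c : A (iota c) by apply: B_A.
have Pf : @gfam F n H hH L iota t D gr (fun=> A).
  split=> //.
  - by move=> _; exact: A_0.
  - by move=> _; exact: A_D.
  - by move=> _ _; exact: A_M.
  - move=> h j; rewrite cvM; apply: A_sum => a; apply: A_sum => b; apply: A_B => //.
    by apply: A_M; [exact: A_t | rewrite ffunE].
  - by move=> g h gg _; rewrite -(ug tu gg); apply: A_ug.
rewrite -[u]mul1r -(pp_sum hH iota gr) mulr_suml cv_sum; apply: A_sum => h.
exact: (gf_ui tu Pf).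
Qed.

Definition hdeg (h : D) (x : 'rV[F]_n) :=
  forall k a, \sum_b hcomul H x a b * gpi gr k b = (k == h)%:R * x 0 a.

(** * Dropping a generator of degree zero *)

Section Step.
Variable M : L -> Prop.
Hypothesis MD : forall x y, M x -> M y -> M (x + y).
Hypothesis MB : forall b x, B b -> M x -> M (b * x).
Hypothesis M1 : M 1.
Variable x0 : 'rV[F]_n.
Hypothesis hx0 : hdeg 0 x0.
Let a := ev t x0.
Hypothesis AMa : forall z, A z -> exists2 c, B c & M (z - c * a).

(** The annihilator of [a] modulo [M]. Since [A] lies in [M + B a], the coefficient of [a] is
    defined up to this ideal, and the goal is that it contains 1. *)
Definition denomI b := B b /\ M (b * a).
Local Notation J := denomI.

Let MBB x y : M x -> M y -> M (x - y).
Proof. by move=> Mx My; apply: MD => //; rewrite -mulN1r; apply: MB => //; apply: BN; exact: B1. Qed.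

Let J0 : J 0.
Proof. by split; [exact: B0 | rewrite mul0r -[0](subrr 1); apply: MBB]. Qed.
Let JD x y : J x -> J y -> J (x + y).
Proof. by move=> [Bx Mx] [By My]; split; [apply: BD | rewrite mulrDl; apply: MD]. Qed.
Let JM x y : B x -> J y -> J (x * y).
Proof. by move=> Bx [By My]; split; [apply: BM | rewrite -mulrA; apply: MB]. Qed.
Let JN x : J x -> J (- x).
Proof. by rewrite -mulN1r; apply: JM; apply: BN; exact: B1. Qed.
Let JB x y : J x -> J y -> J (x - y).
Proof. by move=> Jx /JN; apply: JD. Qed.
Let J_sum (I : finType) (f : I -> L) : (forall j, J (f j)) -> J (\sum_j f j).
Proof. by move=> h; elim/big_ind: _. Qed.

(* Linear only modulo the ideal [denomI]. *)
Definition coefB (z : L) : L := epsilon (inhabits 0) (fun c => B c /\ M (z - c * a)).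
Local Notation f := coefB.

Lemma fP z : A z -> B (f z) /\ M (z - f z * a).
Proof.
move=> /AMa [c Bc' Mc].
exact: (epsilon_spec (inhabits 0) (fun c => B c /\ M (z - c * a)) (ex_intro _ c (conj Bc' Mc))).
Qed.

Lemma f_uniq z c : A z -> B c -> M (z - c * a) -> J (f z - c).
Proof.
move=> /fP [Bf Mf] Bc' Mc; split; first exact: BB.
have -> : (f z - c) * a = (z - c * a) - (z - f z * a) by ring.
exact: MBB.
Qed.

Lemma f_sum (I : finType) (b z : I -> L) : (forall i, B (b i)) -> (forall i, A (z i)) ->
  J (f (\sum_i b i * z i) - \sum_i b i * f (z i)).
Proof.
move=> bB zA; apply: f_uniq; first by apply: A_sum => i; apply: A_B.
  by apply: B_sum => i; apply: BM => //; case: (fP (zA i)).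
rewrite mulr_suml -sumrB; elim/big_ind: _ => //.
  by rewrite -[0](subrr 1); apply: MBB.
move=> i _; rewrite -mulrA -mulrBr; apply: MB => //; by case: (fP (zA i)).
Qed.

Lemma f_a : J (f a - 1).
Proof.
apply: f_uniq; [by apply: A_ev; exact: A_t | exact: B1 | rewrite mul1r subrr].
by rewrite -[0](subrr 1); apply: MBB.
Qed.

Lemma f_B b : B b -> J (f b).
Proof.
move=> bB; rewrite -[f b]subr0; apply: f_uniq; [exact: B_A | exact: B0 |].
by rewrite mul0r subr0 -[b]mulr1; apply: MB.
Qed.

Local Notation JA := (modB J).

Let JA_J b : J b -> JA b.
Proof. by move=> Jb; rewrite -[b]mulr1; apply: J_modB => //; exact: A_1. Qed.

Let JA_M x y : A x -> JA y -> JA (x * y).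
Proof.
move=> Ax [b bJ ->]; rewrite mulr_sumr; apply: modB_sum => // i.
by rewrite mulrCA; apply: J_modB => //; apply: A_M => //; exact: A_t.
Qed.

Let JA_N x : JA x -> JA (- x).
Proof. by rewrite -mulN1r; apply: modBM => //; apply: BN; exact: B1. Qed.

(** The parameter [y] is there for [WW_Psi], where [Psi (y * t d)] appears: vanishing must be known
    for all [y] in [A] for [Zset] to be an ideal. *)
Definition phi (y : L) : cv C iota := [ffun i => f (y * t i)].
Definition Psi (y : L) : cv C iota := u * phi y.
Definition chi (y : L) : cv CC iota := [ffun i => f (y * t i.1 * t i.2)].
Definition WW (y : L) : cv CC iota := T1 u * T2 u * chi y.

(** Multiply t o m = sigma^-1 * (t (x) t) by [y] and apply [f], which is [B]-linear modulo [J]; the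
    coefficients sigma^-1 lie in [B]. *)
Lemma Mm_phi y i : A y -> J ((Mm (phi y) - sigmai * chi y) i).
Proof.
move=> Ay; have yt k : A (y * t k) by apply: A_M => //; exact: A_t.
have ytt k l : A (y * t k * t l) by apply: A_M => //; exact: A_t.
rewrite cvD [X in _ + X]ffunE.
have E1 : J (f (y * Mm t i) - Mm (phi y) i).
  rewrite /Mm !pullE mulr_sumr; under eq_bigr => k _ do rewrite mulrCA.
  under [X in _ - X]eq_bigr => k _ do rewrite ffunE.
  exact: f_sum.
have E2 : J (f (y * Mm t i) - (sigmai * chi y) i).
  rewrite -(sigmai_TT ut) !cvM mulr_sumr.
  under eq_bigr => p _ do rewrite mulr_sumr.
  rewrite !pair_bigA /=.
  rewrite (eq_bigr (fun p => (iota (cd CC i p.1 p.2) * sigmai p.1) *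
      (y * t p.2.1 * t p.2.2))); last first.
    by move=> [p [p1 p2]] _ /=; rewrite T12E; ring.
  rewrite [X in _ - X](eq_bigr (fun p => (iota (cd CC i p.1 p.2) * sigmai p.1) *
      f (y * t p.2.1 * t p.2.2))); last first.
    by move=> [p p'] _ /=; rewrite [chi y _]ffunE mulrA.
  by apply: f_sum => // p; apply: BM.
have -> : Mm (phi y) i + - (sigmai * chi y) i =
  (f (y * Mm t i) - (sigmai * chi y) i) - (f (y * Mm t i) - Mm (phi y) i) by ring.
exact: JB.
Qed.

(** The identity (t^-1 o m) * sigma^-1 = t^-1 (x) t^-1 turns [Mm_phi] into an expression symmetric
    in [x] and [z]. *)
Lemma Psi_mul y x z : A y -> JA (ev (Psi y) (hmul H x z) - ev2 (WW y) x z).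
Proof.
move=> Ay; rewrite -ev2_mm -/(Mm _) /Psi MmM /WW -(Mmu_sigmai ut) -mulrA.
rewrite /ev2 -sumrB; apply: modB_sum => // i; rewrite -sumrB; apply: modB_sum => // j.
rewrite -mulrBr; apply: modBM => //.
have -> : (Mm u * Mm (phi y)) (i, j) - (Mm u * (sigmai * chi y)) (i, j) =
  (Mm u * (Mm (phi y) - sigmai * chi y)) (i, j).
  by rewrite mulrBr cvD [X in _ = _ + X]ffunE.
rewrite cvM; apply: modB_sum => // p; apply: modB_sum => // p'.
apply: modBM => //; apply: JA_M; last exact/JA_J/Mm_phi.
by apply: A_pull => k; exact: A_u.
Qed.

Lemma WW_E y x z : ev2 (WW y) x z = \sum_a \sum_b \sum_c \sum_d
  iota (hcomul H x a b * hcomul H z c d) * (u a * u c * f (y * t b * t d)).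
Proof.
rewrite ev2M; apply: eq_bigr => i _; apply: eq_bigr => j _.
by apply: eq_bigr => k _; apply: eq_bigr => l _; rewrite T12E ffunE.
Qed.

Lemma WW_sym y x z : ev2 (WW y) x z = ev2 (WW y) z x.
Proof.
rewrite !WW_E; under eq_bigr => i _ do rewrite exchange_big /=.
rewrite exchange_big /=; apply: eq_bigr => c _.
under eq_bigr => i _ do rewrite exchange_big /=.
rewrite exchange_big /=; apply: eq_bigr => d _.
apply: eq_bigr => i _; apply: eq_bigr => j _.
by rewrite [hcomul H x i j * _]mulrC [u i * u c]mulrC (mulrAC y).
Qed.

Lemma WW_Psi y x z : ev2 (WW y) x z =
  \sum_c \sum_d (iota (hcomul H z c d) * u c) * ev (Psi (y * t d)) x.
Proof.
rewrite WW_sym WW_E; apply: eq_bigr => c _; apply: eq_bigr => d _.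
rewrite evM mulr_sumr; apply: eq_bigr => i _; rewrite mulr_sumr; apply: eq_bigr => j _.
by rewrite ffunE rmorphM; ring.
Qed.

Definition Zset x := forall y, A y -> JA (ev (Psi y) x).

Lemma Zset_subspace : is_subspace Zset.
Proof.
split=> [y _|c x z hx hz y Ay]; first by rewrite ev0r; apply: modB0.
by rewrite evDr evZr; apply: modBD => //; [apply: modBM => //; apply: hx | apply: hz].
Qed.

Lemma Zset_W x z y : Zset x -> A y -> JA (ev2 (WW y) x z).
Proof.
move=> Zx Ay; rewrite WW_Psi; apply: modB_sum => // c; apply: modB_sum => // d.
by apply: JA_M; [apply: A_B => //; exact: A_u | apply: Zx; apply: A_M => //; exact: A_t].
Qed.

Lemma Zset_mulr x z : Zset x -> Zset (hmul H x z).
Proof.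
move=> Zx y Ay; rewrite -[ev _ _](subrK (ev2 (WW y) x z)); apply: modBD => //.
  exact: Psi_mul.
exact: Zset_W.
Qed.

Lemma Zset_mull x z : Zset x -> Zset (hmul H z x).
Proof.
move=> Zx y Ay; rewrite -[ev _ _](subrK (ev2 (WW y) z x)); apply: modBD => //.
  exact: Psi_mul.
by rewrite WW_sym; apply: Zset_W.
Qed.

Lemma Zset_comm x z : Zset (hmul H x z - hmul H z x).
Proof.
move=> y Ay; rewrite -scaleN1r evDr evZr rmorphN1 mulN1r.
have -> : ev (Psi y) (hmul H x z) - ev (Psi y) (hmul H z x) =
  (ev (Psi y) (hmul H x z) - ev2 (WW y) x z) - (ev (Psi y) (hmul H z x) - ev2 (WW y) z x).
  by rewrite (WW_sym y z x); ring.
by apply: modBD => //; [|apply: JA_N]; apply: Psi_mul.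
Qed.

Lemma Zset_comI x : comI H x -> Zset x.
Proof.
apply; first exact: Zset_subspace.
by move=> b y z c; apply: Zset_mull; apply: Zset_mulr; apply: Zset_comm.
Qed.

Lemma ev_phi x : J (f (ev t x) - ev (phi 1) x).
Proof.
rewrite /ev; under [X in _ - X]eq_bigr => i _ do rewrite ffunE mul1r.
by apply: f_sum => // i; exact: A_t.
Qed.

Lemma JA_phi : JA (ev (phi 1) x0).
Proof.
have -> : phi 1 = t * Psi 1 by rewrite /Psi mulrA tu mul1r.
rewrite evM_row; apply: modB_sum => // i; apply: JA_M; first exact: A_t.
(* As [x0] has degree 0, each row of Delta x0 is a multiple of 1 modulo the commutator ideal, on
   which [Psi 1] vanishes. *)
rewrite -[row _ _](subrK (x0 0 i *: hu H)) evDr; apply: modBD => //.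
  apply: Zset_comI; last exact: A_1.
  refine (@gpi_ker _ _ _ _ gr _ _) => h; under eq_bigr => k _ do rewrite !mxE mulrBl -mulrA.
  by rewrite sumrB hx0 -mulr_sumr gpi_u mulrC subrr.
rewrite evZr evM_glike; last exact: glike1.
apply: modBM => //; apply: JA_M; first by apply: A_ev; exact: A_u.
(* t_1 lies in [B], hence in [M], so its coefficient along [a] is 0 modulo [J]. *)
apply: JA_J; have -> : ev (phi 1) (hu H) = f (ev t (hu H)) - (f (ev t (hu H)) - ev (phi 1) (hu H)) by ring.
by apply: JB; [apply: f_B; exact: B_t1 | exact: ev_phi].
Qed.

Lemma JA_1 : JA 1.
Proof.
have -> : 1 = ev (phi 1) x0 + ((f a - ev (phi 1) x0) - (f a - 1)) by ring.
by apply: modBD => //; [exact: JA_phi | apply/JA_J/JB; [exact: ev_phi | exact: f_a]].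
Qed.

Definition Jcong x y := [/\ B x, B y & J (x - y)].

Lemma Jcong_sum (I : finType) (x y : I -> L) :
  (forall i, Jcong (x i) (y i)) -> Jcong (\sum_i x i) (\sum_i y i).
Proof.
move=> h; split; try by apply: B_sum => i; case: (h i).
by rewrite -sumrB; apply: J_sum => i; case: (h i).
Qed.

Lemma Jcong_M x y x' y' : Jcong x y -> Jcong x' y' -> Jcong (x * x') (y * y').
Proof.
move=> [Bx By Jx] [Bx' By' Jx']; split; try exact: BM.
have -> : x * x' - y * y' = x' * (x - y) + y * (x' - y') by ring.
by apply: JD; apply: JM.
Qed.

Lemma Jcong_refl x : B x -> Jcong x x.
Proof. by move=> Bx; split=> //; rewrite subrr. Qed.

Lemma Jcong_prod (I : finType) (x y : I -> L) :
  (forall i, Jcong (x i) (y i)) -> Jcong (\prod_i x i) (\prod_i y i).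
Proof.
move=> h; elim/big_ind2: _ => //; first exact: Jcong_refl B1.
by move=> *; apply: Jcong_M.
Qed.

(** From 1 in [J A] comes t = c t with [c] over [J]. So 1 - c kills the vector of the t_i, nonzero
    because t_1 is; its determinant vanishes, and it is 1 modulo [J]. *)
Lemma J_1 : J 1.
Proof.
have /fin_all_exists2 [c cJ cE] : forall i, exists2 b : 'I_n -> L,
    forall j, J (b j) & t i = \sum_j b j * t j.
  by move=> i; rewrite -[t i]mulr1; apply: JA_M; [exact: A_t | exact: JA_1].
pose N : 'M[L]_n := \matrix_(i, j) ((i == j)%:R - c i j).
have N0 : \det N = 0.
  apply/eqP; rewrite -det_tr; apply/det0P.
  exists (\row_i t i).
    apply/eqP => /rowP t0; have := tg_neq0 tu (glike1 hH).
    by rewrite /ev big1 ?eqxx // => i _; have := t0 i; rewrite !mxE => ->; rewrite mulr0.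
  apply/rowP=> i; rewrite !mxE.
  under eq_bigr => j _ do rewrite !mxE mulrBr.
  rewrite sumrB (bigD1 i) //= eqxx mulr1 big1 ?addr0; last first.
    by move=> j /negPf ij; rewrite eq_sym ij mulr0.
  by rewrite {1}cE; apply/eqP; rewrite subr_eq0; apply/eqP/eq_bigr => j _; rewrite mulrC.
have [_ _] : Jcong (\det N) (\det (1%:M : 'M[L]_n)).
  apply: Jcong_sum => s; apply: Jcong_M.
    apply: Jcong_refl; rewrite -(rmorph_sign iota); exact: Bc.
  apply: Jcong_prod => i; rewrite !mxE.
  have Bd k : B ((i == k)%:R) by rewrite -(rmorph_nat iota); exact: Bc.
  split; [| exact: Bd |].
    by apply: BB; [exact: Bd | case: (cJ i (s i))].
  by rewrite addrAC subrr add0r; apply: JN.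
by rewrite N0 det1 sub0r => /JN; rewrite opprK.
Qed.

(* Modulo [J] the coefficient of [a] in [a] is 1, and it is also
   [t_x0 * Psi 1 (1) = 0]; hence 1 lies in [J A], and in [J] by the determinant trick. *)
Lemma drop_generator : M a.
Proof. by case: J_1 => _; rewrite mul1r. Qed.

End Step.
End Finite.

(** * Monomials of degree zero *)

Section Lattice.
Variable D : finZmodType.

Definition dg (a : D -> nat) : D := \sum_h h *+ a h.

(** Translation by [x] permutes the terms of the sum of all elements. *)
Lemma mulrn_card (x : D) : x *+ #|D| = 0.
Proof.
apply: (addrI (\sum_(h : D) h)); rewrite addr0.
by rewrite [RHS](reindex_inj (addIr x)) big_split sumr_const cardT.
Qed.

Lemma dgD a b : dg (fun h => a h + b h)%N = dg a + dg b.
Proof. by rewrite -big_split; apply: eq_bigr => h _; rewrite mulrnDr. Qed.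

Lemma dgZ k a : dg (fun h => k * a h)%N = dg a *+ k.
Proof. by rewrite -sumrMnl; apply: eq_bigr => h _; rewrite mulnC mulrnA. Qed.

Lemma dg1 x m : dg (fun h => if h == x then m else 0)%N = x *+ m.
Proof.
rewrite /dg (bigD1 x) //= eqxx big1 ?addr0 // => h /negPf ->.
by rewrite mulr0n.
Qed.

Lemma eq_dg a b : a =1 b -> dg a = dg b.
Proof. by move=> ab; apply: eq_bigr => h _; rewrite ab. Qed.

Lemma ex_min (Q : nat -> Prop) : (exists m, Q m) ->
  exists2 m, Q m & forall k, Q k -> (m <= k)%N.
Proof.
move=> [m0 Qm]; apply: NNPP => ne; suff: forall m, ~ Q m by move/(_ m0).
move=> m; elim/ltn_ind: m => m IH Qm'; apply: ne; exists m => // k Qk.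
by rewrite leqNgt; apply/negP => /IH.
Qed.

Lemma zmod_cancel (V : zmodType) (x r g y : V) : x + r + g - (x + y) = g + (r - y).
Proof. by rewrite opprD addrA -(addrA x) (addrC x) addrK addrA (addrC r). Qed.

(* Triangular basis, with natural exponents, of the kernel of [dg] on integer
   combinations of the elements of [s]. *)
Lemma lattice (s : seq D) : uniq s -> exists b : D -> D -> nat,
  [/\ (forall k, k \in s -> dg (b k) = 0),
      (forall k h, k \in s -> h \notin s -> b k h = 0%N),
      (forall c c' : D -> nat,
        (forall h, \sum_(k <- s) c k * b k h = \sum_(k <- s) c' k * b k h)%N ->
        forall k, k \in s -> c k = c' k) &
      (forall a : D -> nat, (forall h, h \notin s -> a h = 0%N) -> dg a = 0 ->
        exists c c' : D -> nat, forall h,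
          (a h + \sum_(k <- s) c' k * b k h = \sum_(k <- s) c k * b k h)%N)].
Proof.
elim: s => [_|x s IH /= /andP [xs us]].
  exists (fun _ _ => 0%N); split=> //.
  move=> a a0 _; exists (fun=> 0%N), (fun=> 0%N) => h.
  by rewrite !big_nil a0.
have [b [b1 b2 b3 b4]] := IH us.
(* The [m] for which m x lies in the subgroup generated by [s]; the least one is the diagonal entry
   of the new basis vector [bx]. *)
pose Q m := (0 < m)%N /\ exists2 be : D -> nat,
  (forall h, h \notin s -> be h = 0%N) & x *+ m + dg be = 0.
have [|m [m0 [be be0 mbe]] mmin] := @ex_min Q.
  exists #|D|; split; first by apply/card_gt0P; exists x.
  exists (fun=> 0%N) => //; rewrite mulrn_card add0r /dg big1 // => h _.
pose bx h := if h == x then m else be h.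
exists (fun k => if k == x then bx else b k).
have sE c h : (\sum_(k <- x :: s) c k * (if k == x then bx else b k) h =
     c x * bx h + \sum_(k <- s) c k * b k h)%N.
  rewrite big_cons eqxx; congr addn; apply: eq_big_seq => k ks.
  by case: eqP => // kx; rewrite -kx ks in xs.
have bsx k : k \in s -> b k x = 0%N by move=> ks; apply: b2.
have s0 c : (\sum_(k <- s) c k * b k x = 0)%N.
  by apply: big1_seq => k ks; rewrite bsx // muln0.
have bex : be x = 0%N by apply: be0.
have bxE h : bx h = ((if h == x then m else 0) + be h)%N.
  by rewrite /bx; case: eqP => [->|_]; rewrite ?bex ?addn0.
split.
- move=> k; rewrite inE; case: eqP => [_ _|_ /= ks]; last exact: b1.
  by rewrite (eq_dg bxE) dgD dg1.
- move=> k h; rewrite !inE negb_or => kxs /andP [hx hs]; move: kxs.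
  case: eqP => [_ _|_ /= ks]; last exact: b2.
  by rewrite /bx (negPf hx); apply: be0.
- move=> c c' E.
  (* Coordinate [x] sees only [bx], with entry m > 0. *)
  have Ex : c x = c' x.
    have := E x; rewrite !sE !s0 /bx eqxx !addn0 => /eqP.
    by rewrite eqn_pmul2r // => /eqP.
  move=> k; rewrite inE => /predU1P [->|ks] //; apply: b3 ks => h.
  by have := E h; rewrite !sE Ex => /addnI.
move=> a a0 da.
pose N := #|D|.-1.
have DN : #|D| = N.+1 by rewrite prednK //; apply/card_gt0P; exists x.
pose al h := if h == x then 0%N else a h.
have aE : a =1 (fun h => (if h == x then a x else 0) + al h)%N.
  by move=> h; rewrite /al; case: eqP => [->|]; rewrite ?addn0.
have dal : x *+ a x + dg al = 0 by rewrite -[RHS]da (eq_dg aE) dgD dg1.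
have alS h : h \notin s -> al h = 0%N.
  by move=> hs; rewrite /al; case: eqP => // /eqP hx; apply: a0; rewrite inE negb_or hx.
(* On [s], the vector a - q bx is the difference of [g1] and [g2], both with natural entries: N =
   |D| - 1 stands for -1. *)
pose q := (a x %/ m)%N.
pose g1 h := (al h + N * (q * be h))%N.
pose g2 h := (#|D| * (q * be h))%N.
have g1S h : h \notin s -> g1 h = 0%N by move=> hs; rewrite /g1 alS // be0 // !muln0.
have g2S h : h \notin s -> g2 h = 0%N by move=> hs; rewrite /g2 be0 // !muln0.
have dg2 : dg g2 = 0 by rewrite dgZ mulrn_card.
have dg1' : dg g1 = dg al - dg be *+ q.
  rewrite dgD dgZ dgZ; congr (_ + _); apply/eqP; rewrite -addr_eq0 -mulrSr -DN.
  by rewrite mulrn_card.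
have Er : x *+ (a x %% m) + dg g1 = 0.
  rewrite dg1' addrCA.
  have : x *+ a x + dg al - (x *+ m + dg be) *+ q = 0 by rewrite dal mbe mul0rn subr0.
  rewrite {1}(divn_eq (a x) m) -/q mulrnDr mulnC mulrnA mulrnDl => E.
  by rewrite -[RHS]E zmod_cancel.
(* With [g1] as witness, a nonzero remainder would be an element of [Q] smaller than [m]. *)
have r0 : (a x %% m = 0)%N.
  apply/eqP; rewrite -leqn0 leqNgt; apply/negP => r0.
  have /mmin : Q (a x %% m)%N by split=> //; exists g1.
  by rewrite leqNgt ltn_mod m0.
have [c1 [c1' C1]] : exists c c' : D -> nat, forall h,
   (g1 h + \sum_(k <- s) c' k * b k h = \sum_(k <- s) c k * b k h)%N.
  by apply: b4 => //; move: Er; rewrite r0 mulr0n add0r.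
have [c2 [c2' C2]] := b4 _ g2S dg2.
exists (fun k => if k == x then q else c1 k + c2' k)%N,
       (fun k => if k == x then 0%N else c2 k + c1' k)%N => h.
rewrite !sE eqxx mul0n add0n.
have S2 (e e' : D -> nat) v : (\sum_(k <- s) (if k == x then v else e k + e' k) * b k h =
   \sum_(k <- s) e k * b k h + \sum_(k <- s) e' k * b k h)%N.
  rewrite -big_split /=; apply: eq_big_seq => k ks.
  by case: eqP => [kx|_]; [rewrite -kx ks in xs | rewrite mulnDl].
rewrite !S2 -C1 -C2 bxE aE.
have Eq : (a x = q * m)%N by rewrite {1}(divn_eq (a x) m) r0 addn0.
have -> : ((if h == x then a x else 0) = q * (if h == x then m else 0))%N.
  by case: eqP => _; rewrite ?muln0.
rewrite /g1 /g2 DN mulnDr mulSn; lia.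
Qed.

End Lattice.

(** * Homogeneous coordinates *)

Section HomogBasis.
Variables (F : fieldType) (n : nat) (H : hopf_data F n) (hH : is_hopf H).
Variables (D : finZmodType) (gr : grading H D).
Hypothesis hpt : pointed H.

Definition idc : central F F := @Central F F (idfun : {rmorphism F -> F}) (@mulrC F).
Local Notation pp := (pp hH idc gr).

Lemma glike_hdeg g : glike H g -> exists h, hdeg gr h g /\ ev (pp h) g = 1.
Proof.
move=> gg; have [h hd] := glike_deg hH idc gr gg; exists h.
split; last by rewrite hd eqxx.
move=> k a; rewrite gg.1 -(hd k) /ev mulr_suml; apply: eq_bigr => b _.
by rewrite mxE big_ord1 !mxE ffunE /=; ring.
Qed.

(** Otherwise the functional of degree [h] would vanish along the flag, hence on H, against
    [gpi_surj]. *)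
Lemma glike_surj h : exists2 g, glike H g & hdeg gr h g.
Proof.
apply: NNPP => ne.
have X x : ev (pp h) x = 0.
  move: x; apply: (pointed_ind hH hpt).
    split=> [|c x y hx hy]; first by rewrite ev0r.
    by rewrite evDr evZr hx hy mulr0 addr0.
  move=> w g N gg Dw hN.
  have [k kd] := glike_deg hH idc gr gg.
  have [hk|hk] := eqVneq h k.
    case: ne; exists g => //; have [h' [hh' e1]] := glike_hdeg gg.
    move: (kd h'); rewrite e1 -hk => /eqP; case: (eqVneq h' h) => [<- //|_].
    by rewrite oner_eq0.
  have -> : pp h = pp h * pp h by rewrite ppM eqxx.
  rewrite (evM_flag _ _ Dw) kd (negPf hk) mul0r add0r big1 // => a _.
  by rewrite hN mulr0.
have [i] := gpi_surj gr h; have := X (bvec i); rewrite ev_bvec ffunE /= => ->.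
by rewrite eqxx.
Qed.

Definition hproj (h : D) (x : 'rV[F]_n) : 'rV[F]_n :=
  \row_a \sum_b hcomul H x a b * gpi gr h b.

Lemma hproj_hdeg h x : hdeg gr h (hproj h x).
Proof.
move=> k a; rewrite mxE.
have coA a' b' c : \sum_j hcomul H x j c * hd H j a' b' =
   \sum_l hcomul H x a' l * hd H l b' c by case: hH.
transitivity (\sum_b \sum_c gpi gr k b * gpi gr h c *
   (\sum_l hcomul H x a l * hd H l b c)).
  apply: eq_bigr => b _; rewrite hcomulE mulr_suml.
  under eq_bigr => j _ do rewrite mxE mulr_suml mulr_suml.
  rewrite exchange_big; apply: eq_bigr => c _ /=.
  by rewrite -coA mulr_sumr; apply: eq_bigr => j _; ring.
under eq_bigr => b _ do under eq_bigr => c _ do rewrite mulr_sumr.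
under eq_bigr => b _ do rewrite exchange_big /=.
rewrite exchange_big mulr_sumr /=; apply: eq_bigr => l _.
transitivity (hcomul H x a l * ((k == h)%:R * gpi gr k l)); last first.
  by case: eqP => [->|]; rewrite ?mul0r ?mul1r ?mulr0.
rewrite -gpiM mulr_sumr; apply: eq_bigr => b _; rewrite mulr_sumr.
by apply: eq_bigr => c _; ring.
Qed.

Lemma hproj_sum x : x = \sum_h hproj h x.
Proof.
apply/rowP=> a; rewrite summxE; under eq_bigr => h _ do rewrite mxE.
rewrite exchange_big /=; under eq_bigr => b _ do rewrite -mulr_sumr gpi_sum.
by case: hH => _ _ [_ ->].
Qed.

Lemma row_free_ker k (M : 'M[F]_(k, n)) :
  (forall c : 'rV_k, c *m M = 0 -> c = 0) -> row_free M.
Proof.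
move=> h; rewrite -kermx_eq0; apply/eqP/row_matrixP=> i; rewrite row0; apply: h.
by rewrite -row_mul mulmx_ker row0.
Qed.

Definition rmx (z : nat -> 'rV[F]_n) k : 'M[F]_(k, n) := \matrix_(i < k) z i.

Lemma rmxE z k (c : 'rV_k) : c *m rmx z k = \sum_(i < k) c 0 i *: z i.
Proof. by rewrite mulmx_sum_row; apply: eq_bigr => i _; rewrite rowK. Qed.

(** [m] bounds the number of missing vectors. A homogeneous one can always be added because the
    components [hproj h x] span H. *)
Lemma basis_extend m k (z : nat -> 'rV[F]_n) (d : nat -> D) : (n - k <= m)%N ->
  row_free (rmx z k) -> (forall i, (i < k)%N -> hdeg gr (d i) (z i)) ->
  exists z' d', [/\ row_free (rmx z' n), (forall i, (i < n)%N -> hdeg gr (d' i) (z' i)) &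
    (k <= n)%N /\ forall i, (i < k)%N -> z' i = z i /\ d' i = d i].
Proof.
elim: m k z d => [|m IH] k z d mk fz hz.
  have kn : (k <= n)%N by move: fz; rewrite /row_free => /eqP {1}<-; apply: rank_leq_col.
  have E : k = n by lia.
  by subst k; exists z, d.
have kn : (k <= n)%N by move: fz; rewrite /row_free => /eqP {1}<-; apply: rank_leq_col.
have [E|nE] := eqVneq k n; first by subst k; exists z, d.
have [h [x hx]] : exists h x, ~~ (hproj h x <= rmx z k)%MS.
  apply: NNPP => ne; have : row_full (rmx z k).
    rewrite -sub1mx; apply/row_subP=> i; rewrite [row i _]hproj_sum; apply: summx_sub => h _.
    by apply/negPn/negP => nh; apply: ne; exists h, (row i 1%:M).
  by move: fz; rewrite /row_free /row_full => /eqP -> ; rewrite (negPf nE).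
pose z' i := if i == k then hproj h x else z i.
pose d' i := if i == k then h else d i.
have [|||z2 [d2 [f2 h2 [k2 e2]]]] := IH k.+1 z' d'.
- by lia.
- apply: row_free_ker => c; rewrite rmxE big_ord_recr /= /z' eqxx.
  under eq_bigr => i _ do rewrite ltn_eqF //.
  have [c0|c0] := eqVneq (c 0 ord_max) 0; last first.
    move/eqP; rewrite addrC addr_eq0 => /eqP E; case/negP: hx.
    rewrite -(scale1r (hproj h x)) -(mulVf c0) -scalerA scalemx_sub // E eqmx_opp.
    by apply: summx_sub => i _; rewrite scalemx_sub // -[z i](rowK (fun i : 'I_k => z i)) row_sub.
  rewrite c0 scale0r addr0 => E.
  have : (\row_(i < k) c 0 (widen_ord (leqnSn k) i)) *m rmx z k = 0.
    by rewrite rmxE -[RHS]E; apply: eq_bigr => i _; rewrite mxE.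
  move/eqP; rewrite mulmx_free_eq0 // => /eqP /rowP c1.
  apply/rowP=> i; rewrite [RHS]mxE; case: (ltnP i k) => ik.
    have := c1 (Ordinal ik); rewrite !mxE => <-; congr (c 0 _); exact: val_inj.
  rewrite -[RHS]c0; congr (c 0 _); apply: val_inj => /=.
  by apply/eqP; rewrite eqn_leq ik -ltnS ltn_ord.
- move=> i; rewrite ltnS leq_eqVlt /d' /z' => /predU1P [->|ik].
    by rewrite eqxx; apply: hproj_hdeg.
  by rewrite ltn_eqF //; apply: hz.
exists z2, d2; split=> //; split=> // i ik.
have [-> ->] := e2 i (ltnW ik); by rewrite /z' /d' ltn_eqF.
Qed.

Lemma homog_basis : exists (z : 'I_n -> 'rV[F]_n) (d : 'I_n -> D) (gam : D -> 'I_n),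
  [/\ forall i, hdeg gr (d i) (z i), forall h, glike H (z (gam h)),
      forall h, d (gam h) = h & \matrix_(i < n) z i \in unitmx].
Proof.
have /fin_all_exists2 [g gg gd] := glike_surj.
(* The chosen group-likes come first, in the order of the enumeration of [D]; the default 0 is only
   taken from [#|D|] on, where [basis_extend] replaces it. *)
pose z0 i := odflt 0 (omap (fun j : 'I_(#|D|) => g (enum_val j)) (insub i)).
pose d0 i := odflt 0 (omap (fun j : 'I_(#|D|) => enum_val j : D) (insub i)).
have z0E (i : 'I_(#|D|)) : z0 i = g (enum_val i) by rewrite /z0 valK.
have d0E (i : 'I_(#|D|)) : d0 i = enum_val i by rewrite /d0 valK.
have gpi_g h k : \sum_i g h 0 i * gpi gr k i = (k == h)%:R.
  have [h' [hh' e1]] := glike_hdeg (gg h).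
  have [j kd] := glike_deg hH idc gr (gg h).
  have hj : h' = j by move: (kd h'); rewrite e1; case: eqP => // _ /eqP; rewrite oner_eq0.
  have -> : \sum_i g h 0 i * gpi gr k i = ev (pp k) (g h).
    by apply: eq_bigr => i _; rewrite ffunE.
  rewrite kd; congr (_ %:R); congr (_ == _).
  have [a ga] : exists a, g h 0 a != 0.
    apply: NNPP => ne; have [_] := gg h; rewrite (_ : g h = 0) ?raddf0 => [/eqP|].
      by rewrite eq_sym oner_eq0.
    apply/rowP=> a; rewrite mxE; apply/eqP/negPn/negP => ga; apply: ne; by exists a.
  have := gd h j a; have := hh' j a; rewrite hj eqxx mul1r => -> /eqP.
  by case: (eqVneq j h) => [->//|_]; rewrite mul0r (negPf ga).
have [||z' [d' [f' h' [kn e']]]] := @basis_extend n #|D| z0 d0 (leq_subr _ _).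
(* Group-likes of distinct degrees are independent: apply the functional of degree [enum_val j] to a
   relation. *)
- apply: row_free_ker => c; rewrite rmxE => E; apply/rowP=> j; rewrite [RHS]mxE.
  have : \sum_i (\sum_k c 0 k *: z0 k) 0 i * gpi gr (enum_val j) i = 0.
    by rewrite E big1 // => i _; rewrite mxE mul0r.
  under eq_bigr => i _ do rewrite summxE mulr_suml.
  rewrite exchange_big (bigD1 j) //= [X in _ + X]big1 ?addr0.
    move=> Ej; rewrite -[RHS]Ej.
    under [RHS]eq_bigr => i _ do rewrite mxE -mulrA.
    by rewrite -mulr_sumr z0E gpi_g eqxx mulr1.
  move=> k kj; under eq_bigr => i _ do rewrite mxE -mulrA.
  rewrite -mulr_sumr z0E gpi_g (inj_eq enum_val_inj) eq_sym (negPf kj) mulr0 //.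
- by move=> i ik; rewrite -[i]/(nat_of_ord (Ordinal ik)) z0E d0E; apply: gd.
exists (fun i => z' i), (fun i => d' i), (fun h => widen_ord kn (enum_rank h)).
have zg h : z' (enum_rank h) = g h /\ d' (enum_rank h) = h.
  have [-> ->] := e' (enum_rank h) (ltn_ord _).
  by rewrite z0E d0E enum_rankK.
split=> [i|h|h|]; first exact: h'.
- by rewrite /= (zg h).1.
- exact: (zg h).2.
by rewrite -row_free_unit.
Qed.

End HomogBasis.

(** * Degrees of polynomials *)

Section PolyDegree.
Variables (F : fieldType) (n : nat) (D : finZmodType) (d : 'I_n -> D).

Definition mdg (m : 'X_{1..n}) : D := \sum_i d i *+ m i.

Lemma mdg0 : mdg 0%MM = 0.
Proof. by rewrite /mdg big1 // => i _; rewrite mnm0E. Qed.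

Lemma mdgD m m' : mdg (m + m')%MM = mdg m + mdg m'.
Proof. by rewrite -big_split; apply: eq_bigr => i _; rewrite mnmDE mulrnDr. Qed.

Lemma mdgU i : mdg U_(i)%MM = d i.
Proof.
rewrite /mdg (bigD1 i) //= mnm1E eqxx big1 ?addr0 // => j /negPf ji.
by rewrite mnm1E eq_sym ji.
Qed.

(** [S] is a set of degrees: [pred1 h] expresses homogeneity, [predC1 0] the absence of a part of
    degree 0. *)
Definition phom (S : pred D) (p : {mpoly F[n]}) := forall m, m \in msupp p -> S (mdg m).

Lemma phom0 S : phom S 0.
Proof. by move=> m; rewrite msupp0. Qed.

Lemma phomD S p q : phom S p -> phom S q -> phom S (p + q).
Proof. by move=> hp hq m /msuppD_le; rewrite mem_cat => /orP [/hp|/hq]. Qed.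

Lemma phomZ S c p : phom S p -> phom S (c *: p).
Proof. by move=> hp m /msuppZ_le /hp. Qed.

Lemma phom_sum S (I : Type) (r : seq I) (P : pred I) (p : I -> {mpoly F[n]}) :
  (forall i, P i -> phom S (p i)) -> phom S (\sum_(i <- r | P i) p i).
Proof. by move=> h; elim/big_ind: _ => //; [exact: phom0 | exact: phomD]. Qed.

Lemma phomM (S1 S2 S3 : pred D) p q : (forall h k, S1 h -> S2 k -> S3 (h + k)) ->
  phom S1 p -> phom S2 q -> phom S3 (p * q).
Proof.
move=> S123 hp hq m /msuppM_le /allpairsP [[m1 m2] /= [/hp s1 /hq s2 ->]].
by rewrite mdgD; apply: S123.
Qed.

Lemma phomX (S : pred D) m : S (mdg m) -> phom S 'X_[m].
Proof. by move=> Sm m'; rewrite msuppX inE => /eqP ->. Qed.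

Lemma phom1 : phom (pred1 0) 1.
Proof. by rewrite -mpolyX0; apply: phomX; rewrite mdg0 /=. Qed.

Lemma phomXn h k p : phom (pred1 h) p -> phom (pred1 (h *+ k)) (p ^+ k).
Proof.
move=> hp; elim: k => [|k IH]; first by rewrite expr0 mulr0n; exact: phom1.
rewrite exprS mulrS; apply: phomM hp IH => h' k' /= /eqP -> /eqP ->; exact: eqxx.
Qed.

Lemma phom_disj p : phom (pred1 0) p -> phom (predC1 0) p -> p = 0.
Proof.
move=> h1 h2; apply/eqP; rewrite -msupp_eq0; case E: (msupp p) => [//|m s].
have mp : m \in msupp p by rewrite E inE eqxx.
by have := h2 m mp; rewrite /= (eqP (h1 m mp)) eqxx.
Qed.
End PolyDegree.

(** * The degree zero part of [A] is [B] *)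

Section DegreeZero.
Variables (F : fieldType) (n : nat) (H : hopf_data F n) (hH : is_hopf H).
Variables (L : fieldType) (iota : central F L).
Local Notation C := (hco hH).
Variables t u : cv C iota.
Hypotheses (tu : t * u = 1) (ut : u * t = 1).
Variable B : L -> Prop.
Hypothesis Bc : forall c, B (iota c).
Hypothesis BD : forall a b, B a -> B b -> B (a + b).
Hypothesis BM : forall a b, B a -> B b -> B (a * b).
Hypothesis Bs : forall i, B (sigma t u i).
Hypothesis Bsi : forall i, B (sigmai t u i).
Hypothesis Bmin : forall P : L -> Prop, (forall c, P (iota c)) ->
  (forall a b, P a -> P b -> P (a + b)) -> (forall a b, P a -> P b -> P (a * b)) ->
  (forall i, P (sigma t u i)) -> (forall i, P (sigmai t u i)) -> forall z, B z -> P z.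
Variables (D : finZmodType) (gr : grading H D).
Hypothesis hpt : pointed H.
Variables (z : 'I_n -> 'rV[F]_n) (d : 'I_n -> D).
Hypothesis zd : forall i, hdeg gr (d i) (z i).
Local Notation Z := (\matrix_(i < n) z i).
Hypothesis Zu : Z \in unitmx.
Variable be : {rmorphism {mpoly F[n]} -> L}.
Hypothesis be_inj : injective be.
Hypothesis be_C : forall c, be c%:MP = iota c.
Hypothesis be_X : forall i, be 'X_i = ev t (z i).
Local Notation A := (tring t B).
Local Notation phom := (phom d).

Let A_0 : A 0. Proof. exact: (A_0 t Bc). Qed.
Let A_D x y : A x -> A y -> A (x + y). Proof. exact: (A_D BD). Qed.
Let A_B b x : B b -> A x -> A (b * x). Proof. exact: (A_B BM). Qed.
Let A_M x y : A x -> A y -> A (x * y). Proof. exact: (A_M ut Bc BD BM Bs). Qed.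
Let A_1 : A 1. Proof. exact: (A_1 tu Bc BD BM Bsi). Qed.
Let B_A b : B b -> A b. Proof. exact: (B_A tu Bc BD BM Bsi). Qed.
Let A_ug g : glike H g -> A (ev u g). Proof. exact: (A_ug tu ut Bc BD BM Bsi). Qed.

Lemma be_eq0 p : (be p == 0) = (p == 0).
Proof. by rewrite -(inj_eq be_inj) rmorph0. Qed.

Lemma A_exp x k : A x -> A (x ^+ k).
Proof. by move=> Ax; elim: k => [|k IH]; rewrite ?expr0 // exprS; apply: A_M. Qed.

(** Denominators of degree 0 make the degree of a fraction well defined. The record that 1/q lies in
    [A] later places 1/q in [B]. *)
Definition PS (S : pred D) (w : L) := exists p q,
  [/\ phom S p, phom (pred1 0) q, q != 0, A (be q)^-1 & w = be p / be q].

Lemma PS_poly S p : phom S p -> PS S (be p).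
Proof.
move=> hp; exists p, 1; split=> //; first exact: phom1.
- exact: oner_neq0.
- by rewrite rmorph1 invr1.
by rewrite rmorph1 divr1.
Qed.

Lemma PS_D S x y : PS S x -> PS S y -> PS S (x + y).
Proof.
move=> [p [q [hp hq q0 Aq ->]]] [p' [q' [hp' hq' q0' Aq' ->]]].
exists (p * q' + p' * q), (q * q').
have M0 r s : phom S r -> phom (pred1 0) s -> phom S (r * s).
  by apply: phomM => h k Sh /= /eqP ->; rewrite addr0.
split.
- by apply: phomD; apply: M0.
- by apply: phomM hq hq' => h k /= /eqP -> /eqP ->; rewrite addr0.
- by rewrite mulf_neq0.
- by rewrite rmorphM invfM; apply: A_M.
by rewrite addf_div ?be_eq0 // rmorphD !rmorphM.
Qed.

Lemma PS_M (S1 S2 S3 : pred D) x y : (forall h k, S1 h -> S2 k -> S3 (h + k)) ->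
  PS S1 x -> PS S2 y -> PS S3 (x * y).
Proof.
move=> S123 [p [q [hp hq q0 Aq ->]]] [p' [q' [hp' hq' q0' Aq' ->]]].
exists (p * p'), (q * q'); split.
- exact: phomM hp hp'.
- by apply: phomM hq hq' => h k /= /eqP -> /eqP ->; rewrite addr0.
- by rewrite mulf_neq0.
- by rewrite rmorphM invfM; apply: A_M.
by rewrite !rmorphM mulf_div.
Qed.

Lemma PS_disj x : PS (pred1 0) x -> PS (predC1 0) x -> x = 0.
Proof.
move=> [p [q [hp hq q0 Aq ->]]] [p' [q' [hp' hq' q0' Aq']]] /eqP.
rewrite eqr_div ?be_eq0 // -!rmorphM => /eqP /be_inj E.
have : p * q' = 0.
  apply: (phom_disj (d := d)).
    by apply: phomM hp hq' => h k /= /eqP -> /eqP ->; rewrite addr0.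
  rewrite E; apply: phomM hp' hq => h k /= h0 /eqP ->; by rewrite addr0.
by move/eqP; rewrite mulf_eq0 (negPf q0') orbF => /eqP ->; rewrite rmorph0 mul0r.
Qed.

Definition lf (x : 'rV[F]_n) : {mpoly F[n]} := \sum_i (x *m invmx Z) 0 i *: 'X_i.

Lemma coordE x : x = \sum_i (x *m invmx Z) 0 i *: z i.
Proof.
rewrite -{1}(mulmxKV Zu x) mulmx_sum_row; apply: eq_bigr => i _.
by rewrite rowK.
Qed.

Lemma be_lf x : be (lf x) = ev t x.
Proof.
rewrite {2}(coordE x) ev_sumr rmorph_sum; apply: eq_bigr => i _ /=.
by rewrite evZr -mul_mpolyC rmorphM be_C be_X.
Qed.

Lemma hdeg_coord h x i : hdeg gr h x -> d i != h -> (x *m invmx Z) 0 i = 0.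
Proof.
move=> hx di; pose c' := \row_i ((h == d i)%:R * (x *m invmx Z) 0 i).
have E : c' *m Z = x.
  apply/rowP=> a; transitivity ((h == h)%:R * x 0 a); last by rewrite eqxx mul1r.
  rewrite -hx {1}(coordE x) mxE.
  under [RHS]eq_bigr => b _ do rewrite raddf_sum summxE mulr_suml.
  rewrite exchange_big; apply: eq_bigr => j _ /=.
  transitivity ((x *m invmx Z) 0 j * \sum_b hcomul H (z j) a b * gpi gr h b).
    by rewrite zd !mxE; ring.
  by rewrite mulr_sumr; apply: eq_bigr => b _; rewrite linearZ /= !mxE; ring.
have <- : c' 0 i = (x *m invmx Z) 0 i by rewrite -{1}E mulmxK.
by rewrite mxE eq_sym (negPf di) mul0r.
Qed.

Lemma phom_lf h x : hdeg gr h x -> phom (pred1 h) (lf x).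
Proof.
move=> hx; apply: phom_sum => i _; have [di|di] := eqVneq (d i) h.
  by apply/phomZ/phomX; rewrite /= mdgU di.
by rewrite (hdeg_coord hx di) scale0r; apply: phom0.
Qed.

Local Notation pp := (pp hH iota gr).

Lemma ev_tpp h x : ev (t * pp h) x = ev t (hproj gr h x).
Proof.
rewrite evM_row; apply: eq_bigr => a _; rewrite mulrC; congr (_ * _).
rewrite mxE rmorph_sum; apply: eq_bigr => b _.
by rewrite mxE ffunE rmorphM.
Qed.

Lemma PS_gfam : gfam t gr (fun h => PS (pred1 h)).
Proof.
split.
- by move=> h; rewrite -(rmorph0 be); apply/PS_poly/phom0.
- by move=> h; exact: PS_D.
- by move=> h k x y; apply: PS_M => ? ? /= /eqP -> /eqP ->; exact: eqxx.
- move=> c; rewrite -be_C; apply: PS_poly.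
  by rewrite -[c%:MP]mulr1 mul_mpolyC; apply/phomZ/phom1.
- by move=> h i; rewrite -ev_bvec ev_tpp -be_lf; apply/PS_poly/phom_lf/hproj_hdeg.
move=> g h gg hg.
have hgd : hdeg gr h g.
  move=> k a; rewrite gg.1.
  have -> : (k == h)%:R = \sum_b g 0 b * gpi gr k b.
    apply: (fmorph_inj iota); rewrite rmorph_nat -hg rmorph_sum.
    by apply: eq_bigr => b _; rewrite ffunE rmorphM.
  by rewrite mulr_suml; apply: eq_bigr => b _; rewrite mxE big_ord1 !mxE; ring.
have tg0 := tg_neq0 tu gg.
pose N := #|D|.-1.
have DN : #|D| = N.+1 by rewrite prednK //; apply/card_gt0P; exists 0.
(* t_g^-1 = t_g^N / t_g^|D|, and the denominator has degree |D| h = 0. *)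
exists (lf g ^+ N), (lf g ^+ N.+1); split.
- have -> : - h = h *+ N.
    by apply/esym/eqP; rewrite -addr_eq0 -mulrSr -DN mulrn_card.
  exact/phomXn/phom_lf.
- by rewrite -(mulrn_card h) DN; exact/phomXn/phom_lf.
- by rewrite -be_eq0 rmorphXn be_lf expf_neq0.
- by rewrite rmorphXn be_lf -exprVn; apply: A_exp; rewrite -(ug tu gg); apply: A_ug.
rewrite !rmorphXn be_lf [X in _ / X]exprS invfM mulrCA mulfV ?mulr1 //.
by rewrite expf_neq0.
Qed.

Lemma B_PS x : B x -> PS (pred1 0) x.
Proof.
apply: (Bmin (P := PS (pred1 0))).
- exact: (gfc PS_gfam).
- exact: PS_D.
- by move=> a b; apply: PS_M => ? ? /= /eqP -> /eqP ->; rewrite addr0.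
- exact: (gf_sigma tu PS_gfam hpt).
exact: (gf_sigmai tu PS_gfam hpt).
Qed.

Let B1 : B 1. Proof. exact: (B1 Bc). Qed.
Let B0 : B 0. Proof. exact: (B0 Bc). Qed.

Definition MS (S : pred 'I_n) (w : L) := exists b0 b,
  [/\ B b0, (forall i, B (b i)) & w = b0 + \sum_(i | S i) b i * ev t (z i)].

Lemma MS_D S x y : MS S x -> MS S y -> MS S (x + y).
Proof.
move=> [b0 [b [h0 h ->]]] [c0 [c [k0 k ->]]].
exists (b0 + c0), (fun i => b i + c i); split=> [|i|]; try exact: BD.
rewrite addrACA -big_split; congr (_ + _); apply: eq_bigr => i _.
by rewrite mulrDl.
Qed.

Lemma MS_B S a x : B a -> MS S x -> MS S (a * x).
Proof.
move=> Ba [b0 [b [h0 h ->]]]; exists (a * b0), (fun i => a * b i); split=> [|i|]; try exact: BM.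
by rewrite mulrDr mulr_sumr; congr (_ + _); apply: eq_bigr => i _; rewrite mulrA.
Qed.

Lemma MS_1 S : MS S 1.
Proof.
by exists 1, (fun=> 0); split=> //; rewrite big1 ?addr0 // => i _; rewrite mul0r.
Qed.

Lemma MS_z (S : pred 'I_n) j : S j -> MS S (ev t (z j)).
Proof.
move=> Sj; exists 0, (fun i => (i == j)%:R); split=> // [i|]; first by case: eqP.
rewrite add0r (bigD1 j) //= eqxx mul1r big1 ?addr0 // => i /andP [_ /negPf ->].
by rewrite mul0r.
Qed.

Lemma A_MST x : A x -> MS predT x.
Proof.
move=> [b bB ->]; elim/big_ind: _ => [||i _]; [|exact: MS_D|apply: MS_B => //].
  by rewrite -(mul0r 1); apply: MS_B => //; exact: MS_1.
rewrite -ev_bvec (coordE (bvec i)) ev_sumr; elim/big_ind: _ => [||j _]; [|exact: MS_D|].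
  by rewrite -(mul0r 1); apply: MS_B => //; exact: MS_1.
by rewrite evZr; apply: MS_B => //; exact: MS_z.
Qed.

(** [drop_generator] removes the basis vectors of degree 0 one at a time, with the module spanned by
    the others as [M]. *)
Lemma A_MS (s : seq 'I_n) : (forall j, j \in s -> d j = 0) ->
  forall x, A x -> MS (fun i => i \notin s) x.
Proof.
elim: s => [_ x /A_MST [b0 [b [h0 h ->]]]|j s IH sd x Ax].
  by exists b0, b; split=> //; congr (_ + _); apply: eq_bigl => i.
have {}IH := IH (fun k ks => sd k (mem_behead (s := j :: s) ks)).
have AM y : A y -> exists2 c, B c & MS (fun i => i \notin j :: s) (y - c * ev t (z j)).
  (* [j] may occur again in [s]; it has then already been dropped. *)
  move=> /IH [b0 [b [h0 h ->]]]; have [js|js] := boolP (j \in s).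
    exists 0 => //; rewrite mul0r subr0; exists b0, b; split=> //; congr (_ + _).
    apply: eq_bigl => i; rewrite inE negb_or; case: eqP => [->|_] //=.
    by rewrite js.
  exists (b j) => //; exists b0, b; split=> //.
  rewrite (bigD1 j) //= addrCA [LHS]addrC addKr; congr (_ + _); apply: eq_bigl => i.
  by rewrite inE negb_or andbC.
have [c Bc' Mc] := AM x Ax.
rewrite -[x](subrK (c * ev t (z j))); apply: MS_D => //; apply: MS_B => //.
apply: (drop_generator (gr := gr) tu ut Bc BD BM Bs Bsi hpt _ _ _ _ AM) => [a b|b a||].
- exact: MS_D.
- exact: MS_B.
- exact: MS_1.
by rewrite -(sd j (mem_head _ _)).
Qed.

(** Once the generators of degree 0 are dropped, x - b0 is a combination of generators of nonzero
    degree; being also of degree 0, it vanishes. *)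
Lemma A_PS_B x : A x -> PS (pred1 0) x -> B x.
Proof.
move=> Ax Px.
have [|b0 [b [h0 h xE]]] := @A_MS [seq i <- enum 'I_n | d i == 0] _ x Ax.
  by move=> j; rewrite mem_filter => /andP [/eqP].
suff w0 : \sum_(i | i \notin [seq i <- enum 'I_n | d i == 0]) b i * ev t (z i) = 0.
  by rewrite xE w0 addr0.
apply: PS_disj.
  have -> : \sum_(i | i \notin [seq i <- enum 'I_n | d i == 0]) b i * ev t (z i) = x + (-1) * b0.
    by rewrite xE mulN1r addrAC subrr add0r.
  apply: PS_D => //; apply: B_PS; apply: BM => //.
  by rewrite -(rmorphN1 iota).
elim/big_ind: _ => [||i di]; first by rewrite -(rmorph0 be); apply/PS_poly/phom0.
  exact: PS_D.
apply: (@PS_M (pred1 0) (predC1 0)) => [h1 k1 /= /eqP -> k0||].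
- by rewrite add0r.
- exact: B_PS.
rewrite -be_X; apply/PS_poly/phomX; rewrite /= mdgU.
by move: di; rewrite mem_filter mem_enum andbT.
Qed.

Lemma A_be p : A (be p).
Proof.
rewrite (mpolyE p) rmorph_sum; elim/big_ind: _ => // m _.
rewrite -mul_mpolyC rmorphM be_C mpolyXE_id rmorph_prod; apply: A_B => //.
elim/big_ind: _ => // i _; rewrite rmorphXn be_X; apply: A_exp.
by apply: (A_ev Bc BD BM) => j; exact: (A_t t Bc).
Qed.

Lemma B_be p : phom (pred1 0) p -> B (be p).
Proof. by move=> hp; apply: A_PS_B; [exact: A_be | exact: PS_poly]. Qed.

Lemma B_be_inv p : phom (pred1 0) p -> p != 0 -> A (be p)^-1 -> B (be p)^-1.
Proof.
move=> hp p0 Ap; apply: A_PS_B => //; exists 1, p; split=> //; first exact: phom1.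
by rewrite rmorph1 mul1r.
Qed.

End DegreeZero.

(** * The localized polynomial algebra *)

Section MonomialBasis.
Variables (F : fieldType) (n : nat) (D : finZmodType) (d : 'I_n -> D) (gam : D -> 'I_n).
Hypothesis dgam : forall h, d (gam h) = h.
Local Notation mdg := (mdg d).
Local Notation phom := (phom d).

(** Whether index [j] is that of the group-like chosen in its degree. *)
Definition isg (j : 'I_n) := j == gam (d j).

Lemma isg_gam h : isg (gam h).
Proof. by rewrite /isg dgam. Qed.

Definition gmon (a : D -> nat) : 'X_{1..n} := [multinom if isg j then a (d j) else 0%N | j < n].

Lemma gmonE a j : gmon a j = if isg j then a (d j) else 0%N.
Proof. by rewrite mnmE. Qed.

Lemma sum_isg (V : nmodType) (f : 'I_n -> V) : \sum_(j | isg j) f j = \sum_h f (gam h).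
Proof.
rewrite (reindex_onto gam d) => [|j /eqP <- //].
by apply: eq_bigl => h; rewrite isg_gam dgam eqxx.
Qed.

Lemma mdg_gmon a : mdg (gmon a) = dg a.
Proof.
rewrite /mdg (bigID isg) /= [X in _ + X]big1 ?addr0 => [|j /negPf jg]; last first.
  by rewrite gmonE jg mulr0n.
by rewrite sum_isg; apply: eq_bigr => h _; rewrite gmonE isg_gam dgam.
Qed.

Lemma gmonD a a' : gmon (fun h => a h + a' h)%N = (gmon a + gmon a')%MM.
Proof. by apply/mnmP=> j; rewrite mnmDE !gmonE; case: isg. Qed.

Lemma eq_gmon a a' : a =1 a' -> gmon a = gmon a'.
Proof. by move=> aa; apply/mnmP=> j; rewrite !gmonE aa. Qed.

Variable b : D -> D -> nat.
Hypothesis b1 : forall k, dg (b k) = 0.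
Hypothesis b3 : forall c c' : D -> nat,
  (forall h, \sum_k c k * b k h = \sum_k c' k * b k h)%N -> c =1 c'.
Hypothesis b4 : forall a : D -> nat, dg a = 0 -> exists c c' : D -> nat, forall h,
  (a h + \sum_k c' k * b k h = \sum_k c k * b k h)%N.

Definition mu (i : 'I_n) : 'X_{1..n} :=
  if isg i then gmon (b (d i)) else (U_(i) + U_(gam (- d i)))%MM.

Lemma mdg_mu i : mdg (mu i) = 0.
Proof.
rewrite /mu; case: ifP => _; first by rewrite mdg_gmon b1.
by rewrite mdgD !mdgU dgam subrr.
Qed.

(** Exponents, in the original variables, of the monomial [m] in the [n] generators. *)
Definition EE (m : 'X_{1..n}) : 'X_{1..n} := (\big[mnm_add/0%MM]_(i < n) (mu i *+ m i))%MM.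

Lemma EE_E m j : EE m j = (\sum_i mu i j * m i)%N.
Proof. by rewrite /EE mnm_sumE; apply: eq_bigr => i _; rewrite mulmnE. Qed.

Lemma EE_D m m' : EE (m + m')%MM = (EE m + EE m')%MM.
Proof.
apply/mnmP=> j; rewrite mnmDE !EE_E -big_split; apply: eq_bigr => i _ /=.
by rewrite mnmDE mulnDr.
Qed.

Lemma mdg_EE m : mdg (EE m) = 0.
Proof.
rewrite /mdg; under eq_bigr => j _ do rewrite EE_E -sumrMnr.
rewrite exchange_big big1 // => i _.
under eq_bigr => j _ do rewrite mulrnA.
by rewrite sumrMnl -/(mdg _) mdg_mu mul0rn.
Qed.

Lemma EE_nong m j : ~~ isg j -> EE m j = m j.
Proof.
move=> jg; rewrite EE_E (bigD1 j) //= big1 ?addn0.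
  rewrite /mu (negPf jg) mnmDE !mnm1E eqxx.
  have -> : (gam (- d j) == j) = false by apply: contraNF jg => /eqP <-; exact: isg_gam.
  by rewrite addn0 mul1n.
move=> i ij; rewrite /mu; case: ifP => ig; first by rewrite gmonE (negPf jg) mul0n.
rewrite mnmDE !mnm1E (negPf ij).
have -> : (gam (- d i) == j) = false by apply: contraNF jg => /eqP <-; exact: isg_gam.
by [].
Qed.

(** The exponent of the group-like variable of degree [h] that comes from the paired generators,
    those with [~~ isg i]. *)
Definition rest (m : 'X_{1..n}) (h : D) : nat := (\sum_(i | ~~ isg i) (h == - d i) * m i)%N.

Lemma EE_gam m h : EE m (gam h) = (\sum_k m (gam k) * b k h + rest m h)%N.
Proof.
rewrite EE_E (bigID isg) /= sum_isg; congr addn; apply: eq_bigr => i.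
  by move=> _; rewrite /mu isg_gam gmonE isg_gam !dgam mulnC.
move=> /negPf ig; rewrite /mu ig mnmDE !mnm1E; congr muln.
have -> : (i == gam h) = false by apply: contraFF ig => /eqP ->; exact: isg_gam.
rewrite add0n; congr nat_of_bool; rewrite eq_sym; apply/eqP/eqP => [|-> //].
by move=> /(congr1 d); rewrite !dgam.
Qed.

(** Triangularity: exponents outside the group-likes are read off by [EE_nong] and determine [rest];
    what is left is the independence [b3] of the lattice basis. *)
Lemma EE_inj : injective EE.
Proof.
move=> m m' E.
have Eng j : ~~ isg j -> m j = m' j by move=> jg; rewrite -(EE_nong m jg) E EE_nong.
have Er h : rest m h = rest m' h by apply: eq_bigr => i ig; rewrite Eng.
have Eg : (fun k => m (gam k)) =1 (fun k => m' (gam k)).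
  apply: b3 => h; have := EE_gam m' h.
  by rewrite -E EE_gam Er => /addIn.
apply/mnmP=> j; have [jg|/Eng //] := boolP (isg j).
by have := Eg (d j); rewrite -(eqP jg).
Qed.

Lemma EE_gmon c : EE (gmon c) = gmon (fun h => \sum_k c k * b k h)%N.
Proof.
apply/mnmP=> j; rewrite gmonE; case: ifP => jg; last by rewrite EE_nong ?jg // gmonE jg.
transitivity (EE (gmon c) (gam (d j))); first by rewrite -(eqP jg).
rewrite EE_gam -[RHS]addn0; congr addn.
  by apply: eq_bigr => k _; rewrite gmonE isg_gam dgam.
by apply: big1 => i /negPf ig; rewrite gmonE ig muln0.
Qed.

Lemma EE_gen m : mdg m = 0 -> exists e c, (m + EE (gmon e) = EE c)%MM.
Proof.
move=> m0.
(* [c0] produces the part of [m] outside the group-likes, at the price of the surplus group-like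
   exponents [G]. *)
pose c0 : 'X_{1..n} := [multinom if isg j then 0%N else m j | j < n].
pose a1 h := m (gam h).
pose G := rest m.
have c0E j : c0 j = if isg j then 0%N else m j by rewrite mnmE.
have E1 : (m + gmon G = EE c0 + gmon a1)%MM.
  apply/mnmP=> j; rewrite !mnmDE !gmonE; case: ifP => jg; last first.
    by rewrite EE_nong ?jg // c0E jg.
  have -> : EE c0 j = EE c0 (gam (d j)) by rewrite -(eqP jg).
  rewrite EE_gam big1 => [|k _]; last by rewrite c0E isg_gam.
  rewrite add0n /a1 -(eqP jg) addnC; congr addn.
  by apply: eq_bigr => i ig; rewrite c0E (negPf ig).
have dE : dg G = dg a1.
  have := congr1 mdg E1; rewrite !mdgD m0 mdg_EE !mdg_gmon !add0r //.
pose N := #|D|.-1.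
have DN : #|D| = N.+1 by rewrite prednK //; apply/card_gt0P; exists 0.
(* The missing correction a1 - G is written (a1 + N G) - |D| G, a difference of two natural exponent
   vectors that both have degree 0. *)
have [f1 [e1 H1]] : exists c c' : D -> nat, forall h,
    ((a1 h + N * G h) + \sum_k c' k * b k h = \sum_k c k * b k h)%N.
  by apply: b4; rewrite dgD dgZ dE -mulrS -DN mulrn_card.
have [f2 [e2 H2]] : exists c c' : D -> nat, forall h,
    (#|D| * G h + \sum_k c' k * b k h = \sum_k c k * b k h)%N.
  by apply: b4; rewrite dgZ mulrn_card.
exists (fun h => f2 h + e1 h)%N, (c0 + gmon f1 + gmon e2)%MM.
rewrite !EE_D gmonD EE_D !EE_gmon -(eq_gmon H1) -(eq_gmon H2).
apply/mnmP=> j; move/mnmP/(_ j): E1; rewrite !mnmDE !gmonE.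
by case: isg; rewrite ?DN ?mulSn; lia.
Qed.

Definition ysub : n.-tuple {mpoly F[n]} := [tuple 'X_[mu i] | i < n].
Definition ymap (p : {mpoly F[n]}) : {mpoly F[n]} := p \mPo ysub.

Lemma ymapX m : ymap 'X_[m] = 'X_[EE m].
Proof.
rewrite /ymap comp_mpolyX /EE -mprodXE; apply: eq_bigr => i _.
by rewrite tnth_mktuple mpolyXn.
Qed.

Lemma ymapE p : ymap p = \sum_(m <- msupp p) p@_m *: 'X_[EE m].
Proof.
by rewrite /ymap comp_mpolyEX; apply: eq_bigr => m _; rewrite -ymapX.
Qed.

Lemma ymap_coef p m : (ymap p)@_(EE m) = p@_m.
Proof.
rewrite ymapE raddf_sum /=.
under eq_bigr => m' _ do rewrite mcoeffZ mcoeffX (inj_eq EE_inj).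
have [mp|mp] := boolP (m \in msupp p).
  rewrite (bigD1_seq m) ?msupp_uniq //= eqxx mulr1 big1 ?addr0 // => m' /negPf ->.
  by rewrite mulr0.
rewrite (memN_msupp_eq0 mp); apply: big1_seq => m' /andP [_ m'p].
by case: eqP => [E|]; rewrite ?mulr0 // -E m'p in mp *.
Qed.

Lemma ymap_inj : injective ymap.
Proof. by move=> p q E; apply/mpolyP=> m; rewrite -(ymap_coef p) -(ymap_coef q) E. Qed.

Lemma phom_ymap p : phom (pred1 0) (ymap p).
Proof.
rewrite ymapE; apply: phom_sum => m _; apply/phomZ/phomX.
by rewrite /= mdg_EE.
Qed.

(** [EE_gen] clears the negative exponents of each term; the product of the clearing monomials
    serves for all terms. *)
Lemma ymap_gen p : phom (pred1 0) p ->
  exists e p', p * 'X_[EE (gmon e)] = ymap p'.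
Proof.
elim/mpolyind: p => [_|c m p mp c0 IH hp].
  by exists (fun=> 0%N), 0; rewrite mul0r /ymap comp_mpoly0.
have cf m' : (c *: 'X_[m] + p)@_m' = c * (m == m')%:R + p@_m'.
  by rewrite mcoeffD mcoeffZ mcoeffX.
have [|e1 [p1 E1]] := IH.
  move=> m' m'p; apply: hp; rewrite mcoeff_msupp cf.
  case: (eqVneq m m') => [E|_]; first by rewrite E m'p in mp.
  by rewrite mulr0 add0r -mcoeff_msupp.
have m0 : mdg m = 0.
  apply/eqP/hp; rewrite mcoeff_msupp cf eqxx mulr1 (memN_msupp_eq0 mp) addr0 //.
have [e2 [c2 E2]] := EE_gen m0.
exists (fun h => e1 h + e2 h)%N, (c *: ('X_[c2] * 'X_[gmon e1]) + p1 * 'X_[gmon e2]).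
rewrite gmonD EE_D mpolyXD /ymap comp_mpolyD comp_mpolyZ !rmorphM /= -!/(ymap _) !ymapX -E1 -E2 mpolyXD.
rewrite -!mul_mpolyC; ring.
Qed.

Variables (L : fieldType) (iota : F -> L) (be : {rmorphism {mpoly F[n]} -> L}).
Hypothesis be_inj : injective be.
Hypothesis be_C : forall c, be c%:MP = iota c.
Variable B : L -> Prop.
Hypothesis BM : forall x y, B x -> B y -> B (x * y).
Hypothesis B_be : forall p, phom (pred1 0) p -> B (be p).
Hypothesis B_frac : forall x, B x -> exists p q,
  [/\ phom (pred1 0) p, phom (pred1 0) q, q != 0, B (be q)^-1 & x = be p / be q].
Hypothesis B_mon : forall a, dg a = 0 -> B (be 'X_[gmon a])^-1.

Definition yb (p : {mpoly F[n]}) : L := be (ymap p).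

Lemma ybM p q : yb (p * q) = yb p * yb q.
Proof. by rewrite /yb /ymap !rmorphM. Qed.
Lemma ybD p q : yb (p + q) = yb p + yb q.
Proof. by rewrite /yb /ymap !rmorphD. Qed.
Lemma yb1 : yb 1 = 1.
Proof. by rewrite /yb /ymap !rmorph1. Qed.
Lemma ybC c : yb c%:MP = iota c.
Proof. by rewrite /yb /ymap comp_mpolyC be_C. Qed.
Lemma yb_inj : injective yb.
Proof. by move=> p q /be_inj /ymap_inj. Qed.
Lemma yb_neq0 p : p != 0 -> yb p != 0.
Proof.
apply: contra => /eqP p0; apply/eqP/yb_inj.
by rewrite p0 /yb /ymap !rmorph0.
Qed.

(** The largest admissible set of denominators: everything that [B] inverts. *)
Definition TT (p : {mpoly F[n]}) := p != 0 /\ B (yb p)^-1.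

Lemma B_1 : B 1.
Proof. by rewrite -(rmorph1 be); apply/B_be/phom1. Qed.

Lemma TT_mult : mult_subset TT.
Proof.
split.
- by split; [exact: oner_neq0 | rewrite yb1 invr1; exact: B_1].
- by move=> [/eqP].
move=> p q [p0 Bp] [q0 Bq]; split; first by rewrite mulf_neq0.
by rewrite ybM invfM; apply: BM.
Qed.

Local Notation toF := (@FracField.tofrac {mpoly F[n]}).

(** The graph of the isomorphism. [Rel_iff] makes it single-valued in both directions, so the two
    maps can be chosen from it at the end. *)
Definition Rel (x : L) (w : {fraction {mpoly F[n]}}) :=
  exists p q, [/\ TT q, x = yb p / yb q & w = toF p / toF q].

Lemma Rel_ex x : B x -> exists w, Rel x w.
Proof.
move=> Bx; have [p [q [hp hq q0 Bq xE]]] := B_frac Bx.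
have [e1 [p' E1]] := ymap_gen hp; have [e2 [q' E2]] := ymap_gen hq.
have X0 m : 'X_[m] != 0 :> {mpoly F[n]} by rewrite -msupp_eq0 msuppX.
have bX m : be 'X_[m] != 0 by rewrite -(rmorph0 be) (inj_eq be_inj).
have ybg e : yb 'X_[gmon e] = be 'X_[EE (gmon e)] by rewrite /yb ymapX.
have q1 : yb (q' * 'X_[gmon e1]) = be q * be 'X_[EE (gmon e2)] * be 'X_[EE (gmon e1)].
  by rewrite ybM ybg {1}/yb -E2 rmorphM.
have bq0 : be q != 0 by rewrite -(rmorph0 be) (inj_eq be_inj).
(* If x = p / q, where p and q become [p'] and [q'] in the generators after multiplication by
   lattice monomials of exponents [e1] and [e2], then each monomial reappears on the other side of
   the fraction. *)
exists (toF (p' * 'X_[gmon e2]) / toF (q' * 'X_[gmon e1])).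
exists (p' * 'X_[gmon e2]), (q' * 'X_[gmon e1]); split=> //.
  split.
    apply/eqP => z0; have := q1; rewrite z0 /yb /ymap !rmorph0 => /esym /eqP.
    by rewrite !mulf_eq0 (negPf bq0) !(negPf (bX _)).
  have BE e : B (be 'X_[EE (gmon e)])^-1.
    by rewrite EE_gmon; apply: B_mon; rewrite -mdg_gmon -EE_gmon mdg_EE.
  by rewrite q1 !invfM; do !apply: BM.
rewrite q1 ybM ybg {1}/yb -E1 rmorphM xE; apply/eqP.
by rewrite eqr_div ?mulf_neq0 //; apply/eqP; ring.
Qed.

Lemma Rel_loc x w : Rel x w -> in_localization TT w.
Proof. by move=> [p [q [Tq _ ->]]]; exists p, q. Qed.

Lemma Rel_B x w : Rel x w -> B x.
Proof.
by move=> [p [q [[_ Bq] -> _]]]; apply: BM => //; apply/B_be/phom_ymap.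
Qed.

Lemma toF_neq0 (p : {mpoly F[n]}) : p != 0 -> toF p != 0.
Proof. by rewrite tofrac_eq0. Qed.

Lemma Rel_iff x w x' w' : Rel x w -> Rel x' w' -> x = x' <-> w = w'.
Proof.
move=> [p [q [[q0 _] -> ->]]] [p' [q' [[q0' _] -> ->]]].
have E1 : yb p / yb q == yb p' / yb q' = (p * q' == p' * q).
  by rewrite eqr_div ?yb_neq0 // -!ybM (inj_eq yb_inj).
have E2 : toF p / toF q == toF p' / toF q' = (p * q' == p' * q).
  by rewrite eqr_div ?toF_neq0 // -!tofracM tofrac_eq.
by split=> /eqP; rewrite ?E1 ?E2 => h; apply/eqP; rewrite ?E1 ?E2.
Qed.

Lemma Rel_D x w x' w' : Rel x w -> Rel x' w' -> Rel (x + x') (w + w').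
Proof.
move=> [p [q [Tq -> ->]]] [p' [q' [Tq' -> ->]]].
exists (p * q' + p' * q), (q * q'); split; first by case: TT_mult => _ _; apply.
  by rewrite addf_div ?yb_neq0 ?Tq.1 ?Tq'.1 // ybD !ybM.
by rewrite addf_div ?toF_neq0 ?Tq.1 ?Tq'.1 // tofracD !tofracM.
Qed.

Lemma Rel_M x w x' w' : Rel x w -> Rel x' w' -> Rel (x * x') (w * w').
Proof.
move=> [p [q [Tq -> ->]]] [p' [q' [Tq' -> ->]]].
exists (p * p'), (q * q'); split; first by case: TT_mult => _ _; apply.
  by rewrite !ybM mulf_div.
by rewrite !tofracM mulf_div.
Qed.

Lemma Rel_C c : Rel (iota c) (fconst n c).
Proof.
exists c%:MP, 1; split; first by case: TT_mult.
  by rewrite ybC yb1 divr1.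
by rewrite tofrac1 divr1.
Qed.

Lemma Rel_1 : Rel 1 1.
Proof.
have := Rel_C 1; rewrite -be_C mpolyC1 rmorph1.
by rewrite /fconst mpolyC1 tofrac1.
Qed.

Lemma localization_iso : alg_iso_on iota (@fconst F n) B (in_localization TT).
Proof.
pose f x := epsilon (inhabits 0) (fun w => Rel x w).
pose g w := epsilon (inhabits 0) (fun x => Rel x w).
have fP x : B x -> Rel x (f x) by move=> /Rel_ex; apply: epsilon_spec.
have gP w : in_localization TT w -> Rel (g w) w.
  move=> [p [q [Tq wE]]]; apply: (epsilon_spec (inhabits 0) (fun x => Rel x w)).
  by exists (yb p / yb q), p, q.
have fE x w : Rel x w -> f x = w.
  by move=> Rxw; apply/(Rel_iff (fP _ (Rel_B Rxw)) Rxw).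
have gE x w : Rel x w -> g w = x.
  by move=> Rxw; apply/(Rel_iff (gP _ (Rel_loc Rxw)) Rxw).
exists f, g; split.
- by split=> [x /fP /Rel_loc|w /gP /Rel_B].
- by split=> [x /fP /gE|w /gP /fE].
- exact/fE/Rel_1.
- by move=> x y /fP Rx /fP Ry; split; apply: fE; [apply: Rel_D | apply: Rel_M].
by move=> c x /fP Rx; apply: fE; apply: Rel_M => //; apply: Rel_C.
Qed.

End MonomialBasis.

(** * The generic base algebra in convolution form *)

Section Generic.
Variables (F : fieldType) (n : nat) (H : hopf_data F n) (hH : is_hopf H).
Local Notation L := {fraction {mpoly F[n]}}.
Local Notation toF := (@FracField.tofrac {mpoly F[n]}).

Definition fc : central F L :=
  @Central F L (toF \o @mpolyC n F : {rmorphism F -> L}) (fun c x => mulrC _ _).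

Variable u : 'I_n -> L.
Hypothesis hu : is_tinv H u.

Definition tcv : cv (hco hH) fc := [ffun i => tvar (bvec i)].
Definition ucv : cv (hco hH) fc := [ffun i => u i].

Lemma tvar_ev x : tvar x = ev tcv x.
Proof.
rewrite /tvar /ev rmorph_sum; apply: eq_bigr => i _; rewrite ffunE.
rewrite -mul_mpolyC rmorphM; congr (_ * _).
by rewrite /tvar sum_bvec.
Qed.

Lemma tinv_ev x : tinv_of u x = ev ucv x.
Proof. by apply: eq_bigr => i _; rewrite ffunE. Qed.

Lemma tinv_bvec i : tinv_of u (bvec i) = u i.
Proof. by rewrite tinv_ev ev_bvec ffunE. Qed.

Lemma tcv_ucv : tcv * ucv = 1.
Proof.
apply/ffunP=> i; rewrite -!ev_bvec ev1 evM -[RHS](hu (bvec i)).1.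
by apply: eq_bigr => a _; apply: eq_bigr => b _; rewrite !ffunE tinv_bvec.
Qed.

Lemma ucv_tcv : ucv * tcv = 1.
Proof.
apply/ffunP=> i; rewrite -!ev_bvec ev1 evM -[RHS](hu (bvec i)).2.
by apply: eq_bigr => a _; apply: eq_bigr => b _; rewrite !ffunE tinv_bvec.
Qed.

Lemma Mm_ev (f : cv (hco hH) fc) i j : Mm f (i, j) = ev f (hmul H (bvec i) (bvec j)).
Proof. by rewrite -ev2_mm ev2_bvec. Qed.

Lemma gsigma_ev x y : gsigma H u x y = ev2 (sigma tcv ucv) x y.
Proof.
rewrite ev2M; apply: eq_bigr => a _; apply: eq_bigr => b _.
apply: eq_bigr => c _; apply: eq_bigr => d _.
by rewrite T12E Mm_ev tinv_ev !tvar_ev !ev_bvec.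
Qed.

Lemma gsigmainv_ev x y : gsigmainv H u x y = ev2 (sigmai tcv ucv) x y.
Proof.
rewrite ev2M; apply: eq_bigr => a _; apply: eq_bigr => b _.
apply: eq_bigr => c _; apply: eq_bigr => d _.
by rewrite T12E Mm_ev !tinv_ev !tvar_ev !ev_bvec -(mulrA (ev tcv _)).
Qed.

Lemma BH_c c : in_BH H u (fc c). Proof. by move=> P Pc *; apply: Pc. Qed.
Lemma BH_D a b : in_BH H u a -> in_BH H u b -> in_BH H u (a + b).
Proof. by move=> ha hb P h1 h2 h3 h4 h5; exact: (h2 _ _ (ha P h1 h2 h3 h4 h5) (hb P h1 h2 h3 h4 h5)). Qed.
Lemma BH_M a b : in_BH H u a -> in_BH H u b -> in_BH H u (a * b).
Proof. by move=> ha hb P h1 h2 h3 h4 h5; exact: (h3 _ _ (ha P h1 h2 h3 h4 h5) (hb P h1 h2 h3 h4 h5)). Qed.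
Lemma BH_s i : in_BH H u (sigma tcv ucv i).
Proof.
case: i => i j; rewrite -ev2_bvec -gsigma_ev.
by move=> P h1 h2 h3 h4 h5; apply: h4.
Qed.
Lemma BH_si i : in_BH H u (sigmai tcv ucv i).
Proof.
case: i => i j; rewrite -ev2_bvec -gsigmainv_ev.
by move=> P h1 h2 h3 h4 h5; apply: h5.
Qed.

(** By bilinearity of sigma and sigma^-1, generators at pairs of basis vectors suffice. *)
Lemma BH_min (P : L -> Prop) : (forall c, P (fc c)) ->
  (forall a b, P a -> P b -> P (a + b)) -> (forall a b, P a -> P b -> P (a * b)) ->
  (forall i, P (sigma tcv ucv i)) -> (forall i, P (sigmai tcv ucv i)) ->
  forall x, in_BH H u x -> P x.
Proof.
move=> Pc PD PM Ps Psi x; apply=> //.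
  by move=> y z; rewrite gsigma_ev; apply: (B_ev2 Pc PD PM).
by move=> y z; rewrite gsigmainv_ev; apply: (B_ev2 Pc PD PM).
Qed.

Section Coordinates.
Variable Z : 'M[F]_n.
Hypothesis Zu : Z \in unitmx.

Definition lin (M : 'M[F]_n) : n.-tuple {mpoly F[n]} :=
  [tuple \sum_j M i j *: 'X_j | i < n].

Lemma linK : cancel (comp_mpoly (lin Z)) (comp_mpoly (lin (invmx Z))).
Proof.
have XE i : (tnth (lin Z) i) \mPo lin (invmx Z) = 'X_i.
  rewrite tnth_mktuple raddf_sum /=.
  under eq_bigr => j _ do rewrite comp_mpolyZ comp_mpolyXU -tnth_nth tnth_mktuple scaler_sumr.
  rewrite exchange_big /=.
  under eq_bigr => k _ do under eq_bigr => j _ do rewrite scalerA.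
  have VE k : \sum_j Z i j * invmx Z j k = (i == k)%:R.
    by have /matrixP/(_ i k) := mulmxV Zu; rewrite !mxE.
  under eq_bigr => k _ do rewrite -scaler_suml VE.
  rewrite (bigD1 i) //= eqxx scale1r big1 ?addr0 // => k /negPf ki.
  by rewrite eq_sym ki scale0r.
move=> p; rewrite [RHS]mpolyE {1}(mpolyE p) (raddf_sum (comp_mpoly (lin Z))).
rewrite (raddf_sum (comp_mpoly _)); apply: eq_bigr => m _ /=.
rewrite !comp_mpolyZ comp_mpolyX rmorph_prod mpolyXE_id; congr (_ *: _).
by apply: eq_bigr => i _; rewrite rmorphXn /= XE.
Qed.

(** Linear change of variables from the given basis of H to the rows of [Z], later the homogeneous
    basis. *)
Definition bet : {rmorphism {mpoly F[n]} -> L} := toF \o comp_mpoly (lin Z).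

Lemma bet_inj : injective bet.
Proof.
move=> p q /= /eqP; rewrite tofrac_eq => /eqP; exact: (can_inj linK).
Qed.

Lemma bet_C c : bet c%:MP = fc c.
Proof. by rewrite /= comp_mpolyC. Qed.

Lemma bet_X i : bet 'X_i = ev tcv (row i Z).
Proof.
rewrite -tvar_ev /= comp_mpolyXU -tnth_nth tnth_mktuple /tvar; congr (toF _).
by apply: eq_bigr => j _; rewrite mxE.
Qed.
End Coordinates.

End Generic.

Theorem theorem4p4 (F : fieldType) (n : nat) (H : hopf_data F n)
    (hH : is_hopf H) (hpt : pointed H)
    (m : nat) (Q : hopf_data F m) (P : 'M[F]_(n, m)) (hab : is_abelianization H Q P)
    (gT : finGroupType) (Phi : 'M[F]_(m, #|gT|))
    (hiso : hopf_iso Q (group_algebra F gT) Phi)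
    (u : 'I_n -> {fraction {mpoly F[n]}}) (hu : is_tinv H u) :
  exists (k : nat) (T : {mpoly F[k]} -> Prop),
    mult_subset T /\
    alg_iso_on (@fconst F n) (@fconst F k) (in_BH H u) (in_localization T).
Proof.
pose D : finZmodType := abz (group_mulC hab hiso).
pose gr : grading H D := group_grading hH hab hiso.
have [z [d [gam [zd zg dgam Zu]]]] := homog_basis hH gr hpt.
have tu := tcv_ucv hH hu; have ut := ucv_tcv hH hu.
set t := tcv hH in tu ut; set v := ucv hH u in tu ut.
pose Z := \matrix_(i < n) z i.
pose be := bet Z.
have be_inj : injective be := bet_inj Zu.
have be_X i : be 'X_i = ev t (z i) by rewrite /be (bet_X hH) rowK.
have be_C c : be c%:MP = fc F n c := bet_C Z c.
have Bc := @BH_c _ _ H u; have BD := @BH_D _ _ H u; have BM := @BH_M _ _ H u.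
have Bs := @BH_s _ _ H hH u; have Bsi := @BH_si _ _ H hH u.
have Bmin := @BH_min _ _ H hH u.
set B := in_BH H u in Bc BD BM Bs Bsi Bmin *.
have Bbe := B_be tu ut Bc BD BM Bs Bsi Bmin hpt zd Zu be_inj be_C be_X.
have Binv := B_be_inv tu ut Bc BD BM Bs Bsi Bmin hpt zd Zu be_inj be_C be_X.
have BPS := B_PS tu ut Bc BD BM Bs Bsi Bmin hpt zd Zu be_inj be_C be_X.
have [b [b1 _ b3 b4]] := lattice (enum_uniq D).
have b1' k : dg (b k) = 0 by apply: b1; rewrite mem_enum.
have b3' c c' : (forall h, \sum_k c k * b k h = \sum_k c' k * b k h)%N -> c =1 c'.
  move=> E k; apply: b3; last by rewrite mem_enum.
  by move=> h; rewrite !big_enum /=.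
have b4' a : dg a = 0 -> exists c c' : D -> nat, forall h,
    (a h + \sum_k c' k * b k h = \sum_k c k * b k h)%N.
  move=> a0; have [|c [c' E]] := b4 a _ a0; first by move=> h; rewrite mem_enum.
  by exists c, c' => h; have := E h; rewrite !big_enum /=.
have Bfrac x : B x -> exists p q, [/\ phom d (pred1 0) p, phom d (pred1 0) q, q != 0,
    B (be q)^-1 & x = be p / be q].
  move=> /BPS [p [q [hp hq q0 Aq ->]]]; exists p, q; split=> //; exact: Binv.
(* The inverse is a product of elements t_g^-1 of [A] and has total degree 0, so it lies in [B]. *)
have Bmon a : dg a = 0 -> B (be 'X_[gmon d gam a])^-1.
  move=> a0; apply: Binv.
  - by apply: phomX; rewrite /= mdg_gmon // a0.
  - by rewrite -msupp_eq0 msuppX.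
  rewrite mpolyXE_id rmorph_prod -prodfV; elim/big_ind: _ => [|x y|i _].
  - exact: (A_1 tu Bc BD BM Bsi).
  - exact: (A_M ut Bc BD BM Bs).
  rewrite gmonE rmorphXn be_X -exprVn; case: ifP => [/eqP ->|_]; last first.
    by rewrite expr0; exact: (A_1 tu Bc BD BM Bsi).
  apply: (A_exp tu ut Bc BD BM Bs Bsi).
  rewrite -(ug tu (zg _)); exact: (A_ug tu ut Bc BD BM Bsi).
(* The number of variables is the dimension of H. *)
exists n, (TT d gam b be B); split.
  by apply: TT_mult.
exact: (localization_iso dgam b1' b3' b4' be_inj be_C BM Bbe Bfrac Bmon).
Qed.
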